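(* Let $q\ge 0$ and $p\ge 2$ be integers and consider the superposition of $(q+1)$-th order Gaussian beams described in the context, under assumptions (A1)–(A5). There is $\alpha_0>0$, depending on $\phi$ but not on $\omega$, such that for a cut-off of size $\alpha\le\alpha_0$ the following holds. Put $E^T(x)=u_s(x)-\tilde u_s(x)$ (Taylor expansion error) and $E^D(x)=\tilde u_s(x)-\tilde u_s^D(x)$ (discretization error), and $$q^*=\begin{cases} q+2, & q \text{ even},\\ q+1, & q\text{ odd}.\end{cases}$$ There are constants $C,C'$, depending on $p$ and on the beams (their initial data) but not on $x$, $\omega$ or $h$, such that for all $x\in\mathbb{R}$, all $\omega>\omega_0$ and all $h>0$: $$|u_s(x)-\tilde u_s^D(x)|\le |E^T(x)|+|E^D(x)|,$$ $$|E^T(x)|\le C\,\omega^{-q^*/2},\qquad |E^D(x)|\le C\left(\frac{h}{\eta(x)}\right)^p,$$ and $$\left|E^T(x)-C^*(x)\,\omega^{1/2}\,\eta(x)^{q^*+1}\right|\le C'\,\omega^{1/2}\,\eta(x)^{q^*+2},$$ where $\eta(x)$ is the beam width and $C^*(x)$ is the explicit coefficient defined in the context; i.e. the leading order term of $E^T$ in $\omega$ is $C^*(x)\,\omega^{1/2}\eta^{q^*+1}\sim\omega^{-q^*/2}$.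
   Context: Setting. Gaussian beams for the Helmholtz equation $\Delta u+\omega^2c(\mathbf{x})^{-2}u=0$ in two dimensions start orthogonally from a source curve $\mathbf{x}_0(s)$, $s\in\mathbb{R}$, with central rays $\mathbf{X}(t,s)$ ($t$ = travel time). The beam with parameter $s$ has a complex-valued phase $\phi$ (satisfying the eikonal equation $|\nabla\phi|=1/c$, with $\phi(\mathbf{x}_0(s),s)=0$) and complex-valued amplitude terms $A_k$ (satisfying $2\nabla A_0\cdot\nabla\phi+A_0\Delta\phi=0$ and $2\nabla A_{k+1}\cdot\nabla\phi+A_{k+1}\Delta\phi+\Delta A_k=0$), all independent of $\omega$. Everything is restricted to a fixed line $\{(x,y^* ):x\in\mathbb{R}\}$, writing $\phi(x,s)$, $A_k(x,s)$ for the values at $(x,y^* )$. The number $X(s)$ is the point where the central ray meets the line: $\mathbf{X}(t(s),s)=(X(s),y^* )$ for some $t(s)$. On the central rays, $\phi(X(s),s)=t(s)$ and $\phi_x(X(s),s)$ are real and $\phi_s(X(s),s)=0$ for all $s$. Write $m(x)=X^{-1}(x)$. Assumptions. (A1) For $0\le k\le\lfloor q/2\rfloor$, $A_k\in C_b^{p+q+2-2k}(\mathbb{R}^2)$ (that many continuous and bounded derivatives); $\phi\in C^{p+q+4}$; $\mathbf{X}(t,s)\in C^{p+1}$, and $X(s)\in C^{p+1}$ with derivatives of orders $1,\dots,p+1$ bounded; $p\ge2$. (A2) There are $C,\bar p\ge 0$ with $|\partial_x^{p_1}\partial_s^{p_2}\phi(x,s)|\le C(1+|x-X(s)|^{\bar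 p})$ for all integers $p_1,p_2\ge0$ with $p_1+p_2\le p+q+4$. (A3) $0<c_0\le X'(s)\le c_1<\infty$ for all $s$ (no caustics). (A4) $0<c_0\le \Im\phi_{xx}(X(s),s)\le c_1<\infty$ for all $s$; and $\omega>\omega_0$ for a fixed $\omega_0>0$. (A5) The cut-off is $\varphi(x,s)=\varphi(X(s)-x)$ with $\varphi\in C^\infty(\mathbb{R})$, $\varphi(x)=1$ for $|x|\le\alpha/2$, $\varphi(x)=0$ for $|x|>\alpha$; the size $\alpha$ is small enough depending on $\phi$ but independent of $\omega$. Beam width: $\eta(x)=\left(\omega\,\Im\phi_{xx}(x,m(x))\right)^{-1/2}$. Superpositions. Let $A(x,s)=\sum_{k=0}^{\lfloor q/2\rfloor}A_k(x,s)(i\omega)^{-k}$ and $$u_s(x)=\omega^{1/2}\int\varphi(X(s)-x)A(x,s)e^{i\omega\phi(x,s)}ds.$$ Let $\tilde A_{k,r}(x,s)=\sum_{j=0}^{r}\frac{(x-X(s))^j}{j!}\partial_x^jA_k(X(s),s)$, $\tilde A_q(x,s)=\sum_{k=0}^{\lfloor q/2\rfloor}\tilde A_{k,q-2k}(x,s)(i\omega)^{-k}$, $\tilde\phi_q(x,s)=\sum_{j=0}^{q+2}\frac{(x-X(s))^j}{j!}\partial_x^j\phi(X(s),s)$, and $$\tilde u_s(x)=\omega^{1/2}\int\varphi(X(s)-x)\tilde A_q(x,s)e^{i\omega\tilde\phi_q(x,s)}ds,\qquad \tilde u_s^D(x)=\omega^{1/2}h\sum_{j\in\mathbb{Z}}\varphi(X(s_j)-x)\tilde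 A_q(x,s_j)e^{i\omega\tilde\phi_q(x,s_j)},\quad s_j=jh.$$ Definition of $C^*(x)$. Let $\sigma=1$ if $q=0$ and $\sigma=0$ if $q>0$. Put $$\tilde p_j(x)=\frac{(-1)^j}{j!}\partial_x^j\phi(x,m(x))\ (\text{derivative in the first argument, then evaluated at }(x,m(x))),\qquad \tilde r_j(x)=\frac1{j!}\frac{d^j}{dz^j}\phi(x,m(x+z))\Big|_{z=0},$$ $$b_1=i\frac{\tilde p_{q+3}}{\Im\phi_{xx}(x,m(x))},\quad b_2=i\frac{\tilde p_{q+4}+\tilde p_{q+3}'}{\Im\phi_{xx}(x,m(x))},\quad c_1=\Re\frac{\tilde r_2}{\Im\phi_{xx}(x,m(x))},\quad c_2=i\frac{\tilde r_3-\sigma\tilde p_3}{\Im\phi_{xx}(x,m(x))},$$ $$d_j(x)=\int_{\mathbb{R}}z^je^{iz^2c_1(x)-z^2/2}dz.$$ For each $k$ with $0\le k\le\lfloor q/2\rfloor$ put $q_k=q-2k$, $\tilde a_{k,j}(x)=\frac{(-1)^j}{j!}\partial_x^jA_k(x,m(x))$, $a_{k,1}=\tilde a_{k,q_k+1}$, $a_{k,2}=\tilde a_{k,q_k+2}+\tilde a_{k,q_k+1}'$, and $$e_{11}^{(k)}=d_{q_k+1}a_{k,1}m',\qquad e_{12}^{(k)}=a_{k,2}m'd_{q_k+2}+a_{k,1}m''d_{q_k+2}+a_{k,1}c_2m'd_{q_k+4}.$$ With $\tilde b_1(x)=\frac{d}{dz}A_0(x,m(x+z))|_{z=0}$ and $A_0=A_0(x,m(x))$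 put $$e_{21}=A_0b_1d_{q+3}m',\qquad e_{22}=\tilde b_1b_1d_{q+4}m'+A_0\left(b_2d_{q+4}+\frac{\sigma}{2}b_1^2d_{2q+6}\right)m'+A_0b_1d_{q+6}c_2m'+A_0b_1d_{q+4}m''.$$ Define $$\bar C_0(x)=e^{i\omega\phi(x,m(x))}\begin{cases}e_{11}^{(0)}+e_{21},&q\text{ odd},\\ e_{12}^{(0)}+e_{22},&q\text{ even},\end{cases}\qquad \bar C_k(x)=e^{i\omega\phi(x,m(x))}\begin{cases}e_{11}^{(k)},&q\text{ odd},\\ e_{12}^{(k)},&q\text{ even},\end{cases}\quad(k\ge1),$$ $$C^*(x)=\sum_{k=0}^{\lfloor q/2\rfloor}(i\omega\eta(x)^2)^{-k}\,\bar C_k(x).$$ *)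

(* Defs.v *)
From Stdlib Require Export Reals ZArith.
From Coquelicot Require Export Coquelicot.
#[global] Open Scope R_scope.

Definition Cexp (z : C) : C := (exp (Re z) * cos (Im z), exp (Re z) * sin (Im z)).

Definition CDerive_n (f : R -> C) (n : nat) (x : R) : C :=
  (Derive_n (fun t => Re (f t)) n x, Derive_n (fun t => Im (f t)) n x).

Definition CDerive (f : R -> C) (x : R) : C := CDerive_n f 1 x.

(** [Cpartial j k f] is the derivative of [f] of order [j] in the first argument
    and of order [k] in the second. *)
Definition Cpartial (j k : nat) (f : R -> R -> C) (x y : R) : C :=
  (partial_derive j k (fun u v => Re (f u v)) x y,
   partial_derive j k (fun u v => Im (f u v)) x y).

Definition CRInt_line (f : R -> C) : C :=
  RInt_gen (V := C_R_CompleteNormedModule) f (Rbar_locally m_infty) (Rbar_locally p_infty).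

Definition Csum (a : nat -> C) (n : nat) : C := sum_n (G := C_AbelianMonoid) a n.

Definition CSeries (a : nat -> C) : C :=
  (Series (fun n => Re (a n)), Series (fun n => Im (a n))).

(** Only used where all but finitely many terms vanish. *)
Definition CZsum (a : Z -> C) : C :=
  (CSeries (fun n => a (Z.of_nat n)) + CSeries (fun n => a (- Z.of_nat (S n))%Z))%C.

(** [ex_diff_n] asks for existence and continuity of all iterated partial
    derivatives up to the given order. *)
Definition class_C2d (n : nat) (f : R -> R -> R) : Prop :=
  forall x y, ex_diff_n f n x y.

Definition Cclass_C2d (n : nat) (f : R -> R -> C) : Prop :=
  class_C2d n (fun x y => Re (f x y)) /\ class_C2d n (fun x y => Im (f x y)).

Definition Cclass_Cb2d (n : nat) (f : R -> R -> C) : Prop :=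
  Cclass_C2d n f /\
  exists M : R, forall j k : nat, (j + k <= n)%nat ->
    forall x y, Cmod (Cpartial j k f x y) <= M.

Definition class_C (n : nat) (f : R -> R) : Prop :=
  forall k : nat, (k <= n)%nat ->
  forall x, ex_derive_n f k x /\ continuous (Derive_n f k) x.

Definition Cgrad_dot (f g : R -> R -> C) (x y : R) : C :=
  (Cpartial 1 0 f x y * Cpartial 1 0 g x y + Cpartial 0 1 f x y * Cpartial 0 1 g x y)%C.

Definition Claplacian (f : R -> R -> C) (x y : R) : C :=
  (Cpartial 2 0 f x y + Cpartial 0 2 f x y)%C.

Definition Cex_diff_n (f : R -> R -> C) (n : nat) (x y : R) : Prop :=
  ex_diff_n (fun u v => Re (f u v)) n x y /\ ex_diff_n (fun u v => Im (f u v)) n x y.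

(** [|grad f| = 1/c] for a complex phase means [grad f . grad f = 1/c^2], with the
    bilinear (unconjugated) product. *)
Definition eikonal_at (c : R -> R -> R) (f : R -> R -> C) (x y : R) : Prop :=
  Cex_diff_n f 2 x y /\ Cgrad_dot f f x y = RtoC (/ (c x y) ^ 2).

Definition transport0_at (f a0 : R -> R -> C) (x y : R) : Prop :=
  Cex_diff_n a0 2 x y /\
  (2 * Cgrad_dot a0 f x y + a0 x y * Claplacian f x y = 0)%C.

Definition transportS_at (f a a' : R -> R -> C) (x y : R) : Prop :=
  Cex_diff_n a' 2 x y /\
  (2 * Cgrad_dot a' f x y + a' x y * Claplacian f x y + Claplacian a x y = 0)%C.

(** Points of the plane are pairs; [ray t s] is the position at travel time [t] on the
    central ray number [s], and [Phi x y s] is the value at [(x,y)] of the phase of the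
    beam number [s].  The ray equation is [d/dt X = c^2 grad Phi].  Complex solutions of
    the eikonal equation generally have branch points away from the central ray, so the
    equation is required in a neighbourhood of the ray only. *)
Record is_beam_phase (c : R -> R -> R) (x0 : R -> R * R) (ray : R -> R -> R * R)
    (Phi : R -> R -> R -> C) : Prop := {
  speed_pos : forall x y, 0 < c x y;
  ray_start : forall s, ray 0 s = x0 s;
  ray_orthogonal : forall s,
    Derive (fun t => fst (ray t s)) 0 * Derive (fun r => fst (x0 r)) s
    + Derive (fun t => snd (ray t s)) 0 * Derive (fun r => snd (x0 r)) s = 0;
  ray_eq1 : forall t s,
    RtoC (Derive (fun r => fst (ray r s)) t)
    = (RtoC (c (fst (ray t s)) (snd (ray t s)) ^ 2)
       * Cpartial 1 0 (fun x y => Phi x y s) (fst (ray t s)) (snd (ray t s)))%C;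
  ray_eq2 : forall t s,
    RtoC (Derive (fun r => snd (ray r s)) t)
    = (RtoC (c (fst (ray t s)) (snd (ray t s)) ^ 2)
       * Cpartial 0 1 (fun x y => Phi x y s) (fst (ray t s)) (snd (ray t s)))%C;
  phase_eikonal : forall t s,
    locally_2d (eikonal_at c (fun x y => Phi x y s)) (fst (ray t s)) (snd (ray t s));
  phase_source : forall s, Phi (fst (x0 s)) (snd (x0 s)) s = 0%C }.

Definition are_beam_amplitudes (K : nat) (ray : R -> R -> R * R)
    (Phi : R -> R -> R -> C) (Amp : nat -> R -> R -> R -> C) : Prop :=
  forall t s,
    locally_2d (transport0_at (fun x y => Phi x y s) (fun x y => Amp 0%nat x y s))
      (fst (ray t s)) (snd (ray t s)) /\
    forall k : nat, (k < K)%nat ->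
      locally_2d (transportS_at (fun x y => Phi x y s)
                    (fun x y => Amp k x y s) (fun x y => Amp (S k) x y s))
        (fst (ray t s)) (snd (ray t s)).

(** [phi x s] is the restriction of the phase to the line [y = ystar], and [X s] the
    abscissa where ray number [s] crosses it, at time [tX s]. *)
Record meets_line (ystar : R) (ray : R -> R -> R * R) (phi : R -> R -> C)
    (X tX : R -> R) : Prop := {
  crossing : forall s, ray (tX s) s = (X s, ystar);
  phase_on_ray : forall s, phi (X s) s = RtoC (tX s);
  phase_x_real : forall s, Im (Cpartial 1 0 phi (X s) s) = 0;
  phase_s_zero : forall s, Cpartial 0 1 phi (X s) s = 0%C }.

Record smooth_phase (p q : nat) (ray : R -> R -> R * R) (phi : R -> R -> C)
    (X : R -> R) : Prop := {
  phase_smooth : Cclass_C2d (p + q + 4) phi;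
  ray_smooth1 : class_C2d (p + 1) (fun t s => fst (ray t s));
  ray_smooth2 : class_C2d (p + 1) (fun t s => snd (ray t s));
  X_smooth : class_C (p + 1) X;
  X_bounded : exists M : R, forall k : nat, (1 <= k <= p + 1)%nat ->
    forall s, Rabs (Derive_n X k s) <= M }.

(** An integer growth exponent loses no generality, the constant being existential. *)
Definition polynomial_growth (n : nat) (phi : R -> R -> C) (X : R -> R) : Prop :=
  exists (M : R) (pbar : nat), 0 <= M /\
    forall p1 p2 : nat, (p1 + p2 <= n)%nat ->
    forall x s, Cmod (Cpartial p1 p2 phi x s) <= M * (1 + Rabs (x - X s) ^ pbar).

Definition no_caustics (X : R -> R) : Prop :=
  exists c0 c1 : R, 0 < c0 /\ forall s, c0 <= Derive X s <= c1.

Definition im_phi_xx (phi : R -> R -> C) (x s : R) : R := Im (Cpartial 2 0 phi x s).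

Definition beam_convexity (phi : R -> R -> C) (X : R -> R) : Prop :=
  exists c0 c1 : R, 0 < c0 /\ forall s, c0 <= im_phi_xx phi (X s) s <= c1.

Definition smooth_amplitudes (p q : nat) (A : nat -> R -> R -> C) : Prop :=
  forall k : nat, (k <= q / 2)%nat -> Cclass_Cb2d (p + q + 2 - 2 * k) (A k).

Record is_cutoff (alpha : R) (chi : R -> R) : Prop := {
  cutoff_smooth : forall (n : nat) x, ex_derive_n chi n x;
  cutoff_one : forall x, Rabs x <= alpha / 2 -> chi x = 1;
  cutoff_zero : forall x, alpha < Rabs x -> chi x = 0 }.

Section Superposition.

Context (q : nat) (phi : R -> R -> C) (A : nat -> R -> R -> C) (X : R -> R).
Context (chi : R -> R) (omega : R).

Definition iomega : C := (Ci * RtoC omega)%C.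

Definition amplitude (x s : R) : C :=
  Csum (fun k => A k x s / Cpow iomega k)%C (q / 2).

Definition taylor_x (r : nat) (f : R -> R -> C) (x s : R) : C :=
  Csum (fun j => RtoC ((x - X s) ^ j / INR (fact j)) * Cpartial j 0 f (X s) s)%C r.

Definition amplitude_taylor (x s : R) : C :=
  Csum (fun k => taylor_x (q - 2 * k) (A k) x s / Cpow iomega k)%C (q / 2).

Definition phase_taylor (x s : R) : C := taylor_x (q + 2) phi x s.

Definition u_exact (x : R) : C :=
  (RtoC (sqrt omega) *
   CRInt_line (fun s => RtoC (chi (X s - x)) * amplitude x s * Cexp (iomega * phi x s)))%C.

Definition beam_taylor (x s : R) : C :=
  (RtoC (chi (X s - x)) * amplitude_taylor x s * Cexp (iomega * phase_taylor x s))%C.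

Definition u_taylor (x : R) : C :=
  (RtoC (sqrt omega) * CRInt_line (fun s => beam_taylor x s))%C.

Definition u_discrete (h x : R) : C :=
  (RtoC (sqrt omega * h) * CZsum (fun j => beam_taylor x (IZR j * h)))%C.

Definition taylor_error (x : R) : C := (u_exact x - u_taylor x)%C.

Definition discretization_error (h x : R) : C := (u_taylor x - u_discrete h x)%C.

End Superposition.

Definition qstar (q : nat) : nat := if Nat.even q then (q + 2)%nat else (q + 1)%nat.

Section LeadingCoefficient.

(** [m] stands for the inverse of [X].
    [q - 2 * k] is an exact subtraction, only [k <= q / 2] being used. *)
Context (q : nat) (phi : R -> R -> C) (A : nat -> R -> R -> C) (m : R -> R).

Definition beam_width (omega x : R) : R := / sqrt (omega * im_phi_xx phi x (m x)).

Definition sigma_q : R := if Nat.eqb q 0 then 1 else 0.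

Definition m1 (x : R) : R := Derive m x.
Definition m2 (x : R) : R := Derive_n m 2 x.

Definition p_tilde (j : nat) (x : R) : C :=
  (RtoC ((-1) ^ j / INR (fact j)) * Cpartial j 0 phi x (m x))%C.

Definition r_tilde (j : nat) (x : R) : C :=
  (RtoC (/ INR (fact j)) * CDerive_n (fun z => phi x (m (x + z))) j 0)%C.

Definition imxx (x : R) : C := RtoC (im_phi_xx phi x (m x)).

Definition b1 (x : R) : C := (Ci * (p_tilde (q + 3) x / imxx x))%C.

Definition b2 (x : R) : C :=
  (Ci * ((p_tilde (q + 4) x + CDerive (p_tilde (q + 3)) x) / imxx x))%C.

Definition c1 (x : R) : R := Re (r_tilde 2 x / imxx x)%C.

Definition c2 (x : R) : C :=
  (Ci * ((r_tilde 3 x - RtoC sigma_q * p_tilde 3 x) / imxx x))%C.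

Definition d_coef (j : nat) (x : R) : C :=
  CRInt_line (fun z => RtoC (z ^ j) * Cexp (Ci * RtoC (z ^ 2 * c1 x) - RtoC (z ^ 2 / 2)))%C.

Definition a_tilde (k j : nat) (x : R) : C :=
  (RtoC ((-1) ^ j / INR (fact j)) * Cpartial j 0 (A k) x (m x))%C.

Definition a1 (k : nat) (x : R) : C := a_tilde k (q - 2 * k + 1) x.

Definition a2 (k : nat) (x : R) : C :=
  (a_tilde k (q - 2 * k + 2) x + CDerive (a_tilde k (q - 2 * k + 1)) x)%C.

Definition e11 (k : nat) (x : R) : C :=
  (d_coef (q - 2 * k + 1) x * a1 k x * RtoC (m1 x))%C.

Definition e12 (k : nat) (x : R) : C :=
  (a2 k x * RtoC (m1 x) * d_coef (q - 2 * k + 2) x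
   + a1 k x * RtoC (m2 x) * d_coef (q - 2 * k + 2) x
   + a1 k x * c2 x * RtoC (m1 x) * d_coef (q - 2 * k + 4) x)%C.

Definition b1_tilde (x : R) : C := CDerive (fun z => A 0%nat x (m (x + z))) 0.

Definition A0_ray (x : R) : C := A 0%nat x (m x).

Definition e21 (x : R) : C := (A0_ray x * b1 x * d_coef (q + 3) x * RtoC (m1 x))%C.

Definition e22 (x : R) : C :=
  (b1_tilde x * b1 x * d_coef (q + 4) x * RtoC (m1 x)
   + A0_ray x * (b2 x * d_coef (q + 4) x
                 + RtoC (sigma_q / 2) * Cpow (b1 x) 2 * d_coef (2 * q + 6) x) * RtoC (m1 x)
   + A0_ray x * b1 x * d_coef (q + 6) x * c2 x * RtoC (m1 x)
   + A0_ray x * b1 x * d_coef (q + 4) x * RtoC (m2 x))%C.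

Definition Cbar (omega : R) (k : nat) (x : R) : C :=
  (Cexp (iomega omega * phi x (m x)) *
   match k with
   | 0%nat => if Nat.odd q then e11 0 x + e21 x else e12 0 x + e22 x
   | S _ => if Nat.odd q then e11 k x else e12 k x
   end)%C.

Definition Cstar (omega x : R) : C :=
  Csum (fun k => Cbar omega k x
                 / Cpow (iomega omega * RtoC (beam_width omega x ^ 2)) k)%C (q / 2).

End LeadingCoefficient.

(* Main.v *)
Require Import Defs.
From Stdlib Require Import Lra Lia Psatz.

(** The discretization error is that of the trapezoidal rule for a compactly supported
    integrand, at most [h ^ p] times the L1 norm of its [p]-th derivative: as a function of a
    shift of the grid the error averages to zero, and its derivative is the error for the
    derivative of the integrand.  Each derivative in [s] of a beam costs [sqrt omega], since
    the derivative of the phase vanishes on the central ray; the Gaussian decay of width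
    [1 / sqrt omega] makes up for the prefactor [sqrt omega].

    For the Taylor expansion error substitute [X s = x + eta * y].  All factors of the
    difference of the beams are expanded to two orders in [eta], with remainders bounded by
    powers of [eta] times a Gaussian in [y]; the exponents of both beams stay below
    [- y ^ 2 / 4] on the support of a small cut-off.  The integrals of the two leading terms
    are moments [d_j], and the odd ones vanish: for even [q] the first order disappears, for
    odd [q] the second one does, which leaves exactly [Cstar]. *)

(** * Complex-valued functions of a real variable *)

(** Every constant must be uniform in [x], [omega] and [h], although many factors are multiplied.
    Two classes of functions closed under sums and products, [symbol] in the variable [s] and
    [order] in the rescaled offset [y], therefore carry their constants existentially.

    The scale [eta] comes from a cancellation. On the central rays the phase is real and its
    derivative in [s] vanishes; differentiating these relations along the rays shows that the
    quadratic coefficient of the phase has imaginary part exactly [im_phi_xx / 2]. After rescaling,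
    the leading exponent has real part [- y ^ 2 / 2].

    The main obstacle is that the perturbation of the exponent is a power of [eta] times a
    polynomial in [y]: small for fixed [y], but not uniformly. Its exponential is therefore never
    bounded alone. It stays multiplied by an unperturbed exponential, and the Taylor remainder is
    controlled by the larger of the moduli before and after the perturbation, both of which are
    Gaussian by convexity of the two phases. *)

Lemma is_derive_Rconst (c x : R) : is_derive (fun _ => c) x 0.
Proof. apply (is_derive_const (V := R_NormedModule)). Qed.

Lemma is_derive_continuous (f : R -> R) (x l : R) : is_derive f x l -> continuous f x.
Proof. intros H; apply (ex_derive_continuous (V := R_NormedModule)); now exists l. Qed.

Lemma Cmod_le_Re_Im (z : C) : Cmod z <= Rabs (Re z) + Rabs (Im z).
Proof.
replace z with (RtoC (Re z) + Ci * RtoC (Im z))%C at 1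
  by (destruct z; unfold Ci, RtoC, Cmult, Cplus; simpl; f_equal; ring).
eapply Rle_trans; [apply Cmod_triangle|].
rewrite Cmod_mult, Cmod_Ci, !Cmod_R; lra.
Qed.

Lemma Cmod_Cexp (z : C) : Cmod (Cexp z) = exp (Re z).
Proof.
unfold Cmod, Cexp; simpl fst; simpl snd.
replace ((exp (Re z) * cos (Im z)) ^ 2 + (exp (Re z) * sin (Im z)) ^ 2)
  with (exp (Re z) ^ 2 * (Rsqr (sin (Im z)) + Rsqr (cos (Im z)))) by (unfold Rsqr; ring).
rewrite sin2_cos2, Rmult_1_r.
apply sqrt_pow2, Rlt_le, exp_pos.
Qed.

Lemma Cexp_plus (z w : C) : Cexp (z + w) = (Cexp z * Cexp w)%C.
Proof.
unfold Cexp, Cmult, Cplus, Re, Im; simpl.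
rewrite exp_plus, cos_plus, sin_plus; apply injective_projections; simpl; ring.
Qed.

Lemma Cexp_0 : Cexp 0 = 1%C.
Proof.
unfold Cexp; simpl; rewrite exp_0, cos_0, sin_0.
apply injective_projections; simpl; ring.
Qed.

(** Differentiation by components, in agreement with [CDerive_n]; the variable is real, so no
    holomorphy is involved. *)
Definition Cder (f : R -> C) (x : R) (l : C) : Prop :=
  is_derive (fun t => Re (f t)) x (Re l) /\ is_derive (fun t => Im (f t)) x (Im l).

Lemma Cder_eq (f : R -> C) (x : R) (l l' : C) : Cder f x l -> l = l' -> Cder f x l'.
Proof. intros H <-; exact H. Qed.

Lemma Cder_ext (f g : R -> C) (x : R) (l : C) :
  (forall t, f t = g t) -> Cder f x l -> Cder g x l.
Proof.
intros H [H1 H2]; split.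
- apply (is_derive_ext (fun t => Re (f t))); [intros t; now rewrite H | exact H1].
- apply (is_derive_ext (fun t => Im (f t))); [intros t; now rewrite H | exact H2].
Qed.

Lemma Cder_unique (f : R -> C) (x : R) (l : C) : Cder f x l -> CDerive f x = l.
Proof.
intros [H1 H2].
apply is_derive_unique in H1.
apply is_derive_unique in H2.
change ((Derive (fun x => Re (f x)) x, Derive (fun x => Im (f x)) x) = l).
apply injective_projections; [exact H1 | exact H2].
Qed.

Lemma Cder_const (a : C) (x : R) : Cder (fun _ => a) x 0%C.
Proof. split; simpl; apply is_derive_Rconst. Qed.

Lemma Cder_plus (f g : R -> C) (x : R) (lf lg : C) :
  Cder f x lf -> Cder g x lg -> Cder (fun t => f t + g t)%C x (lf + lg)%C.
Proof.
intros [H1 H2] [H3 H4]; split; simpl.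
- exact (is_derive_plus _ _ _ _ _ H1 H3).
- exact (is_derive_plus _ _ _ _ _ H2 H4).
Qed.

Lemma is_derive_Rmult (f g : R -> R) (x lf lg : R) :
  is_derive f x lf -> is_derive g x lg ->
  is_derive (fun t => f t * g t) x (lf * g x + f x * lg).
Proof. intros H1 H2; exact (is_derive_mult f g x lf lg H1 H2 Rmult_comm). Qed.

Lemma is_derive_val (f : R -> R) (x l l' : R) : is_derive f x l -> l = l' -> is_derive f x l'.
Proof. intros H <-; exact H. Qed.

Lemma Cder_mult (f g : R -> C) (x : R) (lf lg : C) :
  Cder f x lf -> Cder g x lg -> Cder (fun t => f t * g t)%C x (lf * g x + f x * lg)%C.
Proof.
intros [H1 H2] [H3 H4]; split; simpl.
- eapply is_derive_val.
  + apply (is_derive_minus (fun t => Re (f t) * Re (g t)) (fun t => Im (f t) * Im (g t)));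
    apply is_derive_Rmult; eassumption.
  + unfold minus, plus, opp, Re, Im; simpl; ring.
- eapply is_derive_val.
  + apply (is_derive_plus (fun t => Re (f t) * Im (g t)) (fun t => Im (f t) * Re (g t)));
    apply is_derive_Rmult; eassumption.
  + unfold minus, plus, opp, Re, Im; simpl; ring.
Qed.

Lemma Cder_RtoC (f : R -> R) (x l : R) : is_derive f x l -> Cder (fun t => RtoC (f t)) x (RtoC l).
Proof. intros H; split; simpl; [exact H | apply is_derive_Rconst]. Qed.

Lemma Cder_scal (a : C) (f : R -> C) (x : R) (l : C) :
  Cder f x l -> Cder (fun t => a * f t)%C x (a * l)%C.
Proof.
intros H; eapply Cder_eq; [apply Cder_mult; [apply Cder_const | exact H] | simpl; ring].
Qed.

Lemma is_derive_Rcomp (f g : R -> R) (x lf lg : R) :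
  is_derive f (g x) lf -> is_derive g x lg -> is_derive (fun t => f (g t)) x (lg * lf).
Proof. intros H1 H2; exact (is_derive_comp f g x lf lg H1 H2). Qed.

Lemma Cder_comp (f : R -> C) (g : R -> R) (x : R) (l : C) (lg : R) :
  Cder f (g x) l -> is_derive g x lg -> Cder (fun t => f (g t)) x (RtoC lg * l)%C.
Proof.
intros [H1 H2] H3; split; simpl.
- eapply is_derive_val; [exact (is_derive_Rcomp _ _ _ _ _ H1 H3) | unfold Re; ring].
- eapply is_derive_val; [exact (is_derive_Rcomp _ _ _ _ _ H2 H3) | unfold Im; ring].
Qed.

Lemma Cder_Cexp (f : R -> C) (x : R) (l : C) :
  Cder f x l -> Cder (fun t => Cexp (f t)) x (l * Cexp (f x))%C.
Proof.
intros [H1 H2].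
assert (E := is_derive_Rcomp exp _ _ _ _ (is_derive_exp _) H1).
split; simpl.
- eapply is_derive_val.
  + apply is_derive_Rmult; [exact E|].
    exact (is_derive_Rcomp cos _ _ _ _ (is_derive_cos _) H2).
  + unfold Re, Im; simpl; ring.
- eapply is_derive_val.
  + apply is_derive_Rmult; [exact E|].
    exact (is_derive_Rcomp sin _ _ _ _ (is_derive_sin _) H2).
  + unfold Re, Im; simpl; ring.
Qed.

Lemma Cder_continuous (f : R -> C) (x : R) (l : C) :
  Cder f x l -> continuous (fun t => Re (f t)) x /\ continuous (fun t => Im (f t)) x.
Proof.
intros [H1 H2]; split;
  apply (ex_derive_continuous (V := R_NormedModule)); eexists; eassumption.
Qed.

Lemma im_le_Cmod (z : C) : Rabs (Im z) <= Cmod z.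
Proof. eapply Rle_trans; [apply Rmax_r | apply Rmax_Cmod]. Qed.

(** The mean value theorem fails for complex values, so it is applied to the real and imaginary
    parts, each bounded by the modulus. Hence the factor 2 that recurs in later remainders. *)
Lemma Cder_path_bound (f df : R -> C) (a b M : R) :
  (forall t, Rmin a b <= t <= Rmax a b -> Cder f t (df t)) ->
  (forall t, Rmin a b <= t <= Rmax a b -> Cmod (df t) <= M) ->
  Cmod (f b - f a)%C <= 2 * M * Rabs (b - a).
Proof.
intros H HM.
assert (B : forall (g dg : R -> R),
   (forall t, Rmin a b <= t <= Rmax a b -> is_derive g t (dg t)) ->
   (forall t, Rmin a b <= t <= Rmax a b -> Rabs (dg t) <= M) ->
   Rabs (g b - g a) <= M * Rabs (b - a)).
{ intros g dg Hg Hdg.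
  destruct (MVT_gen g a b dg) as [c [Hc ->]].
  - intros x Hx; apply Hg; lra.
  - intros x Hx; apply continuity_pt_filterlim, (ex_derive_continuous (V := R_NormedModule)).
    eexists; apply Hg; lra.
  - rewrite Rabs_mult; apply Rmult_le_compat_r; [apply Rabs_pos | now apply Hdg]. }
eapply Rle_trans; [apply Cmod_le_Re_Im|].
assert (B1 := B (fun t => Re (f t)) (fun t => Re (df t)) (fun t Ht => proj1 (H t Ht))
  (fun t Ht => Rle_trans _ _ _ (re_le_Cmod _) (HM t Ht))).
assert (B2 := B (fun t => Im (f t)) (fun t => Im (df t)) (fun t Ht => proj2 (H t Ht))
  (fun t Ht => Rle_trans _ _ _ (im_le_Cmod _) (HM t Ht))).
replace (Re (f b - f a)%C) with (Re (f b) - Re (f a)) by reflexivity.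
replace (Im (f b - f a)%C) with (Im (f b) - Im (f a)) by reflexivity.
lra.
Qed.

(** * Taylor expansions *)

Section PartialDerivatives.

Context (n : nat) (f : R -> R -> R).
Context (Hf : class_C2d n f).

Lemma partial_derive_is_derive_x (j k : nat) (x y : R) : (j + k < n)%nat ->
  is_derive (fun z => partial_derive j k f z y) x (partial_derive (S j) k f x y).
Proof.
intros H; apply (Derive_correct (fun z => partial_derive j k f z y)).
now apply (ex_diff_n_ex_deriv_inf_1 n).
Qed.

(** In [partial_derive] the derivatives in the second argument are taken first. Unlike the
    derivative in [x], this one needs mixed partial derivatives to commute, which uses smoothness on
    a neighbourhood. *)
Lemma partial_derive_is_derive_y (j k : nat) (x y : R) : (j + k < n)%nat ->
  is_derive (fun z => partial_derive j k f x z) y (partial_derive j (S k) f x y).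
Proof.
intros H.
rewrite <- Derive_partial_derive.
- apply (Derive_correct (fun z => partial_derive j k f x z)).
  now apply (ex_diff_n_ex_deriv_inf_2 n).
- apply locally_2d_forall; intros u v.
  apply (ex_diff_n_m n); [lia | apply Hf].
Qed.

Lemma partial_derive_continuity_2d (j k : nat) (x y : R) : (j + k <= n)%nat ->
  continuity_2d_pt (partial_derive j k f) x y.
Proof.
intros H.
assert (E := ex_diff_n_deriv n j k H f x y (Hf x y)).
destruct (n - (j + k))%nat; apply E.
Qed.

Lemma partial_derive_chain (j k : nat) (u v : R -> R) (t du dv : R) : (j + k < n)%nat ->
  is_derive u t du -> is_derive v t dv ->
  is_derive (fun r => partial_derive j k f (u r) (v r)) t
    (du * partial_derive (S j) k f (u t) (v t) + dv * partial_derive j (S k) f (u t) (v t)).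
Proof.
intros H Hu Hv.
apply is_derive_Reals.
eapply is_derive_Reals, is_derive_val.
apply is_derive_Reals, derivable_pt_lim_comp_2d.
- apply filterdiff_differentiable_pt_lim.
  eapply filterdiff_ext_lin.
  (* Differentiability in the plane only requires one partial derivative to be continuous at the
     point and the other one to exist there. *)
  apply is_derive_filterdiff with (dfx := partial_derive (S j) k f).
  + apply filter_forall; intros [a b]; simpl.
    now apply partial_derive_is_derive_x.
  + now apply partial_derive_is_derive_y.
  + apply continuity_2d_pt_filterlim, partial_derive_continuity_2d; lia.
  + intros [a b]; simpl; reflexivity.
- apply is_derive_Reals; eassumption.
- apply is_derive_Reals; eassumption.
- ring.
Qed.

End PartialDerivatives.

Lemma Re_lincomb (a b : R) (z w : C) : Re (RtoC a * z + RtoC b * w)%C = a * Re z + b * Re w.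
Proof. unfold Re; simpl; ring. Qed.

Lemma Im_lincomb (a b : R) (z w : C) : Im (RtoC a * z + RtoC b * w)%C = a * Im z + b * Im w.
Proof. unfold Im; simpl; ring. Qed.

Lemma Cpartial_chain (n : nat) (f : R -> R -> C) (j k : nat) (u v : R -> R) (t du dv : R) :
  Cclass_C2d n f -> (j + k < n)%nat -> is_derive u t du -> is_derive v t dv ->
  Cder (fun r => Cpartial j k f (u r) (v r)) t
    (RtoC du * Cpartial (S j) k f (u t) (v t) + RtoC dv * Cpartial j (S k) f (u t) (v t))%C.
Proof.
intros [H1 H2] H Hu Hv; split.
- eapply is_derive_val; [eapply (partial_derive_chain n); eassumption|].
  rewrite Re_lincomb; reflexivity.
- eapply is_derive_val; [eapply (partial_derive_chain n); eassumption|].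
  rewrite Im_lincomb; reflexivity.
Qed.

Lemma Cpartial_der_x (n : nat) (f : R -> R -> C) (j k : nat) (x y : R) :
  Cclass_C2d n f -> (j + k < n)%nat ->
  Cder (fun z => Cpartial j k f z y) x (Cpartial (S j) k f x y).
Proof.
intros [H1 H2] H; split; now apply (partial_derive_is_derive_x n).
Qed.

Lemma Cpartial_der_y (n : nat) (f : R -> R -> C) (j k : nat) (x y : R) :
  Cclass_C2d n f -> (j + k < n)%nat ->
  Cder (fun z => Cpartial j k f x z) y (Cpartial j (S k) f x y).
Proof.
intros [H1 H2] H; split; now apply (partial_derive_is_derive_y n).
Qed.

Lemma Cpartial_00 (f : R -> R -> C) (x y : R) : Cpartial 0 0 f x y = f x y.
Proof. unfold Cpartial, partial_derive; simpl; now destruct (f x y). Qed.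

Definition taylor_weight (z : R) (j : nat) : C := RtoC (z ^ j / INR (fact j)).

(** When the base point of a Taylor polynomial moves, the derivative of each weight cancels the
    derivative of the preceding coefficient, and only the term of top degree survives. The family
    [e] collects any other dependence of the coefficients on the parameter: it is zero for Taylor
    remainders and a mixed derivative for the phase of a beam differentiated in [s]. *)
Lemma taylor_telescope (g e : nat -> R -> C) (u : R -> R) (b t du : R) (r : nat) :
  is_derive u t du ->
  (forall j, (j <= r)%nat -> Cder (g j) t (RtoC du * g (S j) t + e j t)%C) ->
  Cder (fun s => Csum (fun j => taylor_weight (b - u s) j * g j s)%C r) t
    (RtoC du * (taylor_weight (b - u t) r * g (S r) t)
     + Csum (fun j => taylor_weight (b - u t) j * e j t)%C r)%C.
Proof.
intros Hu; induction r as [|r IH]; intros H.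
- apply (Cder_ext (g 0%nat)).
  { intros s; unfold Csum; rewrite sum_O; unfold taylor_weight; simpl.
    rewrite Rdiv_1_r; now rewrite Cmult_1_l. }
  unfold Csum; rewrite sum_O; unfold taylor_weight; simpl.
  rewrite Rdiv_1_r; eapply Cder_eq; [now apply H | ring].
- assert (Hw : is_derive (fun s => (b - u s) ^ S r / INR (fact (S r))) t
            (- du * ((b - u t) ^ r / INR (fact r)))).
  { eapply is_derive_val.
    - apply is_derive_Rmult; [|apply is_derive_Rconst].
      apply (is_derive_Rcomp (fun z => z ^ S r) (fun s => b - u s)).
      + apply (is_derive_pow (fun z => z) (S r)), is_derive_id.
      + apply (is_derive_minus (fun _ => b) u);
        [apply is_derive_Rconst | exact Hu].
    - change (fact (S r)) with (S r * fact r)%nat; rewrite mult_INR.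
      assert (INR (fact r) <> 0) by apply INR_fact_neq_0.
      assert (INR (S r) <> 0) by (apply not_0_INR; lia).
      unfold minus, plus, opp, zero, one; simpl pred; simpl; field; now split. }
  apply (Cder_ext (fun s => Csum (fun j => taylor_weight (b - u s) j * g j s) r
           + taylor_weight (b - u s) (S r) * g (S r) s)%C).
  { intros s; unfold Csum at 2; rewrite sum_Sn; reflexivity. }
  eapply Cder_eq.
  + apply Cder_plus; [apply IH; intros j Hj; apply H; lia|].
    apply Cder_mult; [apply Cder_RtoC; exact Hw | now apply H].
  + unfold Csum at 2; rewrite sum_Sn; fold (Csum (fun j => taylor_weight (b - u t) j * e j t)%C r).
    change plus with Cplus; unfold taylor_weight.
    rewrite RtoC_mult, RtoC_opp; ring.
Qed.

(** The base point travels from [a] to [b]. At [b] the polynomial is the function itself, and along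
    the way its derivative is a single term of size at most [Rabs (b - a) ^ r * M]; the length of
    the path gives the last factor. The factorial is simply dropped. *)
Lemma taylor_bound (g : nat -> R -> C) (a b M : R) (r : nat) :
  (forall j t, (j <= r)%nat -> Rmin a b <= t <= Rmax a b -> Cder (g j) t (g (S j) t)) ->
  (forall t, Rmin a b <= t <= Rmax a b -> Cmod (g (S r) t) <= M) ->
  Cmod (g 0%nat b - Csum (fun j => taylor_weight (b - a) j * g j a) r)%C
    <= 2 * M * Rabs (b - a) ^ S r.
Proof.
intros H HM.
assert (Hz : forall h : nat -> C, Csum (fun j => taylor_weight (b - b) j * h j)%C r = h 0%nat).
{ intros h; unfold Csum; clear; induction r as [|r IH].
  - rewrite sum_O; unfold taylor_weight; simpl; rewrite Rdiv_1_r; ring.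
  - rewrite sum_Sn, IH; change plus with Cplus; unfold taylor_weight.
    rewrite Rminus_diag, pow_i by lia; unfold Rdiv; rewrite Rmult_0_l; ring. }
rewrite <- (Hz (fun j => g j b)).
eapply Rle_trans.
- apply (Cder_path_bound (fun t => Csum (fun j => taylor_weight (b - t) j * g j t)%C r)
    (fun t => taylor_weight (b - t) r * g (S r) t)%C a b (Rabs (b - a) ^ r * M)).
  + intros t Ht; eapply Cder_eq.
    * apply (taylor_telescope g (fun _ _ => 0%C) (fun t => t)); [apply is_derive_id|].
      intros j Hj; eapply Cder_eq; [now apply H | unfold one; simpl; ring].
    * unfold one; simpl.
      replace (Csum _ r) with (RtoC 0); [ring|].
      unfold Csum; clear; induction r as [|r IH].
      -- rewrite sum_O; ring.
      -- rewrite sum_Sn, <- IH; change plus with Cplus; ring.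
  + intros t Ht; rewrite Cmod_mult; apply Rmult_le_compat; try apply Cmod_ge_0.
    * unfold taylor_weight; rewrite Cmod_R.
      unfold Rdiv; rewrite Rabs_mult, <- RPow_abs.
      rewrite <- (Rmult_1_r (Rabs (b - a) ^ r)).
      apply Rmult_le_compat; [apply pow_le, Rabs_pos | apply Rabs_pos | |].
      -- apply pow_incr; split; [apply Rabs_pos|].
         destruct (Rle_dec a b);
           [rewrite Rmin_left, Rmax_right in Ht by lra | rewrite Rmin_right, Rmax_left in Ht by lra];
           [rewrite !Rabs_pos_eq | rewrite !Rabs_left1]; lra.
      -- assert (1 <= INR (fact r)) by (apply (le_INR 1), lt_O_fact).
         rewrite Rabs_pos_eq by (left; apply Rinv_0_lt_compat; lra).
         rewrite <- Rinv_1; apply Rinv_le_contravar; lra.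
    * now apply HM.
- simpl; right; ring.
Qed.

(** * The trapezoidal rule *)

(** A relation instead of an iterated derivative: the intermediate derivatives can then be whatever
    expressions a product or chain rule produces. *)
Fixpoint deriv_chain (n : nat) (g gn : R -> R) : Prop :=
  match n with
  | O => forall x, g x = gn x
  | S n => exists g', (forall x, is_derive g x (g' x)) /\ deriv_chain n g' gn
  end.

Lemma MVT_all (f df : R -> R) (a b : R) : (forall t, is_derive f t (df t)) ->
  exists c, Rmin a b <= c <= Rmax a b /\ f b - f a = df c * (b - a).
Proof.
intros H; destruct (MVT_gen f a b df) as [c Hc]; [now intros | | now exists c].
intros x _; apply continuity_pt_filterlim, (ex_derive_continuous (V := R_NormedModule)).
eexists; apply H.
Qed.

(** Replaces the integration of [Rabs dg <= v]: both [V - g] and [V + g] are nondecreasing by the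
    mean value theorem, so no integrability of [dg] is needed. *)
Lemma increment_le_majorant (g dg V v : R -> R) (a b : R) :
  (forall t, is_derive g t (dg t)) -> (forall t, is_derive V t (v t)) ->
  (forall t, Rabs (dg t) <= v t) -> a <= b -> Rabs (g b - g a) <= V b - V a.
Proof.
intros Hg HV H Hab.
destruct (MVT_all (fun t => V t - g t) (fun t => v t - dg t) a b) as [c [_ Hc]].
{ intros t; apply (is_derive_minus V g); auto. }
destruct (MVT_all (fun t => V t + g t) (fun t => v t + dg t) a b) as [d [_ Hd]].
{ intros t; apply (is_derive_plus V g); auto. }
assert (Hc' := H c); assert (Hd' := H d).
apply Rabs_le_between in Hc'; apply Rabs_le_between in Hd'.
apply Rabs_le_between; nra.
Qed.

Section Trapezoid.

Context (c h : R) (N : nat) (Hh : 0 < h).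

Let node (k : nat) : R := c + INR k * h.

(** [G] is meant to be a primitive of [g], so that the first two terms are the integral over all
    [S N] cells; [t] is the position of the sampling point inside each cell. *)
Definition trapezoid_error (G g : R -> R) (t : R) : R :=
  G (node (S N)) - G c - h * sum_n (fun k => g (node k + t)) N.

Lemma node_S (k : nat) : node (S k) = node k + h.
Proof. unfold node; rewrite S_INR; ring. Qed.

Lemma node_telescope (G : R -> R) :
  sum_n (fun k => G (node k + h) - G (node k)) N = G (node (S N)) - G c.
Proof.
induction N as [|n IH].
- rewrite sum_O, node_S; unfold node; simpl; now rewrite Rmult_0_l, Rplus_0_r.
- rewrite sum_Sn, IH, (node_S (S n)); unfold plus; simpl; ring.
Qed.

Lemma is_derive_sum_shift (g g' : R -> R) (t : R) : (forall x, is_derive g x (g' x)) ->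
  is_derive (fun t => sum_n (fun k => g (node k + t)) N) t (sum_n (fun k => g' (node k + t)) N).
Proof.
intros Hg; apply (is_derive_sum_n (V := R_NormedModule)
  (fun k t => g (node k + t)) N t (fun k => g' (node k + t))).
intros k _; eapply is_derive_val.
- apply (is_derive_Rcomp g (fun t => node k + t)); [apply Hg|].
  apply (is_derive_plus (fun _ => node k) (fun t => t));
    [apply is_derive_Rconst | apply is_derive_id].
- unfold plus, zero, one; simpl; ring.
Qed.

(* The error averages to zero over the shifts [t] of the grid. *)
Lemma trapezoid_error_zero (G g : R -> R) : (forall x, is_derive G x (g x)) ->
  exists t, 0 <= t <= h /\ trapezoid_error G g t = 0.
Proof.
intros HG.
destruct (MVT_all (fun t => t * (G (node (S N)) - G c)
            - h * sum_n (fun k => G (node k + t)) N) (trapezoid_error G g) 0 h) as [t [Ht E]].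
{ intros t; eapply is_derive_val.
  - apply (is_derive_minus (fun t => t * (G (node (S N)) - G c))
      (fun t => h * sum_n (fun k => G (node k + t)) N)).
    + apply is_derive_Rmult; [apply is_derive_id | apply is_derive_Rconst].
    + apply is_derive_Rmult; [apply is_derive_Rconst|].
      apply is_derive_sum_shift, HG.
  - unfold trapezoid_error, minus, plus, opp, zero, one; simpl; ring. }
rewrite Rmin_left, Rmax_right in Ht by lra.
exists t; split; [lra|].
assert (S0 : sum_n (fun k => G (node k + h)) N - sum_n (fun k => G (node k + 0)) N
             = G (node (S N)) - G c).
{ rewrite <- node_telescope; clear.
  induction N as [|n IH].
  - rewrite !sum_O, Rplus_0_r; reflexivity.
  - rewrite !sum_Sn, <- IH; unfold plus; simpl; rewrite Rplus_0_r; ring. }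
apply (Rmult_eq_reg_r (h - 0)); [|lra].
rewrite <- E; nra.
Qed.

(** Each induction step trades one derivative for a factor [h], starting from a shift where the
    error is zero; the bound is needed for every shift because the mean value point is arbitrary.
    The last derivative is used differently: moving the sampling points changes each cell by at most
    the increase of [V] over it, and these increases telescope. This produces an L1 norm rather than
    a supremum times the length of the interval. *)
Lemma trapezoid_error_bound (p : nat) (G g gp V v : R -> R) (a b t : R) :
  c < a -> b < node (S N) -> (forall x, x < a \/ b < x -> g x = 0) ->
  (forall x, is_derive G x (g x)) -> deriv_chain (S p) g gp ->
  (forall x, is_derive V x (v x)) -> (forall x, Rabs (gp x) <= v x) ->
  0 <= t <= h ->
  Rabs (trapezoid_error G g t) <= h ^ S p * (V (node (S N)) - V c).
Proof.
intros Ha Hb Hsupp HG Hch HV Hv; revert G g t Hsupp HG Hch.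
induction p as [|p IH]; intros G g t Hsupp HG Hch Ht;
  destruct (trapezoid_error_zero G g HG) as [t0 [Ht0 Z]];
  destruct Hch as [g' [Hg' Hch]].
- simpl in Hch.
  replace (trapezoid_error G g t)
    with (- h * (sum_n (fun k => g (node k + t)) N - sum_n (fun k => g (node k + t0)) N))
    by (transitivity (trapezoid_error G g t - trapezoid_error G g t0);
        [unfold trapezoid_error; ring | lra]).
  rewrite Rabs_mult, Rabs_Ropp, Rabs_pos_eq, pow_1 by lra.
  apply Rmult_le_compat_l; [lra|].
  rewrite <- node_telescope.
  assert (B : forall x, Rabs (g (x + t) - g (x + t0)) <= V (x + h) - V x).
  { intros x.
    assert (D : forall y z, y <= z -> Rabs (g z - g y) <= V z - V y).
    { intros y z Hyz; apply (increment_le_majorant g g' V v); try assumption.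
      intros r; rewrite Hch; apply Hv. }
    assert (M : forall y z, y <= z -> V y <= V z).
    { intros y z Hyz; assert (0 <= V z - V y); [|lra].
      eapply Rle_trans; [apply Rabs_pos | now apply D]. }
    destruct (Rle_dec t0 t).
    - eapply Rle_trans; [apply D; lra|].
      assert (V (x + t) <= V (x + h)) by (apply M; lra).
      assert (V x <= V (x + t0)) by (apply M; lra); lra.
    - rewrite Rabs_minus_sym; eapply Rle_trans; [apply D; lra|].
      assert (V (x + t0) <= V (x + h)) by (apply M; lra).
      assert (V x <= V (x + t)) by (apply M; lra); lra. }
  clear - B; induction N as [|n IH].
  + rewrite !sum_O; apply B.
  + rewrite !sum_Sn; unfold plus; simpl.
    match goal with |- Rabs (?p + ?q - (?r + ?s)) <= _ =>
      replace (p + q - (r + s)) with ((p - r) + (q - s)) by ring end.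
    eapply Rle_trans; [apply Rabs_triang | apply Rplus_le_compat; [apply IH | apply B]].
- assert (Z' : forall x, x < a \/ b < x -> g' x = 0).
  { intros x Hx; rewrite <- (is_derive_unique _ _ _ (Hg' x)).
    rewrite <- (Derive_const 0 x); apply Derive_ext_loc.
    destruct Hx as [Hx|Hx].
    - apply (filter_imp (fun y => y < a)); [intros y Hy; now apply Hsupp; left|].
      now apply open_lt.
    - apply (filter_imp (fun y => b < y)); [intros y Hy; now apply Hsupp; right|].
      now apply open_gt. }
  destruct (MVT_all (trapezoid_error G g) (trapezoid_error g g') t0 t) as [r [Hr E]].
  { intros r; eapply is_derive_val.
    - apply (is_derive_minus (fun _ => G (node (S N)) - G c)
        (fun t => h * sum_n (fun k => g (node k + t)) N)).
      + apply is_derive_Rconst.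
      + apply is_derive_Rmult; [apply is_derive_Rconst|].
        apply is_derive_sum_shift, Hg'.
    - unfold trapezoid_error, minus, plus, opp, zero; simpl.
      (* The error for [g'] contains the boundary term [g (node (S N)) - g c], which the derivative
         in the shift does not produce; it vanishes because both ends lie outside the support. *)
      rewrite (Hsupp (node (S N))), (Hsupp c) by lra; ring. }
  rewrite Z, Rminus_0_r in E; rewrite E, Rabs_mult.
  assert (Rabs (t - t0) <= h) by (apply Rabs_le_between; lra).
  assert (Rabs (trapezoid_error g g' r) <= h ^ S p * (V (node (S N)) - V c)).
  { apply IH; try assumption.
    revert Hr; unfold Rmin, Rmax; destruct (Rle_dec t0 t); lra. }
  rewrite <- tech_pow_Rmult.
  replace (h * h ^ S p * _) with (h ^ S p * (V (node (S N)) - V c) * h) by ring.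
  apply Rmult_le_compat; try apply Rabs_pos; assumption.
Qed.

End Trapezoid.

(** * Integrals over the line *)

Notation CR := C_R_CompleteNormedModule.

Lemma norm_CR (z : C) : norm (V := CR) z = Cmod z.
Proof.
change (sqrt (Rabs (fst z) ^ 2 + Rabs (snd z) ^ 2) = Cmod z).
now rewrite !pow2_abs.
Qed.

Lemma scal_CR (r : R) (z : C) : scal (V := CR) r z = (RtoC r * z)%C :> C.
Proof.
apply injective_projections; simpl; unfold scal; simpl; unfold mult; simpl; ring.
Qed.

Lemma Ccontinuous_pair (f : R -> C) (x : R) :
  continuous (fun t => Re (f t)) x -> continuous (fun t => Im (f t)) x ->
  continuous (U := CR) f x.
Proof.
intros H1 H2; apply filterlim_locally; intros eps.
generalize (filter_and _ _ (proj1 (filterlim_locally _ _) H1 eps)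
  (proj1 (filterlim_locally _ _) H2 eps)).
apply filter_imp; intros y [Hy1 Hy2]; now split.
Qed.

Lemma Cder_continuous_CR (f : R -> C) (x : R) (l : C) :
  Cder f x l -> continuous (U := CR) f x.
Proof. intros H; destruct (Cder_continuous _ _ _ H); now apply Ccontinuous_pair. Qed.

Lemma Ccontinuous_proj (f : R -> C) (x : R) : continuous (U := CR) f x ->
  continuous (fun t => Re (f t)) x /\ continuous (fun t => Im (f t)) x.
Proof.
intros H; split.
- apply (continuous_comp (V := CR) f (fun z : C => fst z)); [exact H|].
  apply filterlim_locally; intros eps; exists eps; intros y Hy; apply Hy.
- apply (continuous_comp (V := CR) f (fun z : C => snd z)); [exact H|].
  apply filterlim_locally; intros eps; exists eps; intros y Hy; apply Hy.
Qed.

Lemma norm_RInt_majorant (f : R -> C) (V v : R -> R) (a b : R) :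
  a <= b -> (forall x, is_derive V x (v x)) -> (forall x, continuous v x) ->
  ex_RInt (V := CR) f a b -> (forall x, Cmod (f x) <= v x) ->
  Cmod (RInt (V := CR) f a b) <= V b - V a.
Proof.
intros Hab HV Hc Hf H; rewrite <- norm_CR.
apply (norm_RInt_le f v a b); [exact Hab | | now apply (RInt_correct (V := CR)) | ].
- intros x _; rewrite norm_CR; apply H.
- apply (is_RInt_derive (V := R_CompleteNormedModule) V v); intros; [apply HV | apply Hc].
Qed.

Lemma is_RInt_gen_line_compact (f : R -> C) (a b : R) :
  a <= b -> ex_RInt (V := CR) f a b -> (forall x, x < a \/ b < x -> f x = 0%C) ->
  is_RInt_gen (V := CR) f (Rbar_locally m_infty) (Rbar_locally p_infty) (RInt (V := CR) f a b).
Proof.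
intros Hab Hf H P HP.
apply (Filter_prod _ _ _ (fun y => y < a) (fun y => b < y)); [now exists a | now exists b|].
intros y z Hy Hz; exists (RInt (V := CR) f a b); split; [|now apply locally_singleton].
assert (Z : forall c d, c <= d -> d <= a \/ b <= c -> is_RInt (V := CR) f c d zero).
{ intros c d Hcd H'.
  apply (is_RInt_ext (fun _ => zero)).
  - intros r; rewrite Rmin_left, Rmax_right by lra; intros Hr; symmetry; apply H; lra.
  - assert (E := is_RInt_const (V := CR) c d zero); change (is_RInt (V := CR) (fun _ => zero) c d
      (@scal _ C_R_NormedModule (d - c) zero)) in E.
    rewrite scal_zero_r in E; exact E. }
assert (E := is_RInt_Chasles (V := CR) f _ _ _ _ _
  (is_RInt_Chasles (V := CR) f _ _ _ _ _ (Z y a ltac:(lra) ltac:(lra)) (RInt_correct (V := CR) _ _ _ Hf))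
  (Z b z ltac:(lra) ltac:(lra))).
replace (plus _ zero) with (RInt (V := CR) f a b) in E; [exact E|].
assert (A : forall w : C, w = (0 + w + 0)%C) by (intros; ring); apply A.
Qed.

Lemma is_derive_atan_pow (x : R) : is_derive atan x (/ (1 + x ^ 2)).
Proof. rewrite <- Rsqr_pow2; apply is_derive_atan. Qed.

(** Since [atan (/ y) = PI / 2 - atan y], beyond [M] the arctangent is within [/ M] of its limit.
    This is the tail estimate of the Cauchy criterion below. *)
Lemma atan_increment_le (M u v : R) : 0 < M -> M < u -> M < v -> Rabs (atan v - atan u) <= / M.
Proof.
assert (B : forall y, M < y -> 0 < M -> PI / 2 - / M <= atan y <= PI / 2).
{ intros y Hy HM; split; [|left; apply atan_bound].
  assert (E : atan (/ y) = PI / 2 - atan y) by (apply atan_inv; lra).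
  assert (I : / y <= / M) by (apply Rinv_le_contravar; lra).
  assert (J : 0 < / y) by (apply Rinv_0_lt_compat; lra).
  destruct (MVT_all atan (fun t => / (1 + t ^ 2)) 0 (/ y)) as [c [_ Hc]].
  { intros t; apply is_derive_atan_pow. }
  rewrite atan_0 in Hc.
  assert (/ (1 + c ^ 2) <= 1) by (rewrite <- Rinv_1; apply Rinv_le_contravar; nra).
  nra. }
intros HM Hu Hv; assert (B1 := B u Hu HM); assert (B2 := B v Hv HM).
apply Rabs_le_between; lra.
Qed.

(** * Improper integrals with a majorant [B / (1 + y ^ 2)] *)

Section DominatedIntegral.

Context (f : R -> C) (B : R).
Context (Hex : forall a b, ex_RInt (V := CR) f a b).
Context (Hdom : forall y, Cmod (f y) <= B / (1 + y ^ 2)).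

Lemma dominated_constant_nonneg : 0 <= B.
Proof.
assert (H := Hdom 0); assert (H0 := Cmod_ge_0 (f 0)).
replace (B / (1 + 0 ^ 2)) with B in H by field; lra.
Qed.

Lemma RInt_dominated (a b : R) : a <= b ->
  Cmod (RInt (V := CR) f a b) <= B * (atan b - atan a).
Proof.
intros Hab; rewrite Rmult_minus_distr_l.
assert (D : forall x, 1 + x ^ 2 <> 0) by (intros x; nra).
apply (norm_RInt_majorant f (fun y => B * atan y) (fun y => B / (1 + y ^ 2))); auto.
- intros x; eapply is_derive_val.
  + apply is_derive_Rmult; [apply is_derive_Rconst | apply is_derive_atan_pow].
  + unfold zero; simpl; field; specialize (D x); nra.
- intros x; apply (ex_derive_continuous (V := R_NormedModule)); auto_derive; apply D.
Qed.

Lemma RInt_dominated_swap (a b : R) :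
  Cmod (RInt (V := CR) f a b) <= B * Rabs (atan b - atan a).
Proof.
destruct (Rle_dec a b) as [H|H].
- eapply Rle_trans; [now apply RInt_dominated|].
  apply Rmult_le_compat_l; [apply dominated_constant_nonneg | apply Rle_abs].
- rewrite <- (opp_RInt_swap (V := CR)) by apply Hex.
  change (Cmod (- RInt (V := CR) f b a)%C <= B * Rabs (atan b - atan a)).
  rewrite Cmod_opp, Rabs_minus_sym.
  eapply Rle_trans; [apply RInt_dominated; lra|].
  apply Rmult_le_compat_l; [apply dominated_constant_nonneg | apply Rle_abs].
Qed.

(** The majorant has the explicit primitive [B * atan y] of total increase [B * PI]. Existence is
    the Cauchy criterion for the two moving endpoints, and the bound passes to the limit. *)
Lemma is_RInt_gen_line_dominated :
  exists l : C, is_RInt_gen (V := CR) f (Rbar_locally m_infty) (Rbar_locally p_infty) l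
    /\ Cmod l <= B * PI.
Proof.
set (F := filter_prod (Rbar_locally m_infty) (Rbar_locally p_infty)).
assert (L : exists l : C, filterlim (fun ab => RInt (V := CR) f (fst ab) (snd ab)) F
    (locally (T := CR) l)).
{ apply (filterlim_locally_cauchy (U := CR)).
  intros eps; assert (He := cond_pos eps).
  assert (HB := dominated_constant_nonneg).
  (* Each of the two tails is at most [B / M]; the summand 1 keeps [M] positive when [B] is zero and
     makes the final inequality strict. *)
  set (M := (2 * B + 1) / eps).
  assert (HM : 0 < M) by (apply Rdiv_lt_0_compat; lra).
  assert (HM' : B * / M + B * / M < eps).
  { unfold M; replace (B * _ + _) with (2 * B / (2 * B + 1) * eps) by (field; lra).
    assert (2 * B / (2 * B + 1) < 1).
    { apply (Rmult_lt_reg_r (2 * B + 1)); [lra|]; field_simplify; lra. }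
    nra. }
  exists (fun ab => fst ab < - M /\ M < snd ab); split.
  - apply (Filter_prod _ _ _ (fun y => y < - M) (fun y => M < y));
      [now exists (- M) | now exists M | now split].
  - intros [a b] [a' b'] [Ha Hb] [Ha' Hb']; simpl in *.
    apply (norm_compat1 (V := CR)).
    eapply Rle_lt_trans; [right; apply norm_CR|].
    change (Cmod (RInt (V := CR) f a' b' - RInt (V := CR) f a b)%C < eps).
    replace (RInt (V := CR) f a' b' - RInt (V := CR) f a b)%C
      with (RInt (V := CR) f a' a + RInt (V := CR) f b b')%C.
    + eapply Rle_lt_trans; [apply Cmod_triangle|].
      eapply Rle_lt_trans; [|exact HM'].
      apply Rplus_le_compat; (eapply Rle_trans; [apply RInt_dominated_swap|]);
        apply Rmult_le_compat_l; auto.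
      * replace (atan a - atan a') with (- (atan (- a) - atan (- a')))
          by (rewrite !atan_opp; ring).
        rewrite Rabs_Ropp; apply atan_increment_le; lra.
      * apply atan_increment_le; lra.
    + rewrite <- (RInt_Chasles (V := CR) f a' a b') by apply Hex.
      rewrite <- (RInt_Chasles (V := CR) f a b b') by apply Hex.
      assert (A : forall u v w : C, (u + v)%C = ((u + (w + v)) - w)%C) by (intros; ring); apply A. }
destruct L as [l Hl]; exists l; split.
- intros P HP; unfold filtermapi.
  assert (HP' := Hl P HP); unfold filtermap in HP'.
  revert HP'; apply filter_imp; intros ab Hab.
  eexists; split; [apply (RInt_correct (V := CR)), Hex | exact Hab].
- assert (FF : ProperFilter F) by (apply filter_prod_proper; apply Rbar_locally_filter).
  rewrite <- norm_CR.
  apply (filterlim_le (F := F) (fun ab => norm (RInt (V := CR) f (fst ab) (snd ab)))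
     (fun _ => B * PI) (Finite (norm (V := CR) l)) (Finite (B * PI))).
  + apply (Filter_prod _ _ _ (fun y => y < 0) (fun y => 0 < y)); [now exists 0 | now exists 0|].
    intros a b Ha Hb; simpl; rewrite norm_CR.
    eapply Rle_trans; [apply RInt_dominated; lra|].
    apply Rmult_le_compat_l; [apply dominated_constant_nonneg|].
    assert (A := atan_bound a); assert (A' := atan_bound b); lra.
  + apply (filterlim_comp _ _ _ _ _ _ _ _ Hl), (filterlim_norm (V := CR)).
  + apply filterlim_const.
Qed.

End DominatedIntegral.

Lemma CRInt_line_unique (f : R -> C) (l : C) :
  is_RInt_gen (V := CR) f (Rbar_locally m_infty) (Rbar_locally p_infty) l ->
  CRInt_line f = l.
Proof. intros H; unfold CRInt_line; exact (is_RInt_gen_unique (V := CR) f l H). Qed.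

(** The integral over a symmetric interval equals its own opposite. The two endpoints of the
    improper integral move independently, but each set of its filter contains a symmetric interval,
    so the limit can only be zero. *)
Lemma is_RInt_gen_line_odd (f : R -> C) (l : C) :
  (forall a b, ex_RInt (V := CR) f a b) -> (forall y, f (- y) = (- f y)%C) ->
  is_RInt_gen (V := CR) f (Rbar_locally m_infty) (Rbar_locally p_infty) l -> l = 0%C.
Proof.
intros Hex Hodd Hl.
assert (Z : forall M, (RInt (V := CR) f (- M) M : C) = 0%C).
{ intros M.
  assert (E : is_RInt (V := CR) f (- M) M (opp (RInt (V := CR) f (- M) M))).
  { refine (is_RInt_swap (V := CR) f _ _ _ _).
    assert (E := is_RInt_comp_opp (V := CR) f M (- M) (RInt (V := CR) f (- M) M)).
    rewrite Ropp_involutive in E.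
    apply (is_RInt_ext (fun y => opp (f (- y)))).
    - intros y _; rewrite Hodd.
      assert (A : forall w : C, (- - w)%C = w) by (intros; ring); apply A.
    - apply E, (RInt_correct (V := CR)), Hex. }
  apply (is_RInt_unique (V := CR)) in E.
  destruct (RInt (V := CR) f (- M) M) as [u v]; injection E; intros D1 D2.
  unfold opp in D1, D2; simpl in D1, D2.
  apply injective_projections; simpl; nra. }
apply Cmod_eq_0; destruct (Cmod_ge_0 l) as [Hpos|]; [exfalso|congruence].
(* Balls are taken componentwise. With radius [Cmod l / 2], a ball around [l] containing 0 would
   give [Cmod l <= Rabs (Re l) + Rabs (Im l) < Cmod l]. *)
destruct (Hl (ball (M := CR) l (mkposreal _ (Rmult_lt_0_compat _ _ Hpos (Rinv_0_lt_compat 2 Rlt_0_2)))))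
  as [Q1 Q2 [M1 HQ1] [M2 HQ2] HQ].
{ apply locally_ball. }
set (M := 1 + Rmax (Rabs M1) (Rabs M2)).
destruct (HQ (- M) M) as [w [Hw Hb]].
- apply HQ1; unfold M.
  assert (A := Rmax_l (Rabs M1) (Rabs M2)); assert (A' := Rle_abs (- M1)).
  rewrite Rabs_Ropp in A'; lra.
- apply HQ2; unfold M.
  assert (A := Rmax_r (Rabs M1) (Rabs M2)); assert (A' := Rle_abs M2); lra.
- simpl in Hw; apply (is_RInt_unique (V := CR)) in Hw.
  rewrite Z in Hw; subst w.
  destruct Hb as [Hb1 Hb2]; simpl in Hb1, Hb2.
  unfold ball in Hb1, Hb2; simpl in Hb1, Hb2.
  unfold AbsRing_ball, abs, minus, plus, opp in Hb1, Hb2; simpl in Hb1, Hb2.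
  rewrite Rplus_0_l, Rabs_Ropp in Hb1, Hb2.
  assert (T := Cmod_le_Re_Im l); unfold Re, Im in T; lra.
Qed.

(** * Linearity of the improper integral *)

Definition line_integral (f : R -> C) (l : C) : Prop :=
  is_RInt_gen (V := CR) f (Rbar_locally m_infty) (Rbar_locally p_infty) l.

Lemma line_integral_unique (f : R -> C) (l l' : C) :
  line_integral f l -> line_integral f l' -> l = l'.
Proof.
intros H H'; rewrite <- (CRInt_line_unique f l H); exact (CRInt_line_unique f l' H').
Qed.

Lemma line_integral_ext (f g : R -> C) (l : C) :
  (forall y, f y = g y) -> line_integral f l -> line_integral g l.
Proof.
intros E; refine (is_RInt_gen_ext (V := CR) f g l _).
apply filter_forall; intros ab y _; apply E.
Qed.

Lemma line_integral_plus (f g : R -> C) (l l' : C) : line_integral f l -> line_integral g l' ->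
  line_integral (fun y => f y + g y)%C (l + l')%C.
Proof. exact (is_RInt_gen_plus (V := CR) f g l l'). Qed.

(** The integral is linear over the reals, whereas a complex factor mixes the two components; they
    are integrated separately. *)
Lemma is_RInt_Cscal (f : R -> C) (a b : R) (l c : C) : is_RInt (V := CR) f a b l ->
  is_RInt (V := CR) (fun y => c * f y)%C a b (c * l)%C.
Proof.
intros H.
assert (H1 := is_RInt_fct_extend_fst (U := R_NormedModule) (V := R_NormedModule) f a b l H).
assert (H2 := is_RInt_fct_extend_snd (U := R_NormedModule) (V := R_NormedModule) f a b l H).
apply (is_RInt_fct_extend_pair (U := R_NormedModule) (V := R_NormedModule) (fun y => c * f y)%C).
- apply (is_RInt_minus (V := R_NormedModule) (fun y => fst c * fst (f y)) (fun y => snd c * snd (f y)));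
    apply (is_RInt_scal (V := R_NormedModule)); assumption.
- apply (is_RInt_plus (V := R_NormedModule) (fun y => fst c * snd (f y)) (fun y => snd c * fst (f y)));
    apply (is_RInt_scal (V := R_NormedModule)); assumption.
Qed.

Lemma filterlim_Cmult_l (c l : C) :
  filterlim (fun w : CR => (c * w)%C : CR) (locally (T := CR) l) (locally (T := CR) (c * l)%C).
Proof.
apply filterlim_locally; intros eps.
set (S := Rabs (fst c) + Rabs (snd c) + 1).
assert (P1 := Rabs_pos (fst c)); assert (P2 := Rabs_pos (snd c)).
assert (HS : 0 < S) by (unfold S; lra).
assert (Hd : 0 < eps / S) by (apply Rdiv_lt_0_compat; [apply cond_pos | exact HS]).
exists (mkposreal _ Hd); intros w [H1 H2].
change (Rabs (fst w - fst l) < eps / S) in H1.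
change (Rabs (snd w - snd l) < eps / S) in H2.
assert (B : forall u v, Rabs u < eps / S -> Rabs v < eps / S ->
   Rabs (fst c * u) + Rabs (snd c * v) < eps).
{ intros u v Hu Hv; rewrite !Rabs_mult.
  replace (pos eps) with (S * (eps / S)) by (field; lra); unfold S at 1.
  nra. }
split; [change (Rabs (fst (c * w)%C - fst (c * l)%C) < eps)
       | change (Rabs (snd (c * w)%C - snd (c * l)%C) < eps)]; simpl.
- replace (_ - _) with (fst c * (fst w - fst l) + - (snd c * (snd w - snd l))) by ring.
  eapply Rle_lt_trans; [apply Rabs_triang|]; rewrite Rabs_Ropp; now apply B.
- replace (_ - _) with (fst c * (snd w - snd l) + snd c * (fst w - fst l)) by ring.
  eapply Rle_lt_trans; [apply Rabs_triang|]; now apply B.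
Qed.

Lemma line_integral_Cscal (f : R -> C) (l c : C) : line_integral f l ->
  line_integral (fun y => c * f y)%C (c * l)%C.
Proof.
intros H P HP; assert (H' := H _ (filterlim_Cmult_l c l P HP)).
unfold filtermapi in *; revert H'; apply filter_imp.
intros ab [w [Hw HPw]]; exists (c * w)%C; split; [now apply is_RInt_Cscal | exact HPw].
Qed.

Lemma line_integral_Csum (f : nat -> R -> C) (l : nat -> C) (n : nat) :
  (forall k, (k <= n)%nat -> line_integral (f k) (l k)) ->
  line_integral (fun y => Csum (fun k => f k y) n) (Csum l n).
Proof.
induction n as [|n IH]; intros H.
- apply (line_integral_ext (f 0%nat)); [intros y; unfold Csum; now rewrite sum_O|].
  unfold Csum; rewrite sum_O; now apply H.
- apply (line_integral_ext (fun y => Csum (fun k => f k y) n + f (S n) y)%C);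
    [intros y; unfold Csum; now rewrite sum_Sn|].
  unfold Csum at 2; rewrite sum_Sn; apply line_integral_plus; [apply IH; intros; apply H; lia | now apply H].
Qed.

(** * From a finite grid to sums over all integers *)

Lemma Series_finite (a : nat -> R) (M : nat) :
  (forall n, (M < n)%nat -> a n = 0) -> Series a = sum_n a M.
Proof.
intros H; apply is_series_unique.
change (is_lim_seq (fun n => sum_n a n) (Finite (sum_n a M))).
apply (is_lim_seq_ext_loc (fun _ => sum_n a M)); [|apply is_lim_seq_const].
exists M; intros n Hn; induction n as [|n IH].
- now replace M with 0%nat by lia.
- destruct (Nat.eq_dec M (S n)) as [->|Hne]; [reflexivity|].
  rewrite IH, sum_Sn, H by lia; unfold plus; simpl; now rewrite Rplus_0_r.
Qed.

Lemma sum_n_cat (u : nat -> R) (m n : nat) :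
  sum_n u (m + S n) = sum_n u m + sum_n (fun k => u (S m + k)%nat) n.
Proof.
induction n as [|n IH].
- rewrite sum_O, Nat.add_1_r, sum_Sn, Nat.add_0_r; reflexivity.
- rewrite Nat.add_succ_r, sum_Sn, IH, sum_Sn; unfold plus; simpl.
  rewrite Rplus_assoc, <- Nat.add_succ_r; reflexivity.
Qed.

Lemma sum_n_rev (u : nat -> R) (m : nat) : sum_n u m = sum_n (fun k => u (m - k)%nat) m.
Proof.
revert u; induction m as [|m IH]; intros u; [now rewrite !sum_O|].
rewrite sum_Sn, IH, (sum_n_cat (fun k => u (S m - k)%nat) 0 m : sum_n _ (S m) = _).
rewrite sum_O, Nat.sub_0_r; unfold plus; simpl; apply Rplus_comm.
Qed.

(** Glues the two one-sided series of [CZsum] into one grid read from left to right. The index 0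
    belongs to the right half, so the grid runs from [- (M + 1)] to [M], with [2 * M + 2] points. *)
Lemma sum_n_symmetric_grid (f : Z -> R) (M : nat) :
  sum_n (fun k => f (Z.of_nat k - Z.of_nat (S M))%Z) (M + S M)
  = sum_n (fun n => f (- Z.of_nat (S n))%Z) M + sum_n (fun n => f (Z.of_nat n)) M.
Proof.
rewrite sum_n_cat, sum_n_rev; f_equal; apply sum_n_ext_loc; intros k Hk; f_equal; lia.
Qed.

Lemma trapezoid_line (g gp V v : R -> R) (a b h W : R) (p : nat) :
  0 < h -> a <= b -> (forall x, x < a \/ b < x -> g x = 0) ->
  deriv_chain (S p) g gp ->
  (forall x, is_derive V x (v x)) -> (forall x, Rabs (gp x) <= v x) ->
  (forall x y, V y - V x <= W) ->
  Rabs (RInt g a b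
        - h * (Series (fun n => g (IZR (Z.of_nat n) * h))
               + Series (fun n => g (IZR (- Z.of_nat (S n)) * h)))) <= h ^ S p * W.
Proof.
intros Hh Hab Hsupp Hch HV Hv HW.
(* With [M * h] beyond [Rabs a + Rabs b], both ends of the grid and all omitted terms of the two
   series lie outside the support. *)
destruct (INR_unbounded ((Rabs a + Rabs b) / h)) as [M HM].
assert (HM' : Rabs a + Rabs b < INR M * h).
{ apply (Rmult_lt_compat_r h) in HM; [|exact Hh].
  replace ((Rabs a + Rabs b) / h * h) with (Rabs a + Rabs b) in HM by (field; lra); exact HM. }
assert (Ha := Rabs_pos a); assert (Hb := Rabs_pos b).
assert (Ha1 := Rle_abs a); assert (Hb1 := Rle_abs b).
assert (Ha2 := Rle_abs (- a)); assert (Hb2 := Rle_abs (- b)); rewrite Rabs_Ropp in Ha2, Hb2.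
assert (Hg : forall x, continuous g x).
{ intros x; destruct Hch as [g' [Hg' _]].
  eapply is_derive_continuous,  Hg'. }
assert (HG : forall x, is_derive (fun x => RInt g a x) x (g x)).
{ intros x; apply (is_derive_RInt (V := R_CompleteNormedModule) g _ a x); [|apply Hg].
  apply filter_forall; intros y; apply (RInt_correct (V := R_CompleteNormedModule)).
  apply (ex_RInt_continuous (V := R_CompleteNormedModule)); intros; apply Hg. }
set (c := - INR (S M) * h); set (N := (M + S M)%nat).
assert (Hnode : c + INR (S N) * h = INR (S M) * h).
{ unfold c, N; replace (S (M + S M)) with (S M + S M)%nat by lia; rewrite plus_INR; ring. }
assert (HSM : INR M * h < INR (S M) * h) by (rewrite S_INR; nra).
assert (Z0 : forall u w, u <= w -> w <= a \/ b <= u -> RInt g u w = 0).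
{ intros u w Huw H; rewrite (RInt_ext g (fun _ => 0)).
  - rewrite RInt_const; unfold scal; simpl; unfold mult; simpl; ring.
  - intros r; rewrite Rmin_left, Rmax_right by lra; intros Hr; apply Hsupp; lra. }
assert (EX : forall u w, ex_RInt g u w).
{ intros u w; apply (ex_RInt_continuous (V := R_CompleteNormedModule)); intros; apply Hg. }
assert (T := trapezoid_error_bound c h N Hh p (fun x => RInt g a x) g gp V v a b 0
  ltac:(unfold c; lra) ltac:(lra) Hsupp HG Hch HV Hv ltac:(lra)).
replace (trapezoid_error c h N (fun x => RInt g a x) g 0) with
  (RInt g a b - h * (Series (fun n => g (IZR (Z.of_nat n) * h))
               + Series (fun n => g (IZR (- Z.of_nat (S n)) * h)))) in T.
- eapply Rle_trans; [exact T|]; apply Rmult_le_compat_l; [apply pow_le; lra | apply HW].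
- unfold trapezoid_error; rewrite Hnode.
  rewrite <- (RInt_Chasles g a b (INR (S M) * h)) by apply EX.
  rewrite (Z0 b (INR (S M) * h)) by lra.
  rewrite <- (opp_RInt_swap g c a), (Z0 c a) by (apply EX || (unfold c; lra)).
  rewrite (Series_finite _ M), (Series_finite _ M).
  + rewrite Rplus_comm with (r1 := sum_n _ M).
    rewrite <- (sum_n_symmetric_grid (fun j => g (IZR j * h)) M); fold N.
    rewrite (sum_n_ext (fun k => g (IZR (Z.of_nat k - Z.of_nat (S M)) * h))
       (fun k => g (c + INR k * h + 0))).
    * unfold plus, opp; simpl; ring.
    * intros k; f_equal; rewrite minus_IZR, <- !INR_IZR_INZ; unfold c; ring.
  + intros n Hn; apply Hsupp; left; rewrite opp_IZR, <- INR_IZR_INZ.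
    assert (INR M < INR (S n)) by (apply lt_INR; lia); nra.
  + intros n Hn; apply Hsupp; right; rewrite <- INR_IZR_INZ.
    assert (INR M < INR n) by (apply lt_INR; lia); nra.
Qed.

Lemma RInt_CR_components (f : R -> C) (a b : R) : (forall x, continuous (U := CR) f x) ->
  (RInt (V := CR) f a b : C) = (RInt (fun t => Re (f t)) a b, RInt (fun t => Im (f t)) a b).
Proof.
intros H; apply (is_RInt_unique (V := CR)).
apply (is_RInt_fct_extend_pair (U := R_NormedModule) (V := R_NormedModule) f);
  apply (RInt_correct (V := R_CompleteNormedModule));
  apply (ex_RInt_continuous (V := R_CompleteNormedModule)); intros x _;
  now destruct (Ccontinuous_proj f x (H x)).
Qed.

Lemma Ctrapezoid_line (g : R -> C) (gre gim V v : R -> R) (a b h W : R) (p : nat) :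
  0 < h -> a <= b -> (forall x, x < a \/ b < x -> g x = 0%C) ->
  deriv_chain (S p) (fun s => Re (g s)) gre -> deriv_chain (S p) (fun s => Im (g s)) gim ->
  (forall x, is_derive V x (v x)) ->
  (forall x, Rabs (gre x) <= v x) -> (forall x, Rabs (gim x) <= v x) ->
  (forall x y, V y - V x <= W) ->
  Cmod (CRInt_line g - RtoC h * CZsum (fun j => g (IZR j * h)%R))%C <= 2 * (h ^ S p * W).
Proof.
intros Hh Hab Hsupp Hre Him HV Hvre Hvim HW.
assert (Hc : forall x, continuous (U := CR) g x).
{ intros x; destruct Hre as [d1 [H1 _]], Him as [d2 [H2 _]].
  apply Ccontinuous_pair; eapply is_derive_continuous; [apply H1 | apply H2]. }
rewrite (CRInt_line_unique g (RInt (V := CR) g a b)).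
- eapply Rle_trans; [apply Cmod_le_Re_Im|].
  rewrite RInt_CR_components by exact Hc.
  assert (T1 := trapezoid_line (fun s => Re (g s)) gre V v a b h W p Hh Hab
     (fun x Hx => f_equal Re (Hsupp x Hx)) Hre HV Hvre HW).
  assert (T2 := trapezoid_line (fun s => Im (g s)) gim V v a b h W p Hh Hab
     (fun x Hx => f_equal Im (Hsupp x Hx)) Him HV Hvim HW).
  unfold CZsum, CSeries.
  match goal with |- Rabs ?u + Rabs ?w <= _ =>
    match type of T1 with Rabs ?u' <= _ => replace u with u' by (unfold Re; simpl; ring) end;
    match type of T2 with Rabs ?w' <= _ => replace w with w' by (unfold Im; simpl; ring) end end.
  lra.
- apply is_RInt_gen_line_compact; auto.
  apply (ex_RInt_continuous (V := CR)); intros; apply Hc.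
Qed.

(** * Symbol classes *)

Fixpoint Cderiv_chain (n : nat) (g gn : R -> C) : Prop :=
  match n with
  | O => forall x, g x = gn x
  | S n => exists g', (forall x, Cder g x (g' x)) /\ Cderiv_chain n g' gn
  end.

Lemma Cderiv_chain_components (n : nat) (g gn : R -> C) : Cderiv_chain n g gn ->
  deriv_chain n (fun s => Re (g s)) (fun s => Re (gn s))
  /\ deriv_chain n (fun s => Im (g s)) (fun s => Im (gn s)).
Proof.
revert g; induction n as [|n IH]; intros g; simpl.
- intros H; split; intros x; now rewrite H.
- intros [g' [Hg' Hch]]; apply IH in Hch; destruct Hch as [H1 H2]; split.
  + exists (fun s => Re (g' s)); split; [intros x; apply Hg' | exact H1].
  + exists (fun s => Im (g' s)); split; [intros x; apply Hg' | exact H2].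
Qed.

Lemma bump_mult (K1 K2 u z : R) (a b N1 N2 : nat) (w1 w2 : C) :
  0 <= K1 -> 0 <= K2 -> 0 <= u -> 0 <= z ->
  Cmod w1 <= K1 * u ^ a * (1 + z) ^ N1 -> Cmod w2 <= K2 * u ^ b * (1 + z) ^ N2 ->
  Cmod (w1 * w2)%C <= (K1 * K2) * u ^ (a + b) * (1 + z) ^ (N1 + N2).
Proof.
intros HK1 HK2 Hu Hz H1 H2; rewrite Cmod_mult, !pow_add.
replace (K1 * K2 * (u ^ a * u ^ b) * ((1 + z) ^ N1 * (1 + z) ^ N2))
  with ((K1 * u ^ a * (1 + z) ^ N1) * (K2 * u ^ b * (1 + z) ^ N2)) by ring.
apply Rmult_le_compat; auto using Cmod_ge_0.
Qed.

Lemma bump_plus (K1 K2 u z : R) (N1 N2 : nat) (w1 w2 : C) :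
  0 <= K1 -> 0 <= K2 -> 0 <= u -> 0 <= z ->
  Cmod w1 <= K1 * u * (1 + z) ^ N1 -> Cmod w2 <= K2 * u * (1 + z) ^ N2 ->
  Cmod (w1 + w2)%C <= (K1 + K2) * u * (1 + z) ^ (N1 + N2).
Proof.
intros HK1 HK2 Hu Hz H1 H2.
eapply Rle_trans; [apply Cmod_triangle|].
assert (P1 : (1 + z) ^ N1 <= (1 + z) ^ (N1 + N2)) by (apply Rle_pow; [lra | lia]).
assert (P2 : (1 + z) ^ N2 <= (1 + z) ^ (N1 + N2)) by (apply Rle_pow; [lra | lia]).
assert (0 <= K1 * u) by (apply Rmult_le_pos; lra).
assert (0 <= K2 * u) by (apply Rmult_le_pos; lra).
nra.
Qed.

Section Symbols.

Context (X : R -> R) (omega0 alpha : R) (Homega0 : 0 < omega0).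

(** The bound is required on the support of the cut-off only. The exponent [a] counts powers of
    [sqrt om]; the growth in the scaled distance to the ray is left unspecified since the Gaussian
    absorbs any power. *)
Definition symbol_bound (a : nat) (f : R -> R -> R -> C) : Prop :=
  exists (K : R) (N : nat), 0 <= K /\
  forall x om s, omega0 < om -> Rabs (X s - x) <= alpha ->
    Cmod (f x om s) <= K * sqrt om ^ a * (1 + sqrt om * Rabs (X s - x)) ^ N.

(* Each derivative in [s] costs a factor [sqrt om ^ d], powers of
   [sqrt om * |X s - x|] being free. *)
Fixpoint symbol (d n a : nat) (f : R -> R -> R -> C) : Prop :=
  symbol_bound a f /\
  match n with
  | O => True
  | S n => exists f' : R -> R -> R -> C,
      (forall x om s, omega0 < om -> Cder (f x om) s (f' x om s)) /\
      symbol d n (a + d) f'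
  end.

Lemma symbol_has_bound (d n a : nat) (f : R -> R -> R -> C) : symbol d n a f -> symbol_bound a f.
Proof. destruct n; intros H; apply H. Qed.

Lemma sqrt_omega_pos (om : R) : omega0 < om -> 0 < sqrt om.
Proof. intros H; apply sqrt_lt_R0; lra. Qed.

Lemma scaled_distance_nonneg (om y : R) : 0 <= sqrt om * Rabs y.
Proof. apply Rmult_le_pos; [apply sqrt_pos | apply Rabs_pos]. Qed.

Lemma symbol_bound_plus (a : nat) (f g : R -> R -> R -> C) :
  symbol_bound a f -> symbol_bound a g ->
  symbol_bound a (fun x om s => f x om s + g x om s)%C.
Proof.
intros [K1 [N1 [HK1 H1]]] [K2 [N2 [HK2 H2]]].
exists (K1 + K2), (N1 + N2)%nat; split; [lra|].
intros x om s Ho Hs; apply bump_plus; auto using scaled_distance_nonneg.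
apply pow_le, sqrt_pos.
Qed.

Lemma symbol_bound_mult (a b : nat) (f g : R -> R -> R -> C) :
  symbol_bound a f -> symbol_bound b g ->
  symbol_bound (a + b) (fun x om s => f x om s * g x om s)%C.
Proof.
intros [K1 [N1 [HK1 H1]]] [K2 [N2 [HK2 H2]]].
exists (K1 * K2), (N1 + N2)%nat; split; [nra|].
intros x om s Ho Hs; apply bump_mult; auto using scaled_distance_nonneg, sqrt_pos.
Qed.

(** This is where frequencies must stay away from zero: for [om > omega0] an additional factor
    [sqrt om] is worth at least [sqrt omega0]. *)
Lemma symbol_bound_incr (a : nat) (f : R -> R -> R -> C) :
  symbol_bound a f -> symbol_bound (S a) f.
Proof.
intros [K [N [HK H]]]; exists (K / sqrt omega0), N.
assert (Hs0 : 0 < sqrt omega0) by now apply sqrt_lt_R0.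
split; [apply Rdiv_le_0_compat; lra|].
intros x om s Ho Hs; eapply Rle_trans; [now apply H|].
apply Rmult_le_compat_r; [apply pow_le; assert (D := scaled_distance_nonneg om (X s - x)); lra|].
rewrite <- tech_pow_Rmult.
replace (K / sqrt omega0 * (sqrt om * sqrt om ^ a))
  with ((K * sqrt om ^ a) * (sqrt om / sqrt omega0)) by (field; lra).
rewrite <- (Rmult_1_r (K * sqrt om ^ a)) at 1.
apply Rmult_le_compat_l; [apply Rmult_le_pos; [lra | apply pow_le, sqrt_pos]|].
apply (Rmult_le_reg_r (sqrt omega0)); [lra|].
unfold Rdiv; rewrite Rmult_assoc, Rinv_l, Rmult_1_l, Rmult_1_r by lra.
apply sqrt_le_1; lra.
Qed.

Lemma symbol_ext (d n a : nat) (f g : R -> R -> R -> C) :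
  (forall x om s, f x om s = g x om s) -> symbol d n a f -> symbol d n a g.
Proof.
intros E H; destruct n as [|n]; simpl in *.
- destruct H as [[K [N [HK H]]] _]; split; [|exact I].
  exists K, N; split; [exact HK|]; intros; rewrite <- E; now apply H.
- destruct H as [[K [N [HK H]]] [f' [Hf' H']]]; split.
  + exists K, N; split; [exact HK|]; intros; rewrite <- E; now apply H.
  + exists f'; split; [|exact H'].
    intros x om s Ho; apply (Cder_ext (f x om)); [intros t; apply E | now apply Hf'].
Qed.

Lemma symbol_incr (d n a : nat) (f : R -> R -> R -> C) : symbol d n a f -> symbol d n (S a) f.
Proof.
revert a f; induction n as [|n IH]; intros a f; simpl.
- intros [H _]; split; [now apply symbol_bound_incr | exact I].
- intros [H [f' [Hf' H']]]; split; [now apply symbol_bound_incr|].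
  exists f'; split; [exact Hf' | now apply IH].
Qed.

Lemma symbol_lower (d n a : nat) (f : R -> R -> R -> C) : symbol d (S n) a f -> symbol d n a f.
Proof.
revert a f; induction n as [|n IH]; intros a f.
- intros [H _]; split; [exact H | exact I].
- intros [H [f' [Hf' H']]]; split; [exact H|].
  exists f'; split; [exact Hf' | now apply IH].
Qed.

Lemma symbol_plus (d n a : nat) (f g : R -> R -> R -> C) : symbol d n a f -> symbol d n a g ->
  symbol d n a (fun x om s => f x om s + g x om s)%C.
Proof.
revert a f g; induction n as [|n IH]; intros a f g; simpl.
- intros [Hf _] [Hg _]; split; [now apply symbol_bound_plus | exact I].
- intros [Hf [f' [Hf' F]]] [Hg [g' [Hg' G]]]; split; [now apply symbol_bound_plus|].
  exists (fun x om s => f' x om s + g' x om s)%C; split; [|now apply IH].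
  intros; apply Cder_plus; auto.
Qed.

Lemma symbol_mult (d n a b : nat) (f g : R -> R -> R -> C) : symbol d n a f -> symbol d n b g ->
  symbol d n (a + b) (fun x om s => f x om s * g x om s)%C.
Proof.
revert a b f g; induction n as [|n IH]; intros a b f g Hf Hg.
- split; [apply symbol_bound_mult; now apply (symbol_has_bound d 0) | exact I].
- split; [apply symbol_bound_mult; now apply (symbol_has_bound d (S n))|].
  assert (Hf0 := symbol_lower _ _ _ _ Hf); assert (Hg0 := symbol_lower _ _ _ _ Hg).
  destruct Hf as [_ [f' [Hf' F]]], Hg as [_ [g' [Hg' G]]].
  exists (fun x om s => f' x om s * g x om s + f x om s * g' x om s)%C.
  split; [intros; apply Cder_mult; auto|].
  apply symbol_plus.
  + replace (a + b + d)%nat with (a + d + b)%nat by lia; exact (IH (a + d)%nat b _ _ F Hg0).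
  + replace (a + b + d)%nat with (a + (b + d))%nat by lia; exact (IH a (b + d)%nat _ _ Hf0 G).
Qed.

Lemma symbol_bound_of_bounded (f : R -> R -> R -> C) (K : R) :
  (forall x om s, omega0 < om -> Rabs (X s - x) <= alpha -> Cmod (f x om s) <= K) ->
  symbol_bound 0 f.
Proof.
intros H; exists (Rmax K 0), 0%nat; split; [apply Rmax_r|].
intros x om s Ho Hs; simpl; rewrite !Rmult_1_r.
eapply Rle_trans; [now apply H | apply Rmax_l].
Qed.

Lemma symbol_coefficient (d n : nat) (c : R -> C) (K : R) :
  (forall om, omega0 < om -> Cmod (c om) <= K) ->
  symbol d n 0 (fun _ om _ => c om).
Proof.
assert (Z : forall n a, symbol d n a (fun _ _ _ => 0%C)).
{ assert (B : forall a, symbol_bound a (fun _ _ _ => 0%C)).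
  { intros a; exists 0, 0%nat; split; [lra|].
    intros; rewrite Cmod_0; simpl; lra. }
  intros k; induction k as [|k IH]; intros a; split; auto.
  exists (fun _ _ _ => 0%C); split; [intros; apply Cder_const | apply IH]. }
intros H; assert (B : symbol_bound 0 (fun _ om _ => c om)).
{ apply (symbol_bound_of_bounded _ K); intros; now apply H. }
destruct n as [|n]; split; auto.
exists (fun _ _ _ => 0%C); split; [intros; apply Cder_const | apply Z].
Qed.

Lemma symbol_const (d n : nat) (c : C) : symbol d n 0 (fun _ _ _ => c).
Proof. apply (symbol_coefficient d n (fun _ => c) (Cmod c)); intros; apply Rle_refl. Qed.

Lemma symbol_Csum (d n a r : nat) (f : nat -> R -> R -> R -> C) :
  (forall j, (j <= r)%nat -> symbol d n a (f j)) ->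
  symbol d n a (fun x om s => Csum (fun j => f j x om s) r).
Proof.
induction r as [|r IH]; intros H.
- apply (symbol_ext d n a (f 0%nat)); [|now apply H].
  intros; unfold Csum; now rewrite sum_O.
- apply (symbol_ext d n a (fun x om s => Csum (fun j => f j x om s) r + f (S r) x om s)%C).
  + intros; unfold Csum at 2; now rewrite sum_Sn.
  + apply symbol_plus; [apply IH; intros; apply H; lia | now apply H].
Qed.

Lemma symbol_pow (d n r : nat) (f : R -> R -> R -> C) : symbol d n 0 f ->
  symbol d n 0 (fun x om s => Cpow (f x om s) r).
Proof.
intros H; induction r as [|r IH].
- apply (symbol_const d n 1).
- apply (symbol_ext d n 0 (fun x om s => f x om s * Cpow (f x om s) r)%C).
  + reflexivity.
  + exact (symbol_mult d n 0 0 _ _ H IH).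
Qed.

(** Cut-off and amplitudes have derivatives bounded uniformly in [om] and belong to the class with
    [d = 0]. Next to the exponential, whose derivatives cost [sqrt om] anyway, nothing is lost by
    placing them in the class with [d = 1]. *)
Lemma symbol_cost_one (n a : nat) (f : R -> R -> R -> C) : symbol 0 n a f -> symbol 1 n a f.
Proof.
revert a f; induction n as [|n IH]; intros a f; simpl; [tauto|].
intros [H [f' [Hf' H']]]; split; [exact H|].
exists f'; split; [exact Hf'|].
rewrite Nat.add_0_r in H'; rewrite Nat.add_1_r.
now apply symbol_incr, IH.
Qed.

Lemma symbol_bound_omega_mult (a : nat) (f : R -> R -> R -> C) : symbol_bound a f ->
  symbol_bound (S (S a)) (fun x om s => RtoC om * f x om s)%C.
Proof.
intros [K [N [HK H]]]; exists K, N; split; [exact HK|].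
intros x om s Ho Hs; rewrite Cmod_mult, Cmod_R, Rabs_pos_eq by lra.
replace (sqrt om ^ S (S a)) with (om * sqrt om ^ a)
  by (rewrite <- !tech_pow_Rmult, <- Rmult_assoc, sqrt_sqrt by lra; reflexivity).
replace (K * (om * sqrt om ^ a) * (1 + sqrt om * Rabs (X s - x)) ^ N)
  with (om * (K * sqrt om ^ a * (1 + sqrt om * Rabs (X s - x)) ^ N)) by ring.
apply Rmult_le_compat_l; [lra | now apply H].
Qed.

Lemma symbol_omega_mult (d n a : nat) (f : R -> R -> R -> C) : symbol d n a f ->
  symbol d n (S (S a)) (fun x om s => RtoC om * f x om s)%C.
Proof.
revert a f; induction n as [|n IH]; intros a f; simpl.
- intros [H _]; split; [now apply symbol_bound_omega_mult | exact I].
- intros [H [f' [Hf' H']]]; split; [now apply symbol_bound_omega_mult|].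
  exists (fun x om s => RtoC om * f' x om s)%C; split.
  + intros; now apply Cder_scal, Hf'.
  + now apply IH.
Qed.

(* A factor of size [|X s - x|] gains back one power of [sqrt om]. *)
Lemma symbol_omega_mult_vanishing (n : nat) (f : R -> R -> R -> C) (K : R) :
  0 <= K -> symbol 0 n 0 f ->
  (forall x om s, omega0 < om -> Rabs (X s - x) <= alpha ->
     Cmod (f x om s) <= K * Rabs (X s - x)) ->
  symbol 1 n 1 (fun x om s => RtoC om * f x om s)%C.
Proof.
intros HK Hf HV.
assert (B : symbol_bound 1 (fun x om s => RtoC om * f x om s)%C).
{ exists K, 1%nat; split; [exact HK|].
  intros x om s Ho Hs; rewrite Cmod_mult, Cmod_R, Rabs_pos_eq, !pow_1 by lra.
  assert (Hq := sqrt_omega_pos om Ho).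
  rewrite <- (sqrt_sqrt om) at 1 by lra.
  assert (HV' := HV x om s Ho Hs).
  assert (D := Rabs_pos (X s - x)).
  apply Rle_trans with (sqrt om * sqrt om * (K * Rabs (X s - x))).
  - apply Rmult_le_compat_l; [nra | exact HV'].
  - assert (0 <= K * sqrt om) by (apply Rmult_le_pos; lra); nra. }
destruct n as [|n]; split; auto.
destruct Hf as [_ [f' [Hf' H']]].
exists (fun x om s => RtoC om * f' x om s)%C; split.
- intros; now apply Cder_scal, Hf'.
- apply (symbol_cost_one n 2), (symbol_omega_mult 0 n 0), H'.
Qed.

(** Differentiating [f * Cexp W] keeps the exponential and replaces [f] by [f' + f * W'], which
    stays in the class with one more power of [sqrt om] because [W'] has order one. *)
Lemma symbol_Cexp_chain (n a : nat) (f W W' : R -> R -> R -> C) :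
  (forall x om s, omega0 < om -> Cder (W x om) s (W' x om s)) ->
  symbol 1 n 1 W' -> symbol 1 n a f ->
  exists fn, symbol_bound (a + n) fn /\ forall x om, omega0 < om ->
    Cderiv_chain n (fun s => f x om s * Cexp (W x om s))%C
      (fun s => fn x om s * Cexp (W x om s))%C.
Proof.
intros HW; revert a f; induction n as [|n IH]; intros a f HW' Hf.
- exists f; rewrite Nat.add_0_r; split; [now apply (symbol_has_bound 1 0) | now intros].
- assert (Hf0 := symbol_lower _ _ _ _ Hf); assert (HW0 := symbol_lower _ _ _ _ HW').
  destruct Hf as [_ [f' [Hf' F]]].
  destruct (IH (a + 1)%nat (fun x om s => f' x om s + f x om s * W' x om s)%C)
    as [fn [Hfn Hch]].
  + exact HW0.
  + apply symbol_plus; [exact F | exact (symbol_mult 1 n a 1 _ _ Hf0 HW0)].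
  + exists fn; replace (a + S n)%nat with (a + 1 + n)%nat by lia; split; [exact Hfn|].
    intros x om Ho; eexists; split; [|now apply Hch].
    intros s; eapply Cder_eq; [apply Cder_mult; [now apply Hf' | now apply Cder_Cexp, HW] | ].
    simpl; ring.
Qed.

End Symbols.

(** * Central rays *)

(** Evaluates the iterated derivatives in [r_tilde] from an explicit chain of functions, each being
    the derivative of the one before. *)
Lemma CDerive_n_chain (F : nat -> R -> C) (n : nat) (z : R) :
  (forall k, (k < n)%nat -> forall t, Cder (F k) t (F (S k) t)) ->
  CDerive_n (F 0%nat) n z = F n z.
Proof.
intros H; unfold CDerive_n.
assert (E : forall k, (k <= n)%nat -> forall t,
   Derive_n (fun t => Re (F 0%nat t)) k t = Re (F k t) /\
   Derive_n (fun t => Im (F 0%nat t)) k t = Im (F k t)).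
{ induction k as [|k IH]; intros Hk t; [now split|].
  destruct (H k ltac:(lia) t) as [H1 H2]; simpl; split.
  - rewrite <- (is_derive_unique _ _ _ H1); apply Derive_ext; intros u; apply IH; lia.
  - rewrite <- (is_derive_unique _ _ _ H2); apply Derive_ext; intros u; apply IH; lia. }
destruct (E n (Nat.le_refl n) z) as [-> ->]; now destruct (F n z).
Qed.

Lemma Cmod_minus_triangle (a b c : C) : Cmod (a - c)%C <= Cmod (a - b)%C + Cmod (b - c)%C.
Proof.
replace (a - c)%C with ((a - b) + (b - c))%C by ring; apply Cmod_triangle.
Qed.

Lemma is_derive_shift (f : R -> R) (x z l : R) :
  is_derive f (x + z) l -> is_derive (fun z => f (x + z)) z l.
Proof.
intros H; eapply is_derive_val.
- apply (is_derive_Rcomp f (fun z => x + z)); [exact H|].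
  apply (is_derive_plus (fun _ => x) (fun z => z));
    [apply is_derive_Rconst | apply is_derive_id].
- unfold plus, zero, one; simpl; ring.
Qed.

Lemma expansion1 (f f' : R -> C) (M x z : R) :
  (forall t, Cder f t (f' t)) -> (forall t, Cmod (f' t) <= M) ->
  Cmod (f (x + z)%R - f x)%C <= 2 * M * Rabs z.
Proof.
intros Hf HM; replace z with (x + z - x) at 2 by ring.
apply (Cder_path_bound f f'); intros; auto.
Qed.

Lemma expansion2 (f f' f'' : R -> C) (M x z : R) :
  (forall t, Cder f t (f' t)) -> (forall t, Cder f' t (f'' t)) -> (forall t, Cmod (f'' t) <= M) ->
  Cmod (f (x + z)%R - (f x + RtoC z * f' x))%C <= 2 * M * Rabs z ^ 2.
Proof.
intros Hf Hf' HM.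
assert (T := taylor_bound (fun j => match j with 0 => f | 1 => f' | _ => f'' end) x (x + z) M 1).
replace (x + z - x) with z in T by ring.
replace (f x + RtoC z * f' x)%C with
  (Csum (fun j => taylor_weight z j * match j with 0 => f | 1 => f' | _ => f'' end x)%C 1).
- apply T; [|now intros].
  intros [|[|j]] t Hj _; [apply Hf | apply Hf' | lia].
- unfold Csum; rewrite sum_Sn, sum_O; change plus with Cplus.
  unfold taylor_weight; simpl; rewrite !Rmult_1_r, !Rdiv_1_r; ring.
Qed.

Lemma expansion3 (f f' f'' f''' : R -> C) (M x z : R) :
  (forall t, Cder f t (f' t)) -> (forall t, Cder f' t (f'' t)) ->
  (forall t, Cder f'' t (f''' t)) -> (forall t, Cmod (f''' t) <= M) ->
  Cmod (f (x + z)%R - (f x + RtoC z * f' x + RtoC (z ^ 2 / 2) * f'' x))%C <= 2 * M * Rabs z ^ 3.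
Proof.
intros Hf Hf' Hf'' HM.
assert (T := taylor_bound (fun j => match j with 0 => f | 1 => f' | 2 => f'' | _ => f''' end)
  x (x + z) M 2).
replace (x + z - x) with z in T by ring.
replace (f x + RtoC z * f' x + RtoC (z ^ 2 / 2) * f'' x)%C with
  (Csum (fun j => taylor_weight z j * match j with 0 => f | 1 => f' | 2 => f'' | _ => f''' end x)%C 2).
- apply T; [|now intros].
  intros [|[|[|j]]] t Hj _; [apply Hf | apply Hf' | apply Hf'' | lia].
- unfold Csum; rewrite !sum_Sn, sum_O; change plus with Cplus.
  unfold taylor_weight; simpl fact; simpl INR; rewrite pow_O, pow_1, !Rdiv_1_r.
  replace (1 + 1) with 2 by ring; ring.
Qed.

(** * The inverse of the ray map and its derivatives *)

Section InverseFunction.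

Context (N : nat) (X m : R -> R) (MX cX : R).
Context (HN : (3 <= N)%nat) (HX : class_C N X)
  (HXb : forall k : nat, (1 <= k <= N)%nat -> forall s, Rabs (Derive_n X k s) <= MX)
  (HcX : 0 < cX) (HXlow : forall s, cX <= Derive X s)
  (HXm : forall x, X (m x) = x).

Lemma X_is_derive_n (k : nat) (s : R) : (k < N)%nat ->
  is_derive (Derive_n X k) s (Derive_n X (S k) s).
Proof.
intros H; apply (Derive_correct (Derive_n X k)); exact (proj1 (HX (S k) ltac:(lia) s)).
Qed.

Lemma X_is_derive (s : R) : is_derive X s (Derive X s).
Proof. apply (X_is_derive_n 0); lia. Qed.

Lemma X_increment (s t : R) : s <= t -> cX * (t - s) <= X t - X s.
Proof.
intros H; destruct (MVT_all X (Derive X) s t X_is_derive) as [c [_ ->]].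
apply Rmult_le_compat_r; [lra | apply HXlow].
Qed.

Lemma inverse_increasing (x y : R) : x <= y -> m x <= m y.
Proof.
intros H; destruct (Rle_dec (m x) (m y)) as [|Hn]; [assumption|exfalso].
assert (I := X_increment (m y) (m x) ltac:(lra)); rewrite !HXm in I; nra.
Qed.

Lemma inverse_lipschitz (x y : R) : Rabs (m y - m x) <= Rabs (y - x) / cX.
Proof.
assert (A : forall x y, x <= y -> Rabs (m y - m x) <= Rabs (y - x) / cX).
{ intros u w H; assert (I := X_increment (m u) (m w) (inverse_increasing u w H)).
  rewrite !HXm in I; assert (J := inverse_increasing u w H).
  rewrite !Rabs_pos_eq by lra; apply (Rmult_le_reg_l cX); [lra|].
  replace (cX * ((w - u) / cX)) with (w - u) by (field; lra); exact I. }
destruct (Rle_dec x y); [now apply A|].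
rewrite Rabs_minus_sym, (Rabs_minus_sym y x); apply A; lra.
Qed.

(** Monotonicity of [X]: a Taylor expansion in [s] between the parameters [m x] and [m y] never
    meets a ray farther from [x] than [y] is, so bounds near the rays apply along the whole
    segment. *)
Lemma between_inverse (x y t : R) :
  Rmin (m x) (m y) <= t <= Rmax (m x) (m y) -> Rabs (X t - x) <= Rabs (y - x).
Proof.
intros H.
assert (Hmon : forall s t, s <= t -> X s <= X t).
{ intros u w Huw; assert (I := X_increment u w Huw); nra. }
destruct (Rle_dec x y) as [Hxy|Hxy].
- rewrite Rmin_left, Rmax_right in H by now apply inverse_increasing.
  destruct H as [H1 H2]; apply Hmon in H1; apply Hmon in H2; rewrite HXm in H1, H2.
  rewrite !Rabs_pos_eq; lra.
- assert (Hyx : y <= x) by lra.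
  rewrite Rmin_right, Rmax_left in H by now apply inverse_increasing.
  destruct H as [H1 H2]; apply Hmon in H1; apply Hmon in H2; rewrite HXm in H1, H2.
  rewrite !Rabs_left1; lra.
Qed.

(** These three functions are the successive derivatives of [m], found by differentiating
    [X (m x) = x]. The third one bounds the remainder of a two-term expansion of the Jacobian [mu1],
    and it is the reason for [3 <= N], which becomes [2 <= p]. *)
Definition mu1 (x : R) : R := / Derive X (m x).
Definition mu2 (x : R) : R := - Derive_n X 2 (m x) * mu1 x ^ 3.
Definition mu3 (x : R) : R :=
  - Derive_n X 3 (m x) * mu1 x ^ 4 - 3 * Derive_n X 2 (m x) * mu1 x ^ 2 * mu2 x.

Lemma mu1_pos (x : R) : 0 < mu1 x <= / cX.
Proof.
assert (H := HXlow (m x)); unfold mu1; split.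
- apply Rinv_0_lt_compat; lra.
- apply Rinv_le_contravar; lra.
Qed.

Lemma inverse_is_derive (x : R) : is_derive m x (mu1 x).
Proof.
apply is_derive_Reals; intros eps Heps.
assert (HX' := proj1 (is_derive_Reals X (m x) (Derive X (m x))) (X_is_derive (m x))).
assert (Hlow := HXlow (m x)).
(* With [D] the derivative of [X] at [m x], the error of the difference quotient [k / h] is
   [k / h / D] times the error of [h / k]. The first factor is at most [/ cX * / cX], which this
   tolerance compensates; the half makes the result strict. *)
assert (Heps' : 0 < eps * cX * cX / 2) by (repeat apply Rmult_lt_0_compat; lra).
destruct (HX' _ Heps') as [delta Hd].
assert (Hd' : 0 < delta * cX) by (apply Rmult_lt_0_compat; [apply cond_pos | lra]).
exists (mkposreal _ Hd'); intros h Hh Hhd; simpl in Hhd.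
set (k := m (x + h) - m x).
assert (Hxk : X (m x + k) = x + h) by (unfold k; rewrite <- (HXm (x + h)) at 2; f_equal; ring).
assert (Hk0 : k <> 0).
{ intros E; rewrite E, Rplus_0_r, HXm in Hxk; lra. }
assert (Hk : Rabs k <= Rabs h / cX).
{ unfold k; replace h with (x + h - x) at 2 by ring; apply inverse_lipschitz. }
assert (Hkd : Rabs k < delta).
{ eapply Rle_lt_trans; [exact Hk|]; apply (Rmult_lt_reg_r cX); [lra|].
  unfold Rdiv; rewrite Rmult_assoc, Rinv_l; lra. }
specialize (Hd k Hk0 Hkd); rewrite Hxk, HXm in Hd.
replace ((x + h - x) / k) with (h / k) in Hd by (f_equal; ring).
set (D := Derive X (m x)) in *.
replace (k / h - mu1 x) with (- (k / h / D * (h / k - D)))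
  by (unfold mu1; fold D; field; repeat split; lra).
rewrite Rabs_Ropp, Rabs_mult.
assert (B : Rabs (k / h / D) <= / cX * / cX).
{ unfold Rdiv; rewrite !Rabs_mult, (Rabs_pos_eq (/ D))
    by (left; apply Rinv_0_lt_compat; lra).
  rewrite Rabs_inv; apply Rmult_le_compat.
  - apply Rmult_le_pos; [apply Rabs_pos | left; apply Rinv_0_lt_compat, Rabs_pos_lt, Hh].
  - left; apply Rinv_0_lt_compat; lra.
  - assert (Hh' : 0 < Rabs h) by now apply Rabs_pos_lt.
    apply (Rmult_le_reg_r (Rabs h)); [lra|].
    rewrite Rmult_assoc, Rinv_l by lra; unfold Rdiv in Hk; lra.
  - apply Rinv_le_contravar; lra. }
apply Rle_lt_trans with (/ cX * / cX * (eps * cX * cX / 2)).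
- apply Rmult_le_compat; try apply Rabs_pos; [exact B | lra].
- replace (/ cX * / cX * (eps * cX * cX / 2)) with (eps / 2) by (field; lra); lra.
Qed.

Lemma X_comp_inverse_is_derive (k : nat) (x : R) : (k < N)%nat ->
  is_derive (fun x => Derive_n X k (m x)) x (mu1 x * Derive_n X (S k) (m x)).
Proof.
intros H; apply (is_derive_Rcomp (Derive_n X k) m); [now apply X_is_derive_n | apply inverse_is_derive].
Qed.

Lemma mu1_is_derive (x : R) : is_derive mu1 x (mu2 x).
Proof.
assert (Hlow := HXlow (m x)).
eapply is_derive_val.
- apply (is_derive_inv (fun x => Derive_n X 1 (m x))); [apply X_comp_inverse_is_derive; lia|].
  change (Derive X (m x) <> 0); lra.
- unfold mu2, mu1; change (Derive_n X 1 (m x)) with (Derive X (m x)); field; lra.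
Qed.

Lemma mu2_is_derive (x : R) : is_derive mu2 x (mu3 x).
Proof.
eapply is_derive_val.
- apply (is_derive_Rmult (fun x => - Derive_n X 2 (m x)) (fun x => mu1 x ^ 3)).
  + apply (is_derive_opp (fun x => Derive_n X 2 (m x))), X_comp_inverse_is_derive; lia.
  + apply (is_derive_pow mu1 3), mu1_is_derive.
- unfold mu3, opp; simpl; ring.
Qed.

Lemma inverse_derivatives_bounded :
  exists K, 0 <= K /\ forall x, Rabs (mu1 x) <= K /\ Rabs (mu2 x) <= K /\ Rabs (mu3 x) <= K.
Proof.
set (b := / cX).
assert (Hb : 0 < b) by (apply Rinv_0_lt_compat; lra).
assert (HM : 0 <= MX).
{ eapply Rle_trans; [apply Rabs_pos | apply (HXb 1 ltac:(lia) 0)]. }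
assert (B1 : forall x, Rabs (mu1 x) <= b).
{ intros x; destruct (mu1_pos x); unfold b; rewrite Rabs_pos_eq; lra. }
assert (Bp : forall x n, Rabs (mu1 x ^ n) <= b ^ n).
{ intros x n; rewrite <- RPow_abs; apply pow_incr; split; [apply Rabs_pos | apply B1]. }
assert (B2 : forall x, Rabs (mu2 x) <= MX * b ^ 3).
{ intros x; unfold mu2; rewrite Rabs_mult, Rabs_Ropp.
  apply Rmult_le_compat; try apply Rabs_pos; [apply HXb; lia | apply Bp]. }
assert (B3 : forall x, Rabs (mu3 x) <= MX * b ^ 4 + 3 * MX * b ^ 2 * (MX * b ^ 3)).
{ intros x; unfold mu3, Rminus; eapply Rle_trans; [apply Rabs_triang|].
  apply Rplus_le_compat; rewrite ?Rabs_Ropp, !Rabs_mult, ?Rabs_Ropp.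
  - apply Rmult_le_compat; try apply Rabs_pos; [apply HXb; lia | apply Bp].
  - rewrite (Rabs_pos_eq 3) by lra.
    repeat first [apply Rmult_le_pos | apply Rmult_le_compat | apply Rabs_pos | apply Bp
      | apply B2 | apply HXb; lia | lra]. }
assert (P2 : 0 <= MX * b ^ 3) by (apply Rmult_le_pos; [lra | apply pow_le; lra]).
assert (P3 : 0 <= MX * b ^ 4 + 3 * MX * b ^ 2 * (MX * b ^ 3)).
{ eapply Rle_trans; [apply Rabs_pos | apply (B3 0)]. }
exists (b + MX * b ^ 3 + (MX * b ^ 4 + 3 * MX * b ^ 2 * (MX * b ^ 3))); split; [lra|].
intros x; assert (H1 := B1 x); assert (H2 := B2 x); assert (H3 := B3 x); lra.
Qed.

Lemma Derive_inverse (x : R) : Derive m x = mu1 x.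
Proof. apply is_derive_unique, inverse_is_derive. Qed.

Lemma Derive2_inverse (x : R) : Derive_n m 2 x = mu2 x.
Proof.
rewrite <- (is_derive_unique _ _ _ (mu1_is_derive x)).
simpl; apply Derive_ext; intros t; apply Derive_inverse.
Qed.

(** The formula of Faà di Bruno for [z => f x (m (x + z))], where only the ray parameter moves and
    the observation point [x] is frozen. This is the function differentiated in [r_tilde] and
    [b1_tilde]; all indices above 2 stand for the third derivative. *)
Definition line_derivative (f : R -> R -> C) (x : R) (k : nat) (z : R) : C :=
  let h j := Cpartial 0 j f x (m (x + z)) in
  let a := RtoC (mu1 (x + z)) in let b := RtoC (mu2 (x + z)) in let c := RtoC (mu3 (x + z)) in
  match k with
  | 0 => f x (m (x + z))
  | 1 => a * h 1%nat
  | 2 => a * a * h 2%nat + b * h 1%nat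
  | _ => a * a * a * h 3%nat + 3 * a * b * h 2%nat + c * h 1%nat
  end%C.

Lemma line_derivative_der (n : nat) (f : R -> R -> C) (x : R) (k : nat) (z : R) :
  Cclass_C2d n f -> (k < n)%nat -> (k < 3)%nat ->
  Cder (line_derivative f x k) z (line_derivative f x (S k) z).
Proof.
intros Hf Hn.
assert (Hh : forall j, (j < n)%nat -> Cder (fun z => Cpartial 0 j f x (m (x + z))) z
   (RtoC (mu1 (x + z)) * Cpartial 0 (S j) f x (m (x + z)))%C).
{ intros j Hj; eapply Cder_eq.
  - apply (Cpartial_chain n f 0 j (fun _ => x) (fun z => m (x + z)) z 0 (mu1 (x + z)) Hf Hj).
    + apply is_derive_Rconst.
    + apply is_derive_shift, inverse_is_derive.
  - ring. }
assert (Ha : Cder (fun z => RtoC (mu1 (x + z))) z (RtoC (mu2 (x + z))))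
  by apply Cder_RtoC, is_derive_shift, mu1_is_derive.
assert (Hb : Cder (fun z => RtoC (mu2 (x + z))) z (RtoC (mu3 (x + z))))
  by apply Cder_RtoC, is_derive_shift, mu2_is_derive.
intros Hk; destruct k as [|[|[|k]]]; [| | | lia].
- apply (Cder_ext (fun z => Cpartial 0 0 f x (m (x + z)))); [intros t; apply Cpartial_00|].
  now apply Hh.
- eapply Cder_eq; [apply (Cder_mult (fun z => RtoC (mu1 (x + z)))); [exact Ha | now apply Hh]|].
  simpl; ring.
- eapply Cder_eq.
  + apply Cder_plus.
    * apply (Cder_mult (fun z => RtoC (mu1 (x + z)) * RtoC (mu1 (x + z)))%C);
        [exact (Cder_mult _ _ _ _ _ Ha Ha) | now apply Hh].
    * apply (Cder_mult (fun z => RtoC (mu2 (x + z)))); [exact Hb | apply Hh; lia].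
  + simpl; ring.
Qed.

(** * Functions restricted to the central rays *)

Section RayFunctions.

Context (n : nat) (f : R -> R -> C) (B : R) (Hf : Cclass_C2d n f)
  (HB : forall j k, (j + k <= n)%nat -> forall s, Cmod (Cpartial j k f (X s) s) <= B).

(** Here the point and the parameter move together along the curve [x => (x, m x)], in contrast with
    [line_derivative]; [ray_derivative] and [ray_derivative2] are the total derivatives along this
    curve. *)
Definition ray_value (j k : nat) (x : R) : C := Cpartial j k f x (m x).
Definition ray_derivative (j k : nat) (x : R) : C :=
  (ray_value (S j) k x + RtoC (mu1 x) * ray_value j (S k) x)%C.
Definition ray_derivative2 (j k : nat) (x : R) : C :=
  (ray_derivative (S j) k x + (RtoC (mu2 x) * ray_value j (S k) x
    + RtoC (mu1 x) * ray_derivative j (S k) x))%C.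

Lemma ray_value_bound (j k : nat) (x : R) : (j + k <= n)%nat -> Cmod (ray_value j k x) <= B.
Proof. intros H; unfold ray_value; rewrite <- (HXm x) at 1; now apply HB. Qed.

Lemma ray_value_der (j k : nat) (x : R) : (j + k < n)%nat ->
  Cder (ray_value j k) x (ray_derivative j k x).
Proof.
intros H; eapply Cder_eq.
- apply (Cpartial_chain n f j k (fun x => x) m x 1 (mu1 x)); auto.
  + exact (is_derive_id x).
  + apply inverse_is_derive.
- unfold ray_derivative, ray_value; ring.
Qed.

Lemma ray_derivative_der (j k : nat) (x : R) : (S (j + k) < n)%nat ->
  Cder (ray_derivative j k) x (ray_derivative2 j k x).
Proof.
intros H; apply Cder_plus; [apply ray_value_der; lia|].
apply (Cder_mult (fun x => RtoC (mu1 x))); [apply Cder_RtoC, mu1_is_derive|].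
apply ray_value_der; lia.
Qed.

Lemma ray_derivative_bound : exists K, 0 <= K /\
  forall j k x, (S (j + k) <= n)%nat -> Cmod (ray_derivative j k x) <= K.
Proof.
destruct inverse_derivatives_bounded as [K [HK Hmu]].
assert (HB0 : 0 <= B).
{ eapply Rle_trans; [apply Cmod_ge_0 | apply (HB 0 0 ltac:(lia) 0)]. }
exists (B + K * B); split; [nra|].
intros j k x H; unfold ray_derivative.
eapply Rle_trans; [apply Cmod_triangle|]; rewrite Cmod_mult, Cmod_R.
apply Rplus_le_compat; [apply ray_value_bound; lia|].
apply Rmult_le_compat; [apply Rabs_pos | apply Cmod_ge_0 | apply Hmu | apply ray_value_bound; lia].
Qed.

Lemma ray_derivative2_bound : exists K, 0 <= K /\
  forall j k x, (S (S (j + k)) <= n)%nat -> Cmod (ray_derivative2 j k x) <= K.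
Proof.
destruct inverse_derivatives_bounded as [K [HK Hmu]].
destruct ray_derivative_bound as [K' [HK' HD]].
assert (HB0 : 0 <= B).
{ eapply Rle_trans; [apply Cmod_ge_0 | apply (HB 0 0 ltac:(lia) 0)]. }
exists (K' + (K * B + K * K')); split; [nra|].
intros j k x H; unfold ray_derivative2.
eapply Rle_trans; [apply Cmod_triangle|]; apply Rplus_le_compat; [apply HD; lia|].
eapply Rle_trans; [apply Cmod_triangle|]; rewrite !Cmod_mult, !Cmod_R.
apply Rplus_le_compat; apply Rmult_le_compat;
  (apply Rabs_pos || apply Cmod_ge_0 || apply Hmu || (apply ray_value_bound; lia) || (apply HD; lia)).
Qed.

Lemma ray_expansion1 (j k : nat) : (S (j + k) <= n)%nat ->
  exists K, 0 <= K /\ forall x z,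
    Cmod (ray_value j k (x + z)%R - ray_value j k x)%C <= K * Rabs z.
Proof.
intros H; destruct ray_derivative_bound as [K [HK HD]].
exists (2 * K); split; [lra|].
intros x z; apply (expansion1 _ (ray_derivative j k)); intros t; [apply ray_value_der; lia | now apply HD].
Qed.

Lemma ray_expansion2 (j k : nat) : (S (S (j + k)) <= n)%nat ->
  exists K, 0 <= K /\ forall x z,
    Cmod (ray_value j k (x + z)%R - (ray_value j k x + RtoC z * ray_derivative j k x))%C
    <= K * Rabs z ^ 2.
Proof.
intros H; destruct ray_derivative2_bound as [K [HK HD]].
exists (2 * K); split; [lra|].
intros x z; apply (expansion2 _ _ (ray_derivative2 j k)); intros t;
  [apply ray_value_der; lia | apply ray_derivative_der; lia | now apply HD].
Qed.

End RayFunctions.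

Lemma cubic_composition (K w z a1 a2 : R) :
  0 <= K -> Rabs z <= 1 -> Rabs w <= K * Rabs z -> Rabs a1 <= K -> Rabs a2 <= K ->
  Rabs (w - (z * a1 + z ^ 2 / 2 * a2)) <= K * Rabs z ^ 3 ->
  Rabs (w ^ 2 - (a1 ^ 2 * z ^ 2 + a1 * a2 * z ^ 3)) <= 4 * K ^ 2 * Rabs z ^ 4 /\
  Rabs (w ^ 3 - a1 ^ 3 * z ^ 3) <= 6 * K ^ 3 * Rabs z ^ 4.
Proof.
intros HK Hz Hw H1 H2 Hr.
set (r := w - (z * a1 + z ^ 2 / 2 * a2)) in *.
assert (P := Rabs_pos z); set (y := Rabs z) in *.
assert (Hz1 : Rabs (z * a1) <= K * y).
{ rewrite Rabs_mult; fold y; rewrite Rmult_comm; now apply Rmult_le_compat_r. }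
assert (Hz2 : Rabs (z ^ 2 / 2 * a2) <= K * y ^ 2).
{ unfold Rdiv; rewrite !Rabs_mult, <- RPow_abs, (Rabs_pos_eq (/ 2)) by lra; fold y.
  assert (0 <= y ^ 2) by (apply pow_le; lra); nra. }
assert (Hy2 : y ^ 2 <= y) by nra.
assert (Hy32 : y ^ 3 <= y ^ 2) by nra.
split.
- replace (w ^ 2 - (a1 ^ 2 * z ^ 2 + a1 * a2 * z ^ 3))
    with (r * (w + z * a1 + z ^ 2 / 2 * a2) + (z ^ 2 / 2 * a2) * (z ^ 2 / 2 * a2))
    by (unfold r; field).
  eapply Rle_trans; [apply Rabs_triang|].
  replace (4 * K ^ 2 * y ^ 4) with ((K * y ^ 3) * (3 * K * y) + (K * y ^ 2) * (K * y ^ 2)) by ring.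
  apply Rplus_le_compat; rewrite Rabs_mult; apply Rmult_le_compat; try apply Rabs_pos; auto.
  eapply Rle_trans; [apply Rabs_triang|].
  assert (T := Rabs_triang w (z * a1)); nra.
- replace (w ^ 3 - a1 ^ 3 * z ^ 3)
    with ((r + z ^ 2 / 2 * a2) * (w * w + w * (z * a1) + (z * a1) * (z * a1)))
    by (unfold r; field).
  replace (6 * K ^ 3 * y ^ 4) with ((2 * K * y ^ 2) * (3 * (K * y) * (K * y))) by ring.
  rewrite Rabs_mult; apply Rmult_le_compat; try apply Rabs_pos.
  + eapply Rle_trans; [apply Rabs_triang|]; nra.
  + eapply Rle_trans; [apply Rabs_triang|].
    eapply Rle_trans; [apply Rplus_le_compat_r, Rabs_triang|].
    rewrite !Rabs_mult.
    assert (Rabs w * Rabs w <= (K * y) * (K * y))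
      by (apply Rmult_le_compat; auto using Rabs_pos).
    assert (Rabs w * (Rabs z * Rabs a1) <= (K * y) * (K * y))
      by (rewrite <- Rabs_mult; apply Rmult_le_compat; auto using Rabs_pos).
    assert ((Rabs z * Rabs a1) * (Rabs z * Rabs a1) <= (K * y) * (K * y))
      by (rewrite <- Rabs_mult; apply Rmult_le_compat; auto using Rabs_pos).
    nra.
Qed.

(** * Taylor errors of beam data near the rays *)

Section TaylorAlongRay.

Context (n : nat) (f : R -> R -> C) (B : R) (Hf : Cclass_C2d n f)
  (HBnear : forall j k, (j + k <= n)%nat -> forall x s,
     Rabs (X s - x) <= 1 -> Cmod (Cpartial j k f x s) <= B).

Lemma bound_on_ray (j k : nat) : (j + k <= n)%nat ->
  forall s, Cmod (Cpartial j k f (X s) s) <= B.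
Proof. intros H s; apply HBnear; [exact H|]; rewrite Rminus_diag, Rabs_R0; lra. Qed.

Lemma taylor_x_shift (r : nat) (x z : R) :
  taylor_x X r f x (m (x + z))
  = Csum (fun j => taylor_weight (- z) j * ray_value f j 0 (x + z))%C r.
Proof.
unfold taylor_x, taylor_weight, ray_value; rewrite !HXm.
now replace (x - (x + z)) with (- z) by ring.
Qed.

(** With [s = m (x + z)] the base point is [x + z] and the evaluation point is [x]. The displacement
    is therefore [- z], and the segment between them stays within distance 1 of the ray, where the
    derivatives are bounded. *)
Lemma taylor_x_error (r : nat) (x z : R) : (r < n)%nat -> Rabs z <= 1 ->
  Cmod (f x (m (x + z)%R) - taylor_x X r f x (m (x + z)%R))%C <= 2 * B * Rabs z ^ S r.
Proof.
intros Hr Hz.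
assert (T := taylor_bound (fun j t => Cpartial j 0 f t (m (x + z))) (x + z) x B r
  (fun j t Hj _ => Cpartial_der_x n f j 0 t (m (x + z)) Hf ltac:(lia))).
cbv beta in T; rewrite Cpartial_00 in T.
replace (x - (x + z)) with (- z) in T by ring; rewrite Rabs_Ropp in T.
rewrite taylor_x_shift; unfold ray_value; apply T.
intros t Ht; apply HBnear; [lia|]; rewrite HXm.
revert Ht Hz; unfold Rmin, Rmax; destruct (Rle_dec (x + z) x); intros Ht Hz;
  apply Rabs_le_between in Hz; apply Rabs_le_between; lra.
Qed.

(** Common form of [p_tilde], for the phase, and of [a_tilde], for the amplitudes; the sign reflects
    the displacement [- z]. *)
Definition signed_taylor_coefficient (j : nat) (x : R) : C :=
  (RtoC ((-1) ^ j / INR (fact j)) * Cpartial j 0 f x (m x))%C.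

Lemma taylor_weight_opp (z : R) (j : nat) :
  taylor_weight (- z) j = (RtoC (z ^ j) * RtoC ((-1) ^ j / INR (fact j)))%C.
Proof.
unfold taylor_weight; rewrite <- RtoC_mult; f_equal.
replace (- z) with (z * -1) by ring; rewrite Rpow_mult_distr; apply Rmult_assoc.
Qed.

Lemma signed_taylor_coefficient_der (j : nat) (x : R) : (j < n)%nat ->
  Cder (signed_taylor_coefficient j) x
    (RtoC ((-1) ^ j / INR (fact j)) * ray_derivative f j 0 x)%C.
Proof. intros H; apply Cder_scal, (ray_value_der n f Hf); lia. Qed.

(** The first two omitted Taylor terms have coefficients on the ray through [x + z], whereas the
    claimed ones are taken at [x]. Moving them to [x] costs one derivative along the ray for the
    lower coefficient and nothing at this order for the higher one. This is the origin of the
    derivatives in [b2] and [a2]. *)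
Lemma taylor_x_two_terms (r : nat) : (r + 3 <= n)%nat ->
  exists K, 0 <= K /\ forall x z, Rabs z <= 1 ->
  Cmod (f x (m (x + z)%R) - taylor_x X r f x (m (x + z)%R)
    - (RtoC (z ^ (r + 1)) * signed_taylor_coefficient (r + 1) x
       + RtoC (z ^ (r + 2)) * (signed_taylor_coefficient (r + 2) x
                             + CDerive (signed_taylor_coefficient (r + 1)) x)))%C
  <= K * Rabs z ^ (r + 3).
Proof.
intros Hr.
destruct (ray_expansion2 n f B Hf bound_on_ray (r + 1) 0 ltac:(lia)) as [K1 [HK1 E1]].
destruct (ray_expansion1 n f B Hf bound_on_ray (r + 2) 0 ltac:(lia)) as [K2 [HK2 E2]].
assert (HB : 0 <= B).
{ eapply Rle_trans; [apply Cmod_ge_0 | apply (bound_on_ray 0 0 ltac:(lia) 0)]. }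
set (k1 := (-1) ^ (r + 1) / INR (fact (r + 1))); set (k2 := (-1) ^ (r + 2) / INR (fact (r + 2))).
exists (2 * B + Rabs k1 * K1 + Rabs k2 * K2).
assert (P1 := Rabs_pos k1); assert (P2 := Rabs_pos k2).
split; [nra|].
intros x z Hz.
assert (T := taylor_x_error (r + 2) x z ltac:(lia) Hz).
replace (S (r + 2)) with (r + 3)%nat in T by lia.
rewrite (Cder_unique _ _ _ (signed_taylor_coefficient_der (r + 1) x ltac:(lia))).
set (F := f x (m (x + z))) in *.
assert (ET : taylor_x X (r + 2) f x (m (x + z)) = (taylor_x X r f x (m (x + z))
   + RtoC (z ^ (r + 1)) * RtoC k1 * ray_value f (r + 1) 0 (x + z)
   + RtoC (z ^ (r + 2)) * RtoC k2 * ray_value f (r + 2) 0 (x + z))%C).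
{ rewrite !taylor_x_shift; unfold k1, k2; rewrite <- !taylor_weight_opp.
  replace (r + 2)%nat with (S (S r)) by lia; replace (r + 1)%nat with (S r) by lia.
  unfold Csum; rewrite !sum_Sn; reflexivity. }
rewrite ET in T.
unfold signed_taylor_coefficient; fold k1 k2 (ray_value f (r + 1) 0 x) (ray_value f (r + 2) 0 x).
set (Tr := taylor_x X r f x (m (x + z))) in *.
match goal with |- Cmod ?u <= _ => replace u with
  ((F - (Tr + RtoC (z ^ (r + 1)) * RtoC k1 * ray_value f (r + 1) 0 (x + z)%R
        + RtoC (z ^ (r + 2)) * RtoC k2 * ray_value f (r + 2) 0 (x + z)%R))
   + RtoC (z ^ (r + 1)) * RtoC k1
     * (ray_value f (r + 1) 0 (x + z)%R
        - (ray_value f (r + 1) 0 x + RtoC z * ray_derivative f (r + 1) 0 x))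
   + RtoC (z ^ (r + 2)) * RtoC k2 * (ray_value f (r + 2) 0 (x + z)%R - ray_value f (r + 2) 0 x))%C end.
- eapply Rle_trans; [apply Cmod_triangle|]; rewrite !Rmult_plus_distr_r.
  apply Rplus_le_compat; [eapply Rle_trans; [apply Cmod_triangle|]; apply Rplus_le_compat; [exact T|]|];
    rewrite !Cmod_mult, !Cmod_R, <- RPow_abs.
  + apply Rle_trans with (Rabs z ^ (r + 1) * Rabs k1 * (K1 * Rabs z ^ 2)).
    * apply Rmult_le_compat_l; [apply Rmult_le_pos; [apply pow_le|]; apply Rabs_pos | apply E1].
    * right; replace (r + 3)%nat with ((r + 1) + 2)%nat by lia; rewrite (pow_add _ (r + 1) 2); ring.
  + apply Rle_trans with (Rabs z ^ (r + 2) * Rabs k2 * (K2 * Rabs z)).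
    * apply Rmult_le_compat_l; [apply Rmult_le_pos; [apply pow_le|]; apply Rabs_pos | apply E2].
    * right; replace (r + 3)%nat with ((r + 2) + 1)%nat by lia; rewrite (pow_add _ (r + 2) 1), pow_1; ring.
- replace (z ^ (r + 2)) with (z ^ (r + 1) * z)
    by (replace (r + 2)%nat with (r + 1 + 1)%nat by lia; rewrite (pow_add _ (r + 1) 1), pow_1; ring).
  rewrite RtoC_mult; ring.
Qed.

Lemma inverse_factorial_bound (j : nat) : 0 < / INR (fact j) <= 1.
Proof.
assert (F : 1 <= INR (fact j)) by (apply (le_INR 1), lt_O_fact).
split; [apply Rinv_0_lt_compat; lra | rewrite <- Rinv_1; apply Rinv_le_contravar; lra].
Qed.

Lemma signed_taylor_coefficient_bound : exists K, 0 <= K /\ forall j x,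
  ((j <= n)%nat -> Cmod (signed_taylor_coefficient j x) <= K) /\
  ((S j <= n)%nat -> Cmod (CDerive (signed_taylor_coefficient j) x) <= K).
Proof.
destruct (ray_derivative_bound n f B bound_on_ray) as [K [HK HD]].
assert (HB : 0 <= B).
{ eapply Rle_trans; [apply Cmod_ge_0 | apply (bound_on_ray 0 0 ltac:(lia) 0)]. }
assert (W : forall j, Rabs ((-1) ^ j / INR (fact j)) <= 1).
{ intros j; destruct (inverse_factorial_bound j) as [F1 F2].
  unfold Rdiv; rewrite Rabs_mult, pow_1_abs, Rmult_1_l, Rabs_pos_eq; lra. }
exists (B + K); split; [lra|]; intros j x; split; intros Hj.
- unfold signed_taylor_coefficient; rewrite Cmod_mult, Cmod_R.
  assert (V := ray_value_bound n f B bound_on_ray j 0 x ltac:(lia)); unfold ray_value in V.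
  assert (P := Cmod_ge_0 (Cpartial j 0 f x (m x))); assert (Wj := W j).
  assert (Q := Rabs_pos ((-1) ^ j / INR (fact j))); nra.
- rewrite (Cder_unique _ _ _ (signed_taylor_coefficient_der j x ltac:(lia))).
  rewrite Cmod_mult, Cmod_R.
  assert (V := HD j 0%nat x ltac:(lia)).
  assert (P := Cmod_ge_0 (ray_derivative f j 0 x)); assert (Wj := W j).
  assert (Q := Rabs_pos ((-1) ^ j / INR (fact j))); nra.
Qed.

End TaylorAlongRay.

(** * The phase near the central ray *)

Section Phase.

Context (q : nat) (phi : R -> R -> C) (Mphi cI CI : R).
Context (Hphi : Cclass_C2d (N + q + 3) phi)
  (Hphib : forall j k, (j + k <= N + q + 3)%nat -> forall x s,
     Rabs (X s - x) <= 1 -> Cmod (Cpartial j k phi x s) <= Mphi)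
  (HmX : forall s, m (X s) = s)
  (phi_real : forall s, Im (phi (X s) s) = 0)
  (phi_x_real : forall s, Im (Cpartial 1 0 phi (X s) s) = 0)
  (phi_s_zero : forall s, Cpartial 0 1 phi (X s) s = 0%C)
  (HcI : 0 < cI) (Hconv : forall s, cI <= im_phi_xx phi (X s) s <= CI).

Lemma Mphi_nonneg : 0 <= Mphi.
Proof.
eapply Rle_trans; [apply Cmod_ge_0 | apply (Hphib 0 0 ltac:(lia) (X 0) 0)].
rewrite Rminus_diag, Rabs_R0; lra.
Qed.

Lemma phase_ray_bound (j k : nat) : (j + k <= N + q + 3)%nat -> forall s,
  Cmod (Cpartial j k phi (X s) s) <= Mphi.
Proof. intros H s; apply Hphib; [exact H|]; rewrite Rminus_diag, Rabs_R0; lra. Qed.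

Lemma ray_value_s_zero (x : R) : ray_value phi 0 1 x = 0%C.
Proof. unfold ray_value; rewrite <- (HXm x) at 1; apply phi_s_zero. Qed.

Lemma ray_derivative_s_zero (x : R) : ray_derivative phi 0 1 x = 0%C.
Proof.
assert (H := ray_value_der _ phi Hphi 0 1 x ltac:(lia)).
apply Cder_unique in H; rewrite <- H.
apply Cder_unique, (Cder_ext (fun _ => 0%C)); [intros t; now rewrite ray_value_s_zero | apply Cder_const].
Qed.

Lemma Im_ray_derivative_x_zero (x : R) : Im (ray_derivative phi 1 0 x) = 0.
Proof.
destruct (ray_value_der _ phi Hphi 1 0 x ltac:(lia)) as [_ H].
apply is_derive_unique in H; rewrite <- H.
rewrite (Derive_ext _ (fun _ => 0)); [apply Derive_const|].
intros t; unfold ray_value; rewrite <- (HXm t) at 1; apply phi_x_real.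
Qed.

(* Differentiate [phi_s (X s) s = 0] and [Im (phi_x (X s) s) = 0] along the ray. *)
Lemma im_phi_xx_ray (x : R) : im_phi_xx phi x (m x) = mu1 x ^ 2 * Im (ray_value phi 0 2 x).
Proof.
assert (H1 := ray_derivative_s_zero x); assert (H2 := Im_ray_derivative_x_zero x).
unfold ray_derivative in H1, H2; apply (f_equal Im) in H1.
change (Im (Cpartial 2 0 phi x (m x))) with (Im (ray_value phi 2 0 x)).
unfold im_phi_xx; change (Cpartial 2 0 phi x (m x)) with (ray_value phi 2 0 x).
destruct (ray_value phi 1 1 x) as [a b], (ray_value phi 0 2 x) as [c d], (ray_value phi 2 0 x) as [e f].
unfold Im in *; simpl in *; nra.
Qed.

Lemma im_phi_xx_bounds (x : R) : cI <= im_phi_xx phi x (m x) <= CI.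
Proof. rewrite <- (HXm x) at 1 3; apply Hconv. Qed.

Lemma r_tilde_2 (x : R) : r_tilde phi m 2 x = (RtoC (mu1 x ^ 2 / 2) * ray_value phi 0 2 x)%C.
Proof.
unfold r_tilde.
change (fun z => phi x (m (x + z))) with (line_derivative phi x 0).
rewrite (CDerive_n_chain (line_derivative phi x))
  by (intros; apply (line_derivative_der (N + q + 3)); auto; lia).
simpl; rewrite Rplus_0_r; fold (ray_value phi 0 1 x) (ray_value phi 0 2 x).
rewrite ray_value_s_zero.
replace (mu1 x * (mu1 x * 1) / 2) with (/ (1 + 1) * (mu1 x * mu1 x)) by field.
rewrite !RtoC_mult; ring.
Qed.

Lemma r_tilde_3 (x : R) : r_tilde phi m 3 x =
  (RtoC (mu1 x ^ 3 / 6) * ray_value phi 0 3 x + RtoC (mu1 x * mu2 x / 2) * ray_value phi 0 2 x)%C.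
Proof.
unfold r_tilde.
change (fun z => phi x (m (x + z))) with (line_derivative phi x 0).
rewrite (CDerive_n_chain (line_derivative phi x))
  by (intros; apply (line_derivative_der (N + q + 3)); auto; lia).
unfold line_derivative; rewrite Rplus_0_r.
fold (ray_value phi 0 1 x) (ray_value phi 0 2 x) (ray_value phi 0 3 x).
rewrite ray_value_s_zero.
replace (mu1 x ^ 3 / 6) with (/ INR (fact 3) * (mu1 x * mu1 x * mu1 x)) by (simpl; field).
replace (mu1 x * mu2 x / 2) with (/ INR (fact 3) * (3 * mu1 x * mu2 x)) by (simpl; field).
rewrite !RtoC_mult; ring.
Qed.

(** Justifies the definition of the beam width: as [omega * eta ^ 2 * im_phi_xx = 1], the quadratic
    part of the rescaled exponent has real part exactly [- y ^ 2 / 2]. *)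
Lemma Im_r_tilde_2 (x : R) : Im (r_tilde phi m 2 x) = im_phi_xx phi x (m x) / 2.
Proof.
rewrite r_tilde_2, im_phi_xx_ray; unfold Im; simpl; field.
Qed.

(** Two expansions are composed, that of the phase in [s] at [m x] and that of [m] at [x]. The
    linear term is absent because [phi_s] vanishes on the rays, so the phase is stationary in the
    ray parameter. *)
Lemma phase_cubic : exists K, 0 <= K /\ forall x z, Rabs z <= 1 ->
  Cmod (phi x (m (x + z)%R) - (phi x (m x) + RtoC (z ^ 2) * r_tilde phi m 2 x
        + RtoC (z ^ 3) * r_tilde phi m 3 x))%C <= K * Rabs z ^ 4.
Proof.
destruct inverse_derivatives_bounded as [K0 [HK0 Hmu]].
(* Large enough for the Lipschitz constant [/ cX] of [m], for [mu1] and [mu2], and for the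
   third-order remainder [2 * K0] of [m]. *)
set (K := 2 * K0 + / cX).
assert (HcX' : 0 < / cX) by now apply Rinv_0_lt_compat.
assert (HK : 0 <= K) by (unfold K; lra).
assert (HM := Mphi_nonneg).
exists (2 * Mphi * K ^ 4 + Mphi * (4 * K ^ 2) + Mphi * (6 * K ^ 3)); split.
{ assert (0 <= K ^ 4) by now apply pow_le.
  assert (0 <= K ^ 2) by now apply pow_le.
  assert (0 <= K ^ 3) by now apply pow_le.
  assert (0 <= Mphi * K ^ 4) by now apply Rmult_le_pos.
  assert (0 <= Mphi * K ^ 2) by now apply Rmult_le_pos.
  assert (0 <= Mphi * K ^ 3) by now apply Rmult_le_pos. lra. }
intros x z Hz.
set (w := m (x + z) - m x).
assert (Hw : Rabs w <= K * Rabs z).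
{ unfold w; eapply Rle_trans; [apply inverse_lipschitz|].
  replace (x + z - x) with z by ring; unfold K, Rdiv; assert (P := Rabs_pos z); nra. }
assert (Hr : Rabs (w - (z * mu1 x + z ^ 2 / 2 * mu2 x)) <= K * Rabs z ^ 3).
{ assert (E := expansion3 (fun t => RtoC (m t)) (fun t => RtoC (mu1 t)) (fun t => RtoC (mu2 t))
    (fun t => RtoC (mu3 t)) K0 x z
    (fun t => Cder_RtoC _ _ _ (inverse_is_derive t))
    (fun t => Cder_RtoC _ _ _ (mu1_is_derive t))
    (fun t => Cder_RtoC _ _ _ (mu2_is_derive t))).
  cbv beta in E; rewrite <- !RtoC_mult, <- !RtoC_plus, <- RtoC_minus, Cmod_R in E.
  replace (w - (z * mu1 x + z ^ 2 / 2 * mu2 x))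
    with (m (x + z) - (m x + z * mu1 x + z ^ 2 / 2 * mu2 x)) by (unfold w; ring).
  eapply Rle_trans; [apply E; intros t; rewrite Cmod_R; apply Hmu|].
  apply Rmult_le_compat_r; [apply pow_le, Rabs_pos | unfold K; lra]. }
destruct (Hmu x) as [Hmu1 [Hmu2 _]].
destruct (cubic_composition K w z (mu1 x) (mu2 x)) as [Q1 Q2]; auto; try (unfold K; lra).
assert (T := taylor_bound (fun j t => Cpartial 0 j phi x t) (m x) (m (x + z)) Mphi 3).
assert (T' := T (fun j t Hj _ => Cpartial_der_y _ phi 0 j x t Hphi ltac:(lia))).
clear T; cbv beta in T'; rewrite Cpartial_00 in T'; fold w in T'.
assert (Hw4 : Rabs w ^ 4 <= K ^ 4 * Rabs z ^ 4).
{ rewrite <- Rpow_mult_distr; apply pow_incr; split; [apply Rabs_pos | exact Hw]. }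
assert (T2 : Cmod (phi x (m (x + z)%R) - Csum (fun j => taylor_weight w j * Cpartial 0 j phi x (m x)) 3)%C
   <= 2 * Mphi * K ^ 4 * Rabs z ^ 4).
{ eapply Rle_trans; [apply T'|].
  - intros t Ht; apply between_inverse in Ht.
    replace (x + z - x) with z in Ht by ring; apply Hphib; [lia | lra].
  - rewrite (Rmult_assoc (2 * Mphi)); apply Rmult_le_compat_l; [lra | exact Hw4]. }
rewrite !Rmult_plus_distr_r, Rplus_assoc.
eapply Rle_trans; [apply (Cmod_minus_triangle _
  (Csum (fun j => taylor_weight w j * Cpartial 0 j phi x (m x)) 3)%C)|].
apply Rplus_le_compat; [exact T2|].
unfold Csum; rewrite !sum_Sn, sum_O; change plus with Cplus; unfold taylor_weight.
rewrite Cpartial_00; fold (ray_value phi 0 1 x) (ray_value phi 0 2 x) (ray_value phi 0 3 x).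
rewrite ray_value_s_zero, r_tilde_2, r_tilde_3.
match goal with |- Cmod ?u <= _ =>
  replace u with (RtoC (/ 2 * (w ^ 2 - (mu1 x ^ 2 * z ^ 2 + mu1 x * mu2 x * z ^ 3))) * ray_value phi 0 2 x
    + RtoC (/ 6 * (w ^ 3 - mu1 x ^ 3 * z ^ 3)) * ray_value phi 0 3 x)%C end.
- eapply Rle_trans; [apply Cmod_triangle|]; rewrite !Cmod_mult, !Cmod_R, !Rabs_mult.
  rewrite !(Rabs_pos_eq (/ _)) by lra.
  assert (V2 := ray_value_bound _ phi Mphi phase_ray_bound 0 2 x ltac:(lia)).
  assert (V3 := ray_value_bound _ phi Mphi phase_ray_bound 0 3 x ltac:(lia)).
  apply Rplus_le_compat.
  + rewrite (Rmult_assoc Mphi), (Rmult_comm Mphi); apply Rmult_le_compat; auto using Cmod_ge_0.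
    * apply Rmult_le_pos; [lra | apply Rabs_pos].
    * assert (P := Rabs_pos (w ^ 2 - (mu1 x ^ 2 * z ^ 2 + mu1 x * mu2 x * z ^ 3))); lra.
  + rewrite (Rmult_assoc Mphi), (Rmult_comm Mphi); apply Rmult_le_compat; auto using Cmod_ge_0.
    * apply Rmult_le_pos; [lra | apply Rabs_pos].
    * assert (P := Rabs_pos (w ^ 3 - mu1 x ^ 3 * z ^ 3)); lra.
- simpl fact; simpl INR.
  replace (w ^ 0 / 1) with 1 by (simpl; field).
  replace (w ^ 2 / (1 + 1)) with (/ 2 * w ^ 2) by field.
  replace (w ^ 3 / (1 + 1 + 1 + 1 + 1 + 1)) with (/ 6 * w ^ 3) by field.
  destruct (ray_value phi 0 2 x) as [a b], (ray_value phi 0 3 x) as [c d], (phi x (m x)) as [e f].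
  apply injective_projections; simpl; field.
Qed.

Lemma phase_ray_value_real (x : R) : Im (phi x (m x)) = 0.
Proof. rewrite <- (HXm x) at 1; apply phi_real. Qed.

Lemma r_tilde_3_bound : exists K, 0 <= K /\ forall x, Cmod (r_tilde phi m 3 x) <= K.
Proof.
destruct inverse_derivatives_bounded as [K [HK Hmu]].
assert (HM := Mphi_nonneg).
exists (K ^ 3 * Mphi + K * K * Mphi); split.
{ assert (0 <= K ^ 3) by now apply pow_le. nra. }
intros x; rewrite r_tilde_3; destruct (Hmu x) as [H1 [H2 _]].
eapply Rle_trans; [apply Cmod_triangle|]; rewrite !Cmod_mult, !Cmod_R; unfold Rdiv.
apply Rplus_le_compat; apply Rmult_le_compat; try apply Rabs_pos; try apply Cmod_ge_0;
  try (apply (ray_value_bound _ phi Mphi phase_ray_bound); lia).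
- rewrite Rabs_mult, <- RPow_abs, (Rabs_pos_eq (/ 6)) by lra.
  assert (Rabs (mu1 x) ^ 3 <= K ^ 3) by (apply pow_incr; split; [apply Rabs_pos | exact H1]).
  assert (0 <= Rabs (mu1 x) ^ 3) by (apply pow_le, Rabs_pos); lra.
- rewrite !Rabs_mult, (Rabs_pos_eq (/ 2)) by lra.
  assert (Rabs (mu1 x) * Rabs (mu2 x) <= K * K) by (apply Rmult_le_compat; auto using Rabs_pos).
  assert (0 <= Rabs (mu1 x) * Rabs (mu2 x)) by (apply Rmult_le_pos; apply Rabs_pos); lra.
Qed.

Lemma phase_taylor_error (x z : R) : Rabs z <= 1 ->
  Cmod (phi x (m (x + z)%R) - phase_taylor q phi X x (m (x + z)%R))%C <= 2 * Mphi * Rabs z ^ (q + 3).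
Proof.
intros Hz; replace (q + 3)%nat with (S (q + 2)) by lia.
apply (taylor_x_error _ phi Mphi Hphi Hphib); [lia | exact Hz].
Qed.

Lemma phase_convex : exists alpha0, 0 < alpha0 <= 1 /\
  forall x z, Rabs z <= alpha0 ->
    im_phi_xx phi x (m x) / 4 * z ^ 2 <= Im (phi x (m (x + z))) /\
    im_phi_xx phi x (m x) / 4 * z ^ 2 <= Im (phase_taylor q phi X x (m (x + z))).
Proof.
destruct phase_cubic as [K [HK HC]], r_tilde_3_bound as [K3 [HK3 H3]].
assert (HM := Mphi_nonneg).
(* [K], [K3] and [2 * Mphi] are the three sources of cubic error. For [Rabs z <= cI / L] they add up
   to at most [cI / 4 * z ^ 2]; the summand 1 keeps [L] positive. *)
set (L := 4 * (K + K3 + 2 * Mphi + 1)).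
exists (Rmin 1 (cI / L)).
assert (HL : 0 < L) by (unfold L; lra).
split.
{ split; [apply Rmin_glb_lt; [lra | now apply Rdiv_lt_0_compat] | apply Rmin_l]. }
intros x z Hz.
assert (Hz1 : Rabs z <= 1) by (eapply Rle_trans; [exact Hz | apply Rmin_l]).
assert (Hz2 : Rabs z <= cI / L) by (eapply Rle_trans; [exact Hz | apply Rmin_r]).
assert (P := Rabs_pos z).
assert (Hz3 : (K + K3 + 2 * Mphi) * Rabs z <= cI / 4).
{ apply Rle_trans with ((K + K3 + 2 * Mphi + 1) * (cI / L)); [nra|].
  right; unfold L; field; lra. }
destruct (im_phi_xx_bounds x) as [Hlow _].
assert (D : forall w : C, Cmod (phi x (m (x + z)%R) - w)%C <= 2 * Mphi * Rabs z ^ 3 ->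
   im_phi_xx phi x (m x) / 4 * z ^ 2 <= Im w).
{ intros w Hw.
  assert (E := HC x z Hz1); apply (Rle_trans _ _ _ (im_le_Cmod _)) in E.
  apply (Rle_trans _ _ _ (im_le_Cmod _)) in Hw.
  replace (Im (phi x (m (x + z)%R) - w)%C) with (Im (phi x (m (x + z))) - Im w) in Hw by reflexivity.
  assert (R3 := H3 x); apply (Rle_trans _ _ _ (im_le_Cmod _)) in R3.
  match type of E with Rabs ?u <= _ => replace u with (Im (phi x (m (x + z)))
     - (z ^ 2 * (im_phi_xx phi x (m x) / 2) + z ^ 3 * Im (r_tilde phi m 3 x))) in E end.
  2:{ rewrite <- Im_r_tilde_2; assert (RV := phase_ray_value_real x).
      destruct (phi x (m x)) as [a b], (r_tilde phi m 2 x) as [c d], (r_tilde phi m 3 x) as [e g],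
        (phi x (m (x + z)%R)) as [k l]; unfold Im in *; simpl in *; rewrite RV; ring. }
  assert (Z2 : Rabs z ^ 2 = z ^ 2) by apply pow2_abs.
  assert (Z3 : Rabs (z ^ 3 * Im (r_tilde phi m 3 x)) <= Rabs z ^ 3 * K3).
  { rewrite Rabs_mult, <- RPow_abs; apply Rmult_le_compat_l; [now apply pow_le | exact R3]. }
  assert (Z4 : K * Rabs z ^ 4 <= K * Rabs z ^ 3).
  { apply Rmult_le_compat_l; [exact HK|].
    replace (Rabs z ^ 4) with (Rabs z ^ 3 * Rabs z) by ring.
    assert (0 <= Rabs z ^ 3) by now apply pow_le. nra. }
  assert (Z5 : (K + K3 + 2 * Mphi) * Rabs z ^ 3 <= cI / 4 * z ^ 2).
  { rewrite <- Z2; replace ((K + K3 + 2 * Mphi) * Rabs z ^ 3)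
      with ((K + K3 + 2 * Mphi) * Rabs z * Rabs z ^ 2) by ring.
    apply Rmult_le_compat_r; [now apply pow_le | exact Hz3]. }
  assert (Z6 : cI / 4 * z ^ 2 <= im_phi_xx phi x (m x) / 4 * z ^ 2).
  { apply Rmult_le_compat_r; [rewrite <- Z2; now apply pow_le | lra]. }
  apply Rabs_le_between in E; apply Rabs_le_between in Hw; apply Rabs_le_between in Z3.
  nra. }
split; apply D.
- replace (phi x (m (x + z)%R) - phi x (m (x + z)%R))%C with (RtoC 0) by ring.
  rewrite Cmod_0; apply Rmult_le_pos; [lra | now apply pow_le].
- eapply Rle_trans; [now apply phase_taylor_error|].
  apply Rmult_le_compat_l; [lra|].
  rewrite pow_add; rewrite <- (Rmult_1_l (Rabs z ^ 3)) at 2.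
  apply Rmult_le_compat_r; [now apply pow_le|].
  rewrite <- (pow1 q); apply pow_incr; lra.
Qed.

(** * The discretization error *)

Section Discretization.

Context (A : nat -> R -> R -> C) (MA : R) (chi : R -> R) (alpha omega0 : R).
Context (HA : forall k, (k <= q / 2)%nat -> Cclass_C2d (N + q + 1 - 2 * k) (A k))
  (HAb : forall k, (k <= q / 2)%nat -> forall i j, (i + j <= N + q + 1 - 2 * k)%nat ->
     forall x s, Cmod (Cpartial i j (A k) x s) <= MA)
  (Hchi : is_cutoff alpha chi) (Halpha : 0 < alpha <= 1) (Homega0 : 0 < omega0)
  (Hconvex : forall x z, Rabs z <= alpha ->
    im_phi_xx phi x (m x) / 4 * z ^ 2 <= Im (phi x (m (x + z))) /\
    im_phi_xx phi x (m x) / 4 * z ^ 2 <= Im (phase_taylor q phi X x (m (x + z)))).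

Notation sym := (symbol X omega0 alpha).

Lemma symbol_X_derivative (n k : nat) : (1 <= k)%nat -> (k + n <= N)%nat ->
  sym 0 n 0 (fun _ _ s => RtoC (Derive_n X k s)).
Proof.
revert k; induction n as [|n IH]; intros k Hk Hn;
  (split; [apply (symbol_bound_of_bounded _ _ _ _ MX);
     intros; rewrite Cmod_R; apply HXb; lia|]); [exact I|].
exists (fun _ _ s => RtoC (Derive_n X (S k) s)); split.
- intros; apply Cder_RtoC, X_is_derive_n; lia.
- apply IH; lia.
Qed.

Lemma symbol_distance (n : nat) : (n <= N)%nat ->
  sym 0 n 0 (fun x _ s => RtoC (x - X s)).
Proof.
intros Hn; assert (B : symbol_bound X omega0 alpha 0 (fun x _ s => RtoC (x - X s))).
{ apply (symbol_bound_of_bounded _ _ _ _ alpha); intros x om s _ Hs.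
  rewrite Cmod_R, Rabs_minus_sym; exact Hs. }
destruct n as [|n]; split; try exact B; [exact I|].
exists (fun _ _ s => RtoC (-1) * RtoC (Derive_n X 1 s))%C; split.
- intros x om s _; rewrite <- RtoC_mult; apply Cder_RtoC.
  eapply is_derive_val.
  + apply (is_derive_minus (fun _ => x) X);
      [apply is_derive_Rconst | apply X_is_derive].
  + unfold minus, plus, opp, zero; simpl; change (Derive (fun x => X x) s) with (Derive X s); ring.
- apply (symbol_mult _ _ _ 0 n 0 0); [apply symbol_const | apply symbol_X_derivative; lia].
Qed.

(** Each derivative in [s] raises one of the two indices by one, which explains the budget
    [j + k + n <= n0]; the chain rule also consumes a derivative of [X]. *)
Lemma symbol_ray (n0 : nat) (f : R -> R -> C) (B : R) (n j k : nat) : Cclass_C2d n0 f ->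
  (forall j k, (j + k <= n0)%nat -> forall s, Cmod (Cpartial j k f (X s) s) <= B) ->
  (j + k + n <= n0)%nat -> (n <= N)%nat ->
  sym 0 n 0 (fun _ _ s => Cpartial j k f (X s) s).
Proof.
intros Hf HB; revert j k; induction n as [|n IH]; intros j k Hj Hn;
  (split; [apply (symbol_bound_of_bounded _ _ _ _ B); intros; apply HB; lia|]); [exact I|].
exists (fun _ _ s => RtoC (Derive_n X 1 s) * Cpartial (S j) k f (X s) s
                     + Cpartial j (S k) f (X s) s)%C; split.
- intros x om s _; eapply Cder_eq.
  + apply (Cpartial_chain n0 f j k X (fun s => s) s (Derive X s) 1 Hf); [lia | apply X_is_derive|].
    exact (is_derive_id s).
  + change (Derive_n X 1 s) with (Derive X s); ring.
- apply symbol_plus.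
  + apply (symbol_mult _ _ _ 0 n 0 0); [apply symbol_X_derivative; lia | apply IH; lia].
  + apply IH; lia.
Qed.

Lemma continuous_bounded (f : R -> R) (a b : R) : a <= b -> (forall x, continuous f x) ->
  exists K, forall x, a <= x <= b -> Rabs (f x) <= K.
Proof.
intros Hab Hf.
destruct (continuity_ab_maj (fun x => Rabs (f x)) a b Hab) as [c [Hc _]]; [|now exists (Rabs (f c))].
intros x _; apply continuity_pt_filterlim.
apply (continuous_comp f Rabs); [apply Hf | apply continuous_Rabs].
Qed.

Lemma cutoff_is_derive_n (i : nat) (y : R) : is_derive (Derive_n chi i) y (Derive_n chi (S i) y).
Proof. apply (Derive_correct (Derive_n chi i)), (cutoff_smooth _ _ Hchi (S i)). Qed.

Lemma symbol_cutoff (n i : nat) : (n <= N)%nat ->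
  sym 0 n 0 (fun x _ s => RtoC (Derive_n chi i (X s - x))).
Proof.
assert (B : forall i, symbol_bound X omega0 alpha 0 (fun x _ s => RtoC (Derive_n chi i (X s - x)))).
{ intros k; destruct (continuous_bounded (Derive_n chi k) (- alpha) alpha ltac:(lra)) as [K HK].
  - intros y; eapply is_derive_continuous,  cutoff_is_derive_n.
  - apply (symbol_bound_of_bounded _ _ _ _ K); intros x om s _ Hs.
    rewrite Cmod_R; apply HK; now apply Rabs_le_between. }
revert i; induction n as [|n IH]; intros i Hn; (split; [apply B|]); [exact I|].
exists (fun x _ s => RtoC (Derive_n X 1 s) * RtoC (Derive_n chi (S i) (X s - x)))%C; split.
- intros x om s _; rewrite <- RtoC_mult; apply Cder_RtoC.
  apply (is_derive_Rcomp (Derive_n chi i) (fun s => X s - x)); [apply cutoff_is_derive_n|].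
  eapply is_derive_val.
  + apply (is_derive_minus X (fun _ => x));
      [apply X_is_derive | apply is_derive_Rconst].
  + unfold minus, plus, opp, zero; simpl; rewrite Ropp_0, Rplus_0_r; reflexivity.
- apply (symbol_mult _ _ _ 0 n 0 0); [apply symbol_X_derivative; lia | apply IH; lia].
Qed.

Lemma symbol_taylor_weight (n j : nat) : (n <= N)%nat ->
  sym 0 n 0 (fun x _ s => taylor_weight (x - X s) j).
Proof.
intros Hn.
apply (symbol_ext _ _ _ 0 n 0 (fun x _ s => Cpow (RtoC (x - X s)) j * RtoC (/ INR (fact j)))%C).
- intros x _ s; unfold taylor_weight, Rdiv; now rewrite RtoC_mult, RtoC_pow.
- apply (symbol_mult _ _ _ 0 n 0 0); [|apply symbol_const].
  apply symbol_pow, symbol_distance, Hn.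
Qed.

Lemma symbol_taylor (n0 : nat) (f : R -> R -> C) (B : R) (n r : nat) : Cclass_C2d n0 f ->
  (forall j k, (j + k <= n0)%nat -> forall s, Cmod (Cpartial j k f (X s) s) <= B) ->
  (r + n <= n0)%nat -> (n <= N)%nat ->
  sym 0 n 0 (fun x _ s => taylor_x X r f x s).
Proof.
intros Hf HB Hr Hn.
apply (symbol_Csum _ _ _ 0 n 0 r
  (fun j x _ s => taylor_weight (x - X s) j * Cpartial j 0 f (X s) s)%C).
intros j Hj; apply (symbol_mult _ _ _ 0 n 0 0); [now apply symbol_taylor_weight|].
apply (symbol_ray n0 f B); auto; lia.
Qed.

Lemma Cmod_iomega (om : R) : omega0 < om -> Cmod (iomega om) = om.
Proof.
intros H; unfold iomega; rewrite Cmod_mult, Cmod_Ci, Cmod_R, Rabs_pos_eq; lra.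
Qed.

Lemma iomega_neq_0 (om : R) : omega0 < om -> iomega om <> 0%C.
Proof. intros H; apply Cmod_gt_0; rewrite Cmod_iomega; lra. Qed.

Lemma iomega_power_bound (om : R) (k : nat) : omega0 < om ->
  Cmod (/ Cpow (iomega om) k)%C <= / omega0 ^ k.
Proof.
intros H; rewrite Cmod_inv by now apply Cpow_nz, iomega_neq_0.
rewrite Cmod_pow, Cmod_iomega by exact H.
apply Rinv_le_contravar; [now apply pow_lt | apply pow_incr; lra].
Qed.

Lemma amplitude_ray_bound (k : nat) : (k <= q / 2)%nat -> forall i j,
  (i + j <= N + q + 1 - 2 * k)%nat -> forall s, Cmod (Cpartial i j (A k) (X s) s) <= MA.
Proof. intros Hk i j H s; now apply (HAb k). Qed.

Lemma double_half_le (k : nat) : (k <= q / 2)%nat -> (2 * k <= q)%nat.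
Proof. intros H; assert (D := Nat.Div0.mul_div_le q 2); lia. Qed.

Lemma symbol_amplitude_taylor (n : nat) : (n <= N)%nat ->
  sym 0 n 0 (fun x om s => amplitude_taylor q A X om x s).
Proof.
intros Hn.
apply (symbol_Csum _ _ _ 0 n 0 (q / 2)
  (fun k x om s => taylor_x X (q - 2 * k) (A k) x s * / Cpow (iomega om) k)%C).
intros k Hk; assert (Hk2 := double_half_le k Hk).
apply (symbol_mult _ _ _ 0 n 0 0).
- apply (symbol_taylor _ (A k) MA n _ (HA k Hk) (amplitude_ray_bound k Hk)); lia.
- apply (symbol_coefficient _ _ _ 0 n (fun om => / Cpow (iomega om) k)%C (/ omega0 ^ k)).
  intros; now apply iomega_power_bound.
Qed.

(** The motion of the base point contributes only the top-degree term, by telescoping; the sum comes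
    from the explicit dependence of the coefficients on [s]. *)
Definition phase_taylor_s (x s : R) : C :=
  (RtoC (Derive X s) * (taylor_weight (x - X s) (q + 2) * Cpartial (q + 3) 0 phi (X s) s)
   + Csum (fun j => taylor_weight (x - X s) j * Cpartial j 1 phi (X s) s) (q + 2))%C.

Lemma phase_taylor_der_s (x s : R) :
  Cder (fun s => phase_taylor q phi X x s) s (phase_taylor_s x s).
Proof.
unfold phase_taylor_s; replace (q + 3)%nat with (S (q + 2)) by lia.
apply (taylor_telescope (fun j s => Cpartial j 0 phi (X s) s) (fun j s => Cpartial j 1 phi (X s) s)
  X x s (Derive X s) (q + 2)); [apply X_is_derive|].
intros j Hj; eapply Cder_eq.
- apply (Cpartial_chain _ phi j 0 X (fun s => s) s (Derive X s) 1 Hphi); [lia | apply X_is_derive|].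
  exact (is_derive_id s).
- ring.
Qed.

Lemma symbol_phase_taylor_s (n : nat) : (S n <= N)%nat ->
  sym 0 n 0 (fun x _ s => phase_taylor_s x s).
Proof.
intros Hn; apply symbol_plus.
- apply (symbol_mult _ _ _ 0 n 0 0); [exact (symbol_X_derivative n 1 ltac:(lia) ltac:(lia))|].
  apply (symbol_mult _ _ _ 0 n 0 0); [apply symbol_taylor_weight; lia|].
  apply (symbol_ray _ phi Mphi n (q + 3) 0 Hphi phase_ray_bound); lia.
- apply (symbol_Csum _ _ _ 0 n 0 (q + 2)
    (fun j x _ s => taylor_weight (x - X s) j * Cpartial j 1 phi (X s) s)%C).
  intros j Hj; apply (symbol_mult _ _ _ 0 n 0 0); [apply symbol_taylor_weight; lia|].
  apply (symbol_ray _ phi Mphi n j 1 Hphi phase_ray_bound); lia.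
Qed.

Lemma taylor_weight_small (z : R) (j : nat) : (1 <= j)%nat -> Rabs z <= 1 ->
  Cmod (taylor_weight z j) <= Rabs z.
Proof.
intros Hj Hz; unfold taylor_weight, Rdiv; rewrite Cmod_R, Rabs_mult, <- RPow_abs.
assert (F : 1 <= INR (fact j)) by (apply (le_INR 1), lt_O_fact).
assert (P := Rabs_pos z).
assert (G : 0 < / INR (fact j) <= 1).
{ split; [apply Rinv_0_lt_compat; lra | rewrite <- Rinv_1; apply Rinv_le_contravar; lra]. }
rewrite (Rabs_pos_eq (/ _)) by lra.
destruct j as [|j]; [lia|]; rewrite <- tech_pow_Rmult.
assert (H : 0 <= Rabs z ^ j <= 1).
{ split; [now apply pow_le | rewrite <- (pow1 j); apply pow_incr; lra]. }
assert (0 <= Rabs z * Rabs z ^ j <= Rabs z) by nra; nra.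
Qed.

Lemma Cmod_Csum_le (f : nat -> C) (n : nat) (b : R) :
  (forall j, (j <= n)%nat -> Cmod (f j) <= b) -> Cmod (Csum f n) <= INR (S n) * b.
Proof.
unfold Csum; induction n as [|n IH]; intros H.
- rewrite sum_O; simpl; rewrite Rmult_1_l; now apply H.
- rewrite sum_Sn; eapply Rle_trans; [apply Cmod_triangle|].
  rewrite (S_INR (S n)), Rmult_plus_distr_r, Rmult_1_l.
  apply Rplus_le_compat; [apply IH; intros; apply H; lia | now apply H].
Qed.

(** Weights of positive degree are at most [Rabs (X s - x)] on the support of the cut-off. The only
    term of degree zero is [phi_s] on the ray, which vanishes; so the Taylorised phase keeps the
    stationarity of the exact one. *)
Lemma phase_taylor_s_small : exists K, 0 <= K /\ forall x om s, omega0 < om ->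
  Rabs (X s - x) <= alpha -> Cmod (phase_taylor_s x s) <= K * Rabs (X s - x).
Proof.
assert (HM := Mphi_nonneg).
assert (HMX : 0 <= MX).
{ eapply Rle_trans; [apply Rabs_pos | apply (HXb 1 ltac:(lia) 0)]. }
assert (HI := pos_INR (S (q + 2))).
exists (MX * Mphi + INR (S (q + 2)) * Mphi); split; [nra|].
intros x om s _ Hs; unfold phase_taylor_s.
rewrite Rabs_minus_sym in Hs |- *; assert (P := Rabs_pos (x - X s)).
eapply Rle_trans; [apply Cmod_triangle|]; rewrite Rmult_plus_distr_r.
apply Rplus_le_compat.
- rewrite !Cmod_mult, Cmod_R, (Rmult_assoc MX), (Rmult_comm Mphi).
  repeat apply Rmult_le_compat; try apply Rabs_pos; try apply Cmod_ge_0.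
  + apply Rmult_le_pos; apply Cmod_ge_0.
  + apply (HXb 1); lia.
  + apply taylor_weight_small; [lia | lra].
  + apply phase_ray_bound; lia.
- rewrite Rmult_assoc; apply Cmod_Csum_le; intros j Hj.
  destruct j as [|j].
  + rewrite phi_s_zero, Cmult_0_r, Cmod_0; nra.
  + rewrite Cmod_mult, Rmult_comm; apply Rmult_le_compat; try apply Cmod_ge_0.
    * apply phase_ray_bound; lia.
    * apply taylor_weight_small; [lia | lra].
Qed.

(** * Gaussian decay and the support of the cut-off *)

Lemma exp_le_exp (u v : R) : u <= v -> exp u <= exp v.
Proof. intros [H| ->]; [left; now apply exp_increasing | apply Rle_refl]. Qed.

Lemma exp_pow_INR (u : R) (n : nat) : exp u ^ n = exp (INR n * u).
Proof.
induction n as [|n IH]; [simpl; now rewrite Rmult_0_l, exp_0|].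
rewrite <- tech_pow_Rmult, IH, <- exp_plus, S_INR; f_equal; ring.
Qed.

(** The inequality [exp u >= (1 + u / n) ^ n] with [u = c * t ^ 2] and [n = M + 2]: two of the
    factors [1 + t] pay for [1 + t ^ 2], and [L] is chosen so that [1 + t <= L * (1 + u / n)]. *)
Lemma polynomial_gaussian (c : R) (M : nat) : 0 < c ->
  exists K, 0 <= K /\ forall t, 0 <= t -> (1 + t) ^ M * exp (- (c * t ^ 2)) <= K / (1 + t ^ 2).
Proof.
intros Hc; set (n := S (S M)).
assert (Hn : 0 < INR n) by (apply (lt_INR 0); unfold n; lia).
set (L := 2 + INR n / c).
assert (HL : 0 < INR n / c) by now apply Rdiv_lt_0_compat.
exists (L ^ n); split; [apply pow_le; unfold L; lra|].
intros t Ht.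
assert (P : 0 < 1 + t ^ 2) by nra.
apply (Rmult_le_reg_r (1 + t ^ 2)); [exact P|].
unfold Rdiv; rewrite (Rmult_assoc (L ^ n)), Rinv_l, Rmult_1_r by lra.
apply Rle_trans with ((1 + t) ^ n * exp (- (c * t ^ 2))).
- rewrite Rmult_assoc, (Rmult_comm (exp _)), <- Rmult_assoc.
  apply Rmult_le_compat_r; [left; apply exp_pos|].
  replace n with (M + 2)%nat by (unfold n; lia); rewrite pow_add.
  apply Rmult_le_compat_l; [apply pow_le; lra | nra].
- apply (Rmult_le_reg_r (exp (c * t ^ 2))); [apply exp_pos|].
  rewrite Rmult_assoc, <- exp_plus, Rplus_opp_l, exp_0, Rmult_1_r.
  replace (c * t ^ 2) with (INR n * (c * t ^ 2 / INR n)) by (field; lra).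
  rewrite <- (exp_pow_INR (c * t ^ 2 / INR n) n).
  rewrite <- Rpow_mult_distr; apply pow_incr; split; [lra|].
  assert (E := exp_ineq1_le (c * t ^ 2 / INR n)).
  assert (F : L * (c * t ^ 2 / INR n) >= t ^ 2).
  { unfold L; rewrite Rmult_plus_distr_r.
    replace (INR n / c * (c * t ^ 2 / INR n)) with (t ^ 2) by (field; lra).
    assert (0 <= c * t ^ 2 / INR n); [|lra].
    apply Rdiv_le_0_compat; [nra | lra]. }
  assert (1 + t <= 2 + t ^ 2) by nra.
  apply Rle_trans with (L * (1 + c * t ^ 2 / INR n)); [unfold L in *; lra|].
  apply Rmult_le_compat_l; [unfold L; lra | exact E].
Qed.

(** Symbol bounds say nothing off the support of the cut-off. There the derivatives vanish because
    the function vanishes on an open set. *)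
Lemma Cderiv_chain_zero (n : nat) (g gn : R -> C) (a b : R) : Cderiv_chain n g gn ->
  (forall x, x < a \/ b < x -> g x = 0%C) -> forall x, x < a \/ b < x -> gn x = 0%C.
Proof.
revert g; induction n as [|n IH]; intros g; simpl.
- intros H Hg x Hx; rewrite <- H; now apply Hg.
- intros [g' [Hg' Hch]] Hg; apply (IH g' Hch).
  assert (Z : forall x, x < a \/ b < x -> locally x (fun t => g t = 0%C)).
  { intros x [Hx|Hx].
    - apply (filter_imp (fun y => y < a)); [intros y Hy; apply Hg; now left|].
      now apply open_lt.
    - apply (filter_imp (fun y => b < y)); [intros y Hy; apply Hg; now right|].
      now apply open_gt. }
  intros x Hx; destruct (Hg' x) as [H1 H2]; specialize (Z x Hx).
  apply is_derive_unique in H1; apply is_derive_unique in H2.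
  rewrite (Derive_ext_loc _ (fun _ => 0)), Derive_const in H1
    by (revert Z; apply filter_imp; now intros t ->).
  rewrite (Derive_ext_loc _ (fun _ => 0)), Derive_const in H2
    by (revert Z; apply filter_imp; now intros t ->).
  apply injective_projections; [exact (eq_sym H1) | exact (eq_sym H2)].
Qed.

Lemma outside_cutoff (x s : R) : s < m (x - alpha) \/ m (x + alpha) < s -> alpha < Rabs (X s - x).
Proof.
assert (Hstrict : forall s t, s < t -> X s < X t).
{ intros u w Huw; assert (I := X_increment u w ltac:(lra)); nra. }
intros [H|H]; apply Hstrict in H; rewrite HXm in H.
- rewrite Rabs_left; lra.
- rewrite Rabs_pos_eq; lra.
Qed.

Lemma inside_or_outside_cutoff (x s : R) :
  Rabs (X s - x) <= alpha \/ (s < m (x - alpha) \/ m (x + alpha) < s).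
Proof.
destruct (Rlt_dec s (m (x - alpha))) as [|H1]; [now right; left|].
destruct (Rlt_dec (m (x + alpha)) s) as [|H2]; [now right; right|].
left.
assert (I1 := X_increment (m (x - alpha)) s ltac:(lra)).
assert (I2 := X_increment s (m (x + alpha)) ltac:(lra)).
rewrite HXm in I1, I2; apply Rabs_le_between; split; nra.
Qed.

Lemma phase_taylor_convex_s (x s : R) : Rabs (X s - x) <= alpha ->
  cI / 4 * (X s - x) ^ 2 <= Im (phase_taylor q phi X x s).
Proof.
intros H; destruct (Hconvex x (X s - x) H) as [_ C].
replace (x + (X s - x)) with (X s) in C by ring; rewrite HmX in C.
eapply Rle_trans; [|exact C].
apply Rmult_le_compat_r; [apply pow2_ge_0|].
destruct (im_phi_xx_bounds x); lra.
Qed.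

Lemma Re_iomega_mult (om : R) (w : C) : Re (iomega om * w)%C = - (om * Im w).
Proof. unfold iomega, Re, Im; simpl; ring. Qed.

Lemma beam_width_inv (om x : R) : omega0 < om ->
  / beam_width phi m om x = sqrt om * sqrt (im_phi_xx phi x (m x)).
Proof.
intros H; unfold beam_width; rewrite Rinv_inv.
destruct (im_phi_xx_bounds x); apply sqrt_mult; lra.
Qed.

Lemma discretization_bound : exists K, 0 <= K /\ forall x om h, omega0 < om -> 0 < h ->
  Cmod (discretization_error q phi A X chi om h x)
  <= K * (h / beam_width phi m om x) ^ (N - 1).
Proof.
set (p := (N - 1)%nat).
destruct phase_taylor_s_small as [K1 [HK1 HV]].
assert (HW' : sym 1 p 1 (fun x om s => Ci * (RtoC om * phase_taylor_s x s))%C).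
{ apply (symbol_mult _ _ _ 1 p 0 1); [apply symbol_const|].
  apply (symbol_omega_mult_vanishing _ _ _ Homega0 p (fun x _ s => phase_taylor_s x s) K1 HK1);
    [|exact HV].
  apply symbol_phase_taylor_s; unfold p; lia. }
assert (HF : sym 1 p 0 (fun x om s => RtoC (chi (X s - x)) * amplitude_taylor q A X om x s)%C).
{ apply symbol_cost_one; [exact Homega0|].
  apply (symbol_mult _ _ _ 0 p 0 0).
  - apply (symbol_cutoff p 0); unfold p; lia.
  - apply symbol_amplitude_taylor; unfold p; lia. }
destruct (symbol_Cexp_chain X omega0 alpha p 0 _
  (fun x om s => iomega om * phase_taylor q phi X x s)%C _
  (fun x om s _ => Cder_eq _ _ _ _
     (Cder_scal (iomega om) _ _ _ (phase_taylor_der_s x s))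
     (eq_sym (Cmult_assoc Ci (RtoC om) (phase_taylor_s x s)))) HW' HF) as [gn [Hgn Hch]].
destruct Hgn as [K2 [M [HK2 Hgn]]]; simpl in Hgn.
destruct (polynomial_gaussian (cI / 4) M ltac:(lra)) as [K3 [HK3 HG]].
set (K := K2 * K3).
assert (HK : 0 <= K) by (unfold K; nra).
assert (HsI : 0 < sqrt cI) by now apply sqrt_lt_R0.
(* The factor [Derive X s / cX >= 1] is inserted so that the majorant becomes an exact derivative,
   that of an arctangent in [sqrt om * (X s - x)]. Its total increase is at most a multiple of
   [PI / sqrt om], and this gain cancels the prefactor of the superposition. *)
assert (Bnd : forall x om s, omega0 < om ->
  Cmod (gn x om s * Cexp (iomega om * phase_taylor q phi X x s))%C
  <= K * sqrt om ^ p / cX * (Derive X s / (1 + (sqrt om * (X s - x)) ^ 2))).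
{ intros x om s Ho.
  assert (Hs := sqrt_omega_pos omega0 Homega0 om Ho).
  assert (Hpw : 0 <= sqrt om ^ p) by (apply pow_le; lra).
  assert (D : 0 < 1 + (sqrt om * (X s - x)) ^ 2).
  { assert (Q := pow2_ge_0 (sqrt om * (X s - x))); lra. }
  assert (HX' := HXlow s).
  destruct (inside_or_outside_cutoff x s) as [Hin|Hout].
  - rewrite Cmod_mult, Cmod_Cexp, Re_iomega_mult.
    assert (G := HG (sqrt om * Rabs (X s - x)) (scaled_distance_nonneg om (X s - x))).
    assert (Q : (sqrt om * Rabs (X s - x)) ^ 2 = (sqrt om * (X s - x)) ^ 2)
      by now rewrite !Rpow_mult_distr, pow2_abs.
    rewrite Q in G.
    assert (E : exp (- (om * Im (phase_taylor q phi X x s)))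
      <= exp (- (cI / 4 * (sqrt om * (X s - x)) ^ 2))).
    { apply exp_le_exp, Ropp_le_contravar.
      rewrite Rpow_mult_distr, pow2_sqrt by lra.
      assert (F := phase_taylor_convex_s x s Hin).
      replace (cI / 4 * (om * (X s - x) ^ 2)) with (om * (cI / 4 * (X s - x) ^ 2)) by ring.
      apply Rmult_le_compat_l; lra. }
    apply Rle_trans with (K2 * sqrt om ^ p * (1 + sqrt om * Rabs (X s - x)) ^ M
       * exp (- (cI / 4 * (sqrt om * (X s - x)) ^ 2))).
    { apply Rmult_le_compat; [apply Cmod_ge_0 | left; apply exp_pos | now apply Hgn | exact E]. }
    apply Rle_trans with (K2 * sqrt om ^ p * (K3 / (1 + (sqrt om * (X s - x)) ^ 2))).
    { rewrite Rmult_assoc; apply Rmult_le_compat_l; [now apply Rmult_le_pos | exact G]. }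
    replace (K2 * sqrt om ^ p * (K3 / (1 + (sqrt om * (X s - x)) ^ 2)))
      with (K * sqrt om ^ p / cX * (cX / (1 + (sqrt om * (X s - x)) ^ 2)))
      by (unfold K; field; lra).
    apply Rmult_le_compat_l; [apply Rdiv_le_0_compat; [now apply Rmult_le_pos | lra]|].
    apply Rmult_le_compat_r; [left; now apply Rinv_0_lt_compat | exact HX'].
  - rewrite (Cderiv_chain_zero p _ _ _ _ (Hch x om Ho)) with (2 := Hout).
    + rewrite Cmod_0; apply Rmult_le_pos; apply Rdiv_le_0_compat; try lra.
      now apply Rmult_le_pos.
    + intros t Ht; rewrite (cutoff_zero _ _ Hchi) by now apply outside_cutoff.
      ring. }
(* The 2 comes from the real and imaginary parts, [PI] from the arctangent, and [sqrt cI ^ p] from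
   replacing [sqrt om] by the inverse beam width, which is at least [sqrt om * sqrt cI]. *)
exists (2 * (K / cX * PI) / sqrt cI ^ p).
assert (HPI := PI_RGT_0).
assert (HKc : 0 <= K / cX * PI).
{ apply Rmult_le_pos; [apply Rdiv_le_0_compat|]; lra. }
split; [apply Rdiv_le_0_compat; [lra | now apply pow_lt]|].
intros x om h Ho Hh.
assert (Hs := sqrt_omega_pos omega0 Homega0 om Ho).
set (g := beam_taylor q phi A X chi om x).
change (discretization_error q phi A X chi om h x)
  with (RtoC (sqrt om) * CRInt_line g
        - RtoC (sqrt om * h) * CZsum (fun j => g (IZR j * h)%R))%C.
replace (RtoC (sqrt om) * CRInt_line g - _)%C
  with (RtoC (sqrt om) * (CRInt_line g - RtoC h * CZsum (fun j => g (IZR j * h)%R)))%C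
  by (rewrite RtoC_mult; ring).
destruct (Cderiv_chain_components p _ _ (Hch x om Ho)) as [Cre Cim].
assert (Hp : p = S (p - 1)) by (unfold p; lia).
rewrite Hp in Cre, Cim.
assert (T := Ctrapezoid_line g
  (fun s => Re (gn x om s * Cexp (iomega om * phase_taylor q phi X x s))%C)
  (fun s => Im (gn x om s * Cexp (iomega om * phase_taylor q phi X x s))%C)
  (fun s => K * sqrt om ^ p / cX / sqrt om * atan (sqrt om * (X s - x)))
  (fun s => K * sqrt om ^ p / cX * (Derive X s / (1 + (sqrt om * (X s - x)) ^ 2)))
  (m (x - alpha)) (m (x + alpha)) h (K * sqrt om ^ p / cX / sqrt om * PI) (p - 1)
  Hh ltac:(apply inverse_increasing; lra)).
rewrite Cmod_mult, Cmod_R, Rabs_pos_eq by lra.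
eapply Rle_trans; [apply Rmult_le_compat_l; [lra|]; apply T|].
- intros s Hsx; unfold g, beam_taylor; rewrite (cutoff_zero _ _ Hchi) by now apply outside_cutoff.
  ring.
- exact Cre.
- exact Cim.
- intros s; eapply is_derive_val.
  + apply is_derive_Rmult; [apply is_derive_Rconst|].
    apply (is_derive_Rcomp atan (fun s => sqrt om * (X s - x))); [apply is_derive_atan_pow|].
    apply is_derive_Rmult; [apply is_derive_Rconst|].
    apply (is_derive_minus X (fun _ => x));
      [apply X_is_derive | apply is_derive_Rconst].
  + assert (D : 1 + (sqrt om * (X s - x)) ^ 2 <> 0).
    { assert (Q := pow2_ge_0 (sqrt om * (X s - x))); lra. }
    unfold minus, plus, opp, zero; simpl opp; cbn -[pow sqrt Derive].
    field; repeat split; lra.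
- intros s; eapply Rle_trans; [apply re_le_Cmod | now apply Bnd].
- intros s; eapply Rle_trans; [apply im_le_Cmod | now apply Bnd].
- intros s t; rewrite <- Rmult_minus_distr_l; apply Rmult_le_compat_l.
  + repeat apply Rdiv_le_0_compat; try lra; apply Rmult_le_pos; [lra | apply pow_le; lra].
  + assert (B1 := atan_bound (sqrt om * (X s - x))).
    assert (B2 := atan_bound (sqrt om * (X t - x))); lra.
- rewrite <- Hp; unfold Rdiv at 5; rewrite beam_width_inv by exact Ho.
  destruct (im_phi_xx_bounds x) as [Hlow _].
  assert (Hsq : sqrt cI <= sqrt (im_phi_xx phi x (m x))) by (apply sqrt_le_1; lra).
  apply Rle_trans with (2 * (K / cX * PI) / sqrt cI ^ p * (h * (sqrt om * sqrt cI)) ^ p).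
  + right; rewrite !Rpow_mult_distr; field.
    repeat split; try lra; apply pow_nonzero; lra.
  + apply Rmult_le_compat_l; [apply Rdiv_le_0_compat; [lra | now apply pow_lt]|].
    apply pow_incr; split.
    * apply Rmult_le_pos; [lra|]; apply Rmult_le_pos; lra.
    * apply Rmult_le_compat_l; [lra|]; apply Rmult_le_compat_l; lra.
Qed.

(** * Expansions in powers of the beam width *)

Notation eta := (beam_width phi m).

Lemma eta_pos (x om : R) : omega0 < om -> 0 < eta om x.
Proof.
intros H; unfold beam_width; apply Rinv_0_lt_compat, sqrt_lt_R0.
destruct (im_phi_xx_bounds x); apply Rmult_lt_0_compat; lra.
Qed.

Lemma omega_eta2 (x om : R) : omega0 < om ->
  om * eta om x ^ 2 = / im_phi_xx phi x (m x).
Proof.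
intros H; destruct (im_phi_xx_bounds x) as [H1 _].
unfold beam_width; rewrite pow_inv, pow2_sqrt by (apply Rmult_le_pos; lra).
field; lra.
Qed.

Lemma omega_eta2_bounds (x om : R) : omega0 < om ->
  / CI <= om * eta om x ^ 2 <= / cI.
Proof.
intros H; rewrite omega_eta2 by exact H; destruct (im_phi_xx_bounds x) as [H1 H2].
split; apply Rinv_le_contravar; lra.
Qed.

(** Upper bound of all beam widths for [om > omega0]; it allows a higher power of the width to be
    traded for a lower one. *)
Definition eta_max : R := / sqrt (omega0 * cI).

Lemma eta_max_pos : 0 < eta_max.
Proof. apply Rinv_0_lt_compat, sqrt_lt_R0, Rmult_lt_0_compat; lra. Qed.

Lemma eta_le_max (x om : R) : omega0 < om -> eta om x <= eta_max.
Proof.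
intros H; destruct (im_phi_xx_bounds x) as [H1 _]; unfold beam_width, eta_max.
apply Rinv_le_contravar.
- apply sqrt_lt_R0, Rmult_lt_0_compat; lra.
- apply sqrt_le_1_alt, Rmult_le_compat; lra.
Qed.

(* [y] is the offset from the central ray measured in beam widths; [near] restricts the
   bound to the support of the cut-off. *)
Definition order (near : Prop) (g : R) (n : nat) (f : R -> R -> R -> C) : Prop :=
  exists (K : R) (M : nat), 0 <= K /\ forall x om y, omega0 < om ->
    (near -> Rabs (eta om x * y) <= alpha) ->
    Cmod (f x om y) <= K * eta om x ^ n * (1 + Rabs y) ^ M * exp (- (g * y ^ 2)).

Lemma order_ext (near : Prop) (g : R) (n : nat) (f f' : R -> R -> R -> C) :
  (forall x om y, omega0 < om -> (near -> Rabs (eta om x * y) <= alpha) ->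
     f x om y = f' x om y) -> order near g n f -> order near g n f'.
Proof.
intros E [K [M [HK H]]]; exists K, M; split; [exact HK|].
intros x om y Ho Hn; rewrite <- E by assumption; now apply H.
Qed.

Lemma order_local (near : Prop) (g : R) (n : nat) (f : R -> R -> R -> C) :
  order False g n f -> order near g n f.
Proof.
intros [K [M [HK H]]]; exists K, M; split; [exact HK|].
intros x om y Ho _; now apply H.
Qed.

Lemma order_plus (near : Prop) (g : R) (n : nat) (f f' : R -> R -> R -> C) :
  order near g n f -> order near g n f' ->
  order near g n (fun x om y => f x om y + f' x om y)%C.
Proof.
intros [K1 [M1 [HK1 H1]]] [K2 [M2 [HK2 H2]]].
exists (K1 + K2), (M1 + M2)%nat; split; [lra|].
intros x om y Ho Hn.
assert (E1 := H1 x om y Ho Hn); assert (E2 := H2 x om y Ho Hn).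
assert (P := Rabs_pos y); assert (G := exp_pos (- (g * y ^ 2))).
assert (N0 : 0 <= eta om x ^ n) by (apply pow_le; left; now apply eta_pos).
assert (A1 : (1 + Rabs y) ^ M1 <= (1 + Rabs y) ^ (M1 + M2)) by (apply Rle_pow; [lra | lia]).
assert (A2 : (1 + Rabs y) ^ M2 <= (1 + Rabs y) ^ (M1 + M2)) by (apply Rle_pow; [lra | lia]).
eapply Rle_trans; [apply Cmod_triangle|].
rewrite !Rmult_plus_distr_r; apply Rplus_le_compat.
- eapply Rle_trans; [exact E1|].
  apply Rmult_le_compat_r; [lra|]; apply Rmult_le_compat_l; [now apply Rmult_le_pos | exact A1].
- eapply Rle_trans; [exact E2|].
  apply Rmult_le_compat_r; [lra|]; apply Rmult_le_compat_l; [now apply Rmult_le_pos | exact A2].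
Qed.

Lemma order_mult (near : Prop) (g : R) (n n' : nat) (f f' : R -> R -> R -> C) :
  order near g n f -> order near 0 n' f' ->
  order near g (n + n') (fun x om y => f x om y * f' x om y)%C.
Proof.
intros [K1 [M1 [HK1 H1]]] [K2 [M2 [HK2 H2]]].
exists (K1 * K2), (M1 + M2)%nat; split; [now apply Rmult_le_pos|].
intros x om y Ho Hn.
assert (E1 := H1 x om y Ho Hn); assert (E2 := H2 x om y Ho Hn).
rewrite Rmult_0_l, Ropp_0, exp_0, Rmult_1_r in E2.
rewrite Cmod_mult, !pow_add.
replace (K1 * K2 * (eta om x ^ n * eta om x ^ n') * ((1 + Rabs y) ^ M1 * (1 + Rabs y) ^ M2)
    * exp (- (g * y ^ 2)))
  with (K1 * eta om x ^ n * (1 + Rabs y) ^ M1 * exp (- (g * y ^ 2))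
     * (K2 * eta om x ^ n' * (1 + Rabs y) ^ M2)) by ring.
apply Rmult_le_compat; auto using Cmod_ge_0.
Qed.

Lemma order_lower (near : Prop) (g : R) (n n' : nat) (f : R -> R -> R -> C) :
  (n' <= n)%nat -> order near g n f -> order near g n' f.
Proof.
intros Hn [K [M [HK H]]]; exists (K * eta_max ^ (n - n')), M; split.
{ apply Rmult_le_pos; [exact HK | apply pow_le; left; apply eta_max_pos]. }
intros x om y Ho Hy; eapply Rle_trans; [now apply H|].
assert (He := eta_pos x om Ho).
apply Rmult_le_compat_r; [left; apply exp_pos|].
apply Rmult_le_compat_r; [apply pow_le; assert (P := Rabs_pos y); lra|].
rewrite Rmult_assoc; apply Rmult_le_compat_l; [exact HK|].
replace n with ((n - n') + n')%nat at 1 by lia; rewrite pow_add.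
apply Rmult_le_compat_r; [apply pow_le; lra|].
apply pow_incr; split; [lra | now apply eta_le_max].
Qed.

Lemma order_bounded (near : Prop) (n : nat) (f : R -> R -> R -> C) (K : R) (M : nat) :
  0 <= K ->
  (forall x om y, omega0 < om -> (near -> Rabs (eta om x * y) <= alpha) ->
     Cmod (f x om y) <= K * eta om x ^ n * Rabs y ^ M) -> order near 0 n f.
Proof.
intros HK H; exists K, M; split; [exact HK|].
intros x om y Ho Hn; eapply Rle_trans; [now apply H|].
rewrite Rmult_0_l, Ropp_0, exp_0, Rmult_1_r.
assert (P := Rabs_pos y).
apply Rmult_le_compat_l.
- apply Rmult_le_pos; [exact HK | apply pow_le; left; now apply eta_pos].
- apply pow_incr; lra.
Qed.

Lemma order_coefficient (near : Prop) (c : R -> R -> C) (K : R) :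
  (forall x om, omega0 < om -> Cmod (c x om) <= K) ->
  order near 0 0 (fun x om _ => c x om).
Proof.
intros H; assert (HK : 0 <= K).
{ eapply Rle_trans; [apply Cmod_ge_0 | apply (H 0 (omega0 + 1)); lra]. }
apply (order_bounded _ _ _ K 0 HK); intros x om y Ho _; simpl; rewrite !Rmult_1_r.
now apply H.
Qed.

Lemma order_monomial (near : Prop) (n j : nat) :
  order near 0 n (fun x om y => RtoC (eta om x ^ n * y ^ j)).
Proof.
apply (order_bounded _ _ _ 1 j); [lra|]; intros x om y Ho _.
rewrite Cmod_R, Rabs_mult, <- !RPow_abs, (Rabs_pos_eq (eta _ _))
  by (left; now apply eta_pos).
right; ring.
Qed.

Lemma order_term (near : Prop) (c : R -> R -> C) (K : R) (n j : nat) :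
  (forall x om, omega0 < om -> Cmod (c x om) <= K) ->
  order near 0 n (fun x om y => c x om * RtoC (eta om x ^ n * y ^ j))%C.
Proof.
intros H; apply (order_mult near 0 0 n); [now apply (order_coefficient near c K) | apply order_monomial].
Qed.

Lemma order_offset (n : nat) (f : R -> R -> R -> C) (K : R) : 0 <= K ->
  (forall x z om, omega0 < om -> Rabs z <= alpha ->
     Cmod (f x om (z / eta om x)) <= K * Rabs z ^ n) ->
  order True 0 n f.
Proof.
intros HK H; apply (order_bounded _ _ _ K n HK); intros x om y Ho Hy.
assert (He := eta_pos x om Ho).
assert (E := H x (eta om x * y) om Ho (Hy I)).
replace (eta om x * y / eta om x) with y in E by (field; lra).
eapply Rle_trans; [exact E|].
rewrite Rabs_mult, Rpow_mult_distr, (Rabs_pos_eq (eta _ _)) by lra; right; ring.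
Qed.

(** The two leading terms must be controlled on the whole line, because they are integrated there
    into moments; the remainder is only controlled on the support of the cut-off, where the Taylor
    expansions are valid. The rate [g] is 0 for algebraic factors and positive once an exponential
    is present. *)
Definition expansion (g : R) (n : nat) (f f0 f1 : R -> R -> R -> C) : Prop :=
  order False g n f0 /\ order False g (S n) f1 /\
  order True g (S (S n)) (fun x om y => f x om y - (f0 x om y + f1 x om y))%C.

Lemma expansion_ext (g : R) (n : nat) (f f0 f1 h h0 h1 : R -> R -> R -> C) :
  (forall x om y, omega0 < om -> Rabs (eta om x * y) <= alpha ->
    f x om y = h x om y) ->
  (forall x om y, omega0 < om -> f0 x om y = h0 x om y) ->
  (forall x om y, omega0 < om -> f1 x om y = h1 x om y) ->
  expansion g n f f0 f1 -> expansion g n h h0 h1.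
Proof.
intros E E0 E1 [H0 [H1 H2]]; split; [|split].
- revert H0; apply order_ext; auto.
- revert H1; apply order_ext; auto.
- revert H2; apply order_ext; intros x om y Ho Hy; rewrite E, E0, E1; auto.
Qed.

Lemma expansion_plus (g : R) (n : nat) (f f0 f1 h h0 h1 : R -> R -> R -> C) :
  expansion g n f f0 f1 -> expansion g n h h0 h1 ->
  expansion g n (fun x om y => f x om y + h x om y)%C
    (fun x om y => f0 x om y + h0 x om y)%C
    (fun x om y => f1 x om y + h1 x om y)%C.
Proof.
intros [F0 [F1 F2]] [H0 [H1 H2]]; split; [|split]; try now apply order_plus.
eapply order_ext; [|exact (order_plus _ _ _ _ _ F2 H2)]; intros; cbv beta; ring.
Qed.

Lemma expansion_order (g : R) (n : nat) (f f0 f1 : R -> R -> R -> C) :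
  expansion g n f f0 f1 -> order True g n f.
Proof.
intros [F0 [F1 F2]].
apply (order_local True) in F0; apply (order_local True) in F1.
apply (order_lower _ _ _ n) in F1; [|lia]; apply (order_lower _ _ _ n) in F2; [|lia].
eapply order_ext; [|exact (order_plus _ _ _ _ _ F2 (order_plus _ _ _ _ _ F0 F1))]; intros; cbv beta; ring.
Qed.

(** The Gaussian is carried by the left factor alone, so later products always start with the
    exponential. The four products collected at the end are all at least two orders beyond the
    leading one. *)
Lemma expansion_mult (g : R) (n n' : nat) (f f0 f1 h h0 h1 : R -> R -> R -> C) :
  expansion g n f f0 f1 -> expansion 0 n' h h0 h1 ->
  expansion g (n + n') (fun x om y => f x om y * h x om y)%C
    (fun x om y => f0 x om y * h0 x om y)%C
    (fun x om y => f0 x om y * h1 x om y + f1 x om y * h0 x om y)%C.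
Proof.
intros F H; assert (Hh := expansion_order _ _ _ _ _ H).
destruct F as [F0 [F1 F2]], H as [H0 [H1 H2]].
split; [now apply order_mult|split].
- apply order_plus.
  + rewrite <- Nat.add_succ_r; now apply order_mult.
  + exact (order_mult _ _ _ _ _ _ F1 H0).
- assert (F0' := order_local True _ _ _ F0); assert (F1' := order_local True _ _ _ F1).
  assert (H1' := order_local True _ _ _ H1).
  assert (P1 := order_mult _ _ _ _ _ _ F2 Hh).
  assert (P2 := order_mult _ _ _ _ _ _ F0' H2).
  assert (P3 := order_mult _ _ _ _ _ _ F1' H2).
  assert (P4 := order_mult _ _ _ _ _ _ F1' H1').
  apply (order_lower _ _ _ (S (S (n + n')))) in P1; [|lia].
  apply (order_lower _ _ _ (S (S (n + n')))) in P2; [|lia].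
  apply (order_lower _ _ _ (S (S (n + n')))) in P3; [|lia].
  apply (order_lower _ _ _ (S (S (n + n')))) in P4; [|lia].
  eapply order_ext; [|exact (order_plus _ _ _ _ _ (order_plus _ _ _ _ _ P1 P2) (order_plus _ _ _ _ _ P3 P4))]; intros; cbv beta; ring.
Qed.

Lemma expansion_remainder (g : R) (n : nat) (f f0 f1 h : R -> R -> R -> C) :
  expansion g n f f0 f1 ->
  order True g (S (S n)) (fun x om y => h x om y - f x om y)%C ->
  expansion g n h f0 f1.
Proof.
intros [F0 [F1 F2]] H; split; [exact F0|split; [exact F1|]].
eapply order_ext; [|exact (order_plus _ _ _ _ _ F2 H)]; intros; cbv beta; ring.
Qed.

Lemma expansion_Csum (g : R) (n r : nat) (f f0 f1 : nat -> R -> R -> R -> C) :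
  (forall k, (k <= r)%nat -> expansion g n (f k) (f0 k) (f1 k)) ->
  expansion g n (fun x om y => Csum (fun k => f k x om y) r)
    (fun x om y => Csum (fun k => f0 k x om y) r)
    (fun x om y => Csum (fun k => f1 k x om y) r).
Proof.
induction r as [|r IH]; intros H.
- apply (expansion_ext g n (f 0%nat) (f0 0%nat) (f1 0%nat)); try (now apply H);
    intros; unfold Csum; now rewrite sum_O.
- generalize (expansion_plus _ _ _ _ _ _ _ _ (IH ltac:(intros; apply H; lia)) (H (S r) ltac:(lia))).
  apply expansion_ext; intros; unfold Csum; now rewrite !sum_Sn.
Qed.

(** Taylor's formula for [t => Cexp (t * w)] on the unit interval, where the modulus
    [exp (t * Re w)] is largest at an endpoint. Keeping the maximum, rather than a bound in terms of
    [Cmod w], is what makes the next lemma possible. *)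
Lemma Cexp_taylor_bound (w : C) (r : nat) :
  Cmod (Cexp w - Csum (fun j => taylor_weight 1 j * Cpow w j) r)%C
  <= 2 * (Cmod w ^ S r * Rmax 1 (exp (Re w))).
Proof.
assert (T := taylor_bound (fun j t => Cpow w j * Cexp (RtoC t * w))%C 0 1
  (Cmod w ^ S r * Rmax 1 (exp (Re w))) r).
cbv beta in T; rewrite Rminus_0_r, Rabs_R1, pow1, Rmult_1_r in T.
replace (Cpow w 0 * Cexp (RtoC 1 * w))%C with (Cexp w) in T
  by (simpl; rewrite !Cmult_1_l; reflexivity).
replace (Csum (fun j => taylor_weight 1 j * Cpow w j)%C r)
  with (Csum (fun j => taylor_weight 1 j * (Cpow w j * Cexp (RtoC 0 * w)))%C r).
- apply T.
  + intros j t _ _; eapply Cder_eq.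
    * apply Cder_scal, Cder_Cexp.
      apply (Cder_mult (fun t => RtoC t) (fun _ => w)); [|apply Cder_const].
      apply Cder_RtoC; exact (is_derive_id t).
    * simpl; unfold one; simpl; ring.
  + intros t; rewrite Rmin_left, Rmax_right by lra; intros Ht.
    rewrite Cmod_mult, Cmod_pow, Cmod_Cexp.
    apply Rmult_le_compat_l; [apply pow_le, Cmod_ge_0|].
    replace (Re (RtoC t * w)%C) with (t * Re w) by (unfold Re; simpl; ring).
    destruct (Rle_dec 0 (Re w)) as [H|H].
    * eapply Rle_trans; [|apply Rmax_r]; apply exp_le_exp; nra.
    * eapply Rle_trans; [|apply Rmax_l]; rewrite <- exp_0; apply exp_le_exp; nra.
- unfold Csum; apply sum_n_ext; intros j.
  now rewrite Cmult_0_l, Cexp_0, Cmult_1_r.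
Qed.

(** The perturbation [h] can be large when [y] is, so [Cexp h] has no useful bound of its own. The
    maximum of 1 and its modulus, multiplied by [e], is either [e] or the perturbed exponential, and
    both are assumed Gaussian. *)
Lemma order_exp_remainder (g : R) (n r : nat) (e h : R -> R -> R -> C) :
  order True 0 n h ->
  (forall x om y, omega0 < om -> Rabs (eta om x * y) <= alpha ->
     Cmod (e x om y) <= exp (- (g * y ^ 2)) /\
     Cmod (e x om y * Cexp (h x om y))%C <= exp (- (g * y ^ 2))) ->
  order True g (n * S r) (fun x om y => e x om y * (Cexp (h x om y)
     - Csum (fun j => taylor_weight 1 j * Cpow (h x om y) j) r))%C.
Proof.
intros [K [M [HK H]]] He; exists (2 * K ^ S r), (M * S r)%nat; split.
{ apply Rmult_le_pos; [lra | now apply pow_le]. }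
intros x om y Ho Hy; assert (Hn := Hy I).
destruct (He x om y Ho Hn) as [E1 E2]; rewrite Cmod_mult in E2.
assert (B := H x om y Ho Hy); rewrite Rmult_0_l, Ropp_0, exp_0, Rmult_1_r in B.
rewrite Cmod_mult; rewrite Cmod_Cexp in E2.
assert (T := Cexp_taylor_bound (h x om y) r).
assert (P := Cmod_ge_0 (e x om y)).
assert (Hm : Cmod (e x om y) * Rmax 1 (exp (Re (h x om y))) <= exp (- (g * y ^ 2))).
{ unfold Rmax; destruct (Rle_dec 1 (exp (Re (h x om y)))); lra. }
apply Rle_trans with (Cmod (e x om y)
   * (2 * (Cmod (h x om y) ^ S r * Rmax 1 (exp (Re (h x om y)))))).
{ now apply Rmult_le_compat_l. }
replace (Cmod (e x om y) * (2 * (Cmod (h x om y) ^ S r * Rmax 1 (exp (Re (h x om y))))))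
  with (2 * Cmod (h x om y) ^ S r * (Cmod (e x om y) * Rmax 1 (exp (Re (h x om y))))) by ring.
apply Rmult_le_compat.
- apply Rmult_le_pos; [lra | apply pow_le, Cmod_ge_0].
- apply Rmult_le_pos; [exact P | eapply Rle_trans; [|apply Rmax_l]; lra].
- rewrite !pow_mult, (Rmult_assoc 2), (Rmult_assoc 2), <- !Rpow_mult_distr.
  apply Rmult_le_compat_l; [lra|]; apply pow_incr; split; [apply Cmod_ge_0 | exact B].
- exact Hm.
Qed.

Lemma expansion_terms (n j0 j1 : nat) (c0 c1 : R -> R -> C) (K0 K1 : R)
    (f : R -> R -> R -> C) :
  (forall x om, omega0 < om -> Cmod (c0 x om) <= K0) ->
  (forall x om, omega0 < om -> Cmod (c1 x om) <= K1) ->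
  order True 0 (S (S n)) (fun x om y => f x om y
    - (c0 x om * RtoC (eta om x ^ n * y ^ j0)
       + c1 x om * RtoC (eta om x ^ S n * y ^ j1)))%C ->
  expansion 0 n f (fun x om y => c0 x om * RtoC (eta om x ^ n * y ^ j0))%C
    (fun x om y => c1 x om * RtoC (eta om x ^ S n * y ^ j1))%C.
Proof.
intros H0 H1 H; split; [now apply (order_term _ _ K0)|split; [now apply (order_term _ _ K1)|exact H]].
Qed.

(** The cut-off is 1 on a neighbourhood of the ray, so its difference from 1 is bounded and
    supported where [Rabs z > alpha / 2]; any power of [2 * Rabs z / alpha] majorises it there, and
    the square suffices. *)
Lemma expansion_cutoff : expansion 0 0 (fun x om y => RtoC (chi (eta om x * y)))
  (fun x om y => 1 * RtoC (eta om x ^ 0 * y ^ 0))%C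
  (fun x om y => 0 * RtoC (eta om x ^ 1 * y ^ 0))%C.
Proof.
apply (expansion_terms 0 0 0 (fun _ _ => 1%C) (fun _ _ => 0%C) 1 0).
- intros; rewrite Cmod_1; lra.
- intros; rewrite Cmod_0; lra.
- destruct (continuous_bounded chi (- alpha) alpha ltac:(lra)) as [K HK].
  { intros y; apply (ex_derive_continuous (V := R_NormedModule)); eexists.
    apply (cutoff_is_derive_n 0). }
  assert (HK0 : 0 <= K) by (eapply Rle_trans; [apply Rabs_pos | apply (HK 0); lra]).
  assert (Ha : 0 < (alpha / 2) ^ 2) by (apply pow_lt; lra).
  apply (order_offset 2 _ ((K + 1) / (alpha / 2) ^ 2)); [apply Rdiv_le_0_compat; lra|].
  intros x z om Ho Hz; assert (He := eta_pos x om Ho).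
  replace (eta om x * (z / eta om x)) with z by (field; lra).
  replace (RtoC (chi z) - _)%C with (RtoC (chi z - 1))
    by (rewrite RtoC_minus; simpl; rewrite Rmult_1_r; ring).
  rewrite Cmod_R.
  destruct (Rle_dec (Rabs z) (alpha / 2)) as [Hs|Hs].
  + rewrite (cutoff_one _ _ Hchi) by exact Hs; rewrite Rminus_diag, Rabs_R0.
    apply Rmult_le_pos; [apply Rdiv_le_0_compat; lra | apply pow_le, Rabs_pos].
  + apply Rle_trans with (K + 1).
    * unfold Rminus; eapply Rle_trans; [apply Rabs_triang|].
      rewrite Rabs_Ropp, Rabs_R1; apply Rplus_le_compat_r, HK; now apply Rabs_le_between.
    * replace (K + 1) with ((K + 1) / (alpha / 2) ^ 2 * (alpha / 2) ^ 2) at 1 by (field; lra).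
      apply Rmult_le_compat_l; [apply Rdiv_le_0_compat; lra|].
      apply pow_incr; lra.
Qed.

Lemma expansion_mu1 : expansion 0 0 (fun x om y => RtoC (mu1 (x + eta om x * y)))
  (fun x om y => RtoC (mu1 x) * RtoC (eta om x ^ 0 * y ^ 0))%C
  (fun x om y => RtoC (mu2 x) * RtoC (eta om x ^ 1 * y ^ 1))%C.
Proof.
destruct inverse_derivatives_bounded as [K [HK Hmu]].
apply (expansion_terms 0 0 1 (fun x _ => RtoC (mu1 x)) (fun x _ => RtoC (mu2 x)) K K).
- intros; rewrite Cmod_R; apply Hmu.
- intros; rewrite Cmod_R; apply Hmu.
- apply (order_offset 2 _ (2 * K)); [lra|].
  intros x z om Ho Hz; assert (He := eta_pos x om Ho).
  replace (eta om x * (z / eta om x)) with z by (field; lra).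
  assert (E := expansion2 (fun t => RtoC (mu1 t)) (fun t => RtoC (mu2 t)) (fun t => RtoC (mu3 t))
    K x z (fun t => Cder_RtoC _ _ _ (mu1_is_derive t)) (fun t => Cder_RtoC _ _ _ (mu2_is_derive t))).
  cbv beta in E.
  replace (eta om x ^ 1 * (z / eta om x) ^ 1) with z by (simpl; field; lra).
  match goal with |- Cmod ?u <= _ =>
    replace u with (RtoC (mu1 (x + z)) - (RtoC (mu1 x) + RtoC z * RtoC (mu2 x)))%C end.
  + apply E; intros; rewrite Cmod_R; apply Hmu.
  + simpl; rewrite Rmult_1_r; ring.
Qed.

(** The bounded factor left when [(i * omega) ^ (- k)] is converted into [eta ^ (2 * k)]. The
    conversion compensates the lower Taylor degree [q - 2 * k] of the amplitude of index [k], so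
    that all amplitudes contribute at the same order; it also explains the factor in [Cstar]. *)
Definition kappa (k : nat) (x om : R) : C :=
  (/ Cpow (iomega om * RtoC (eta om x ^ 2)) k)%C.

Lemma iomega_eta2_neq_0 (x om : R) : omega0 < om ->
  (iomega om * RtoC (eta om x ^ 2))%C <> 0%C.
Proof.
intros Ho; apply Cmod_gt_0; rewrite Cmod_mult, Cmod_iomega, Cmod_R by exact Ho.
assert (He := eta_pos x om Ho).
apply Rmult_lt_0_compat; [lra | apply Rabs_pos_lt, pow_nonzero; lra].
Qed.

Lemma CI_pos : 0 < CI.
Proof. destruct (im_phi_xx_bounds 0); lra. Qed.

Lemma kappa_bound (k : nat) (x om : R) : omega0 < om -> Cmod (kappa k x om) <= CI ^ k.
Proof.
intros Ho; assert (He := eta_pos x om Ho); assert (HCI := CI_pos).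
destruct (omega_eta2_bounds x om Ho) as [L _].
assert (HL : 0 < / CI) by now apply Rinv_0_lt_compat.
unfold kappa; rewrite Cmod_inv by now apply Cpow_nz, iomega_eta2_neq_0.
rewrite Cmod_pow, Cmod_mult, Cmod_iomega, Cmod_R, Rabs_pos_eq by (exact Ho || (apply pow_le; lra)).
rewrite <- pow_inv; apply pow_incr; split.
- left; apply Rinv_0_lt_compat; lra.
- rewrite <- (Rinv_inv CI); apply Rinv_le_contravar; lra.
Qed.

Lemma inverse_iomega_power (k n : nat) (x om : R) : omega0 < om ->
  (/ Cpow (iomega om) k * RtoC (eta om x ^ n) = kappa k x om * RtoC (eta om x ^ (n + 2 * k)))%C.
Proof.
intros Ho; assert (He := eta_pos x om Ho).
unfold kappa; rewrite Cpow_mult_l, pow_add, pow_mult, RtoC_mult, <- !RtoC_pow.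
assert (N1 : Cpow (iomega om) k <> 0%C) by now apply Cpow_nz, iomega_neq_0.
assert (N2 : RtoC ((eta om x ^ 2) ^ k) <> 0%C).
{ intros E; apply RtoC_inj in E; revert E; apply pow_nonzero, pow_nonzero; lra. }
field; now split.
Qed.

Lemma amplitude_near_bound (k : nat) : (k <= q / 2)%nat -> forall i j,
  (i + j <= N + q + 1 - 2 * k)%nat -> forall x s, Rabs (X s - x) <= 1 ->
  Cmod (Cpartial i j (A k) x s) <= MA.
Proof. intros Hk i j H x s _; now apply (HAb k). Qed.

Lemma Cmod_inverse_iomega_power (k n : nat) (x om : R) : omega0 < om ->
  Cmod (/ Cpow (iomega om) k)%C * eta om x ^ n <= CI ^ k * eta om x ^ (n + 2 * k).
Proof.
intros Ho; assert (He := eta_pos x om Ho).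
assert (Hp : forall j, 0 <= eta om x ^ j) by (intros; apply pow_le; lra).
rewrite <- (Rabs_pos_eq (eta om x ^ n)), <- Cmod_R, <- Cmod_mult by apply Hp.
rewrite inverse_iomega_power, Cmod_mult, Cmod_R, Rabs_pos_eq by (exact Ho || apply Hp).
apply Rmult_le_compat_r; [apply Hp | now apply kappa_bound].
Qed.

Lemma amplitude_coefficient_bound (k : nat) : (k <= q / 2)%nat -> exists K,
  forall x om, omega0 < om ->
    Cmod (kappa k x om * a1 q A m k x)%C <= K /\
    Cmod (kappa k x om * a2 q A m k x)%C <= K.
Proof.
intros Hk; assert (Hk2 := double_half_le k Hk).
destruct (signed_taylor_coefficient_bound _ (A k) MA (HA k Hk) (amplitude_near_bound k Hk))
  as [K [HK HS]].
exists (CI ^ k * (K + K)); intros x om Ho; rewrite !Cmod_mult.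
assert (Hkap := kappa_bound k x om Ho).
split; apply Rmult_le_compat; try apply Cmod_ge_0; try exact Hkap.
- assert (E : Cmod (a1 q A m k x) <= K) by (apply HS; lia); lra.
- unfold a2; eapply Rle_trans; [apply Cmod_triangle|]; apply Rplus_le_compat; apply HS; lia.
Qed.

Lemma expansion_amplitude_error (k : nat) : (k <= q / 2)%nat ->
  expansion 0 (q + 1) (fun x om y =>
      (A k x (m (x + eta om x * y)%R)
       - taylor_x X (q - 2 * k) (A k) x (m (x + eta om x * y)%R)) / Cpow (iomega om) k)%C
    (fun x om y => kappa k x om * a1 q A m k x
        * RtoC (eta om x ^ (q + 1) * y ^ (q - 2 * k + 1)))%C
    (fun x om y => kappa k x om * a2 q A m k x
        * RtoC (eta om x ^ S (q + 1) * y ^ (q - 2 * k + 2)))%C.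
Proof.
intros Hk; assert (Hk2 := double_half_le k Hk).
destruct (amplitude_coefficient_bound k Hk) as [K0 HK0].
destruct (taylor_x_two_terms _ (A k) MA (HA k Hk) (amplitude_near_bound k Hk) (q - 2 * k)
  ltac:(lia)) as [K [HK HT]].
apply (expansion_terms _ _ _ (fun x om => kappa k x om * a1 q A m k x)%C
  (fun x om => kappa k x om * a2 q A m k x)%C K0 K0); try (intros; now apply HK0).
assert (HCI := CI_pos).
apply (order_bounded _ _ _ (K * CI ^ k) (q - 2 * k + 3)).
{ apply Rmult_le_pos; [exact HK | apply pow_le; lra]. }
intros x om y Ho Hy; assert (He := eta_pos x om Ho).
set (z := eta om x * y) in *.
assert (E := HT x z ltac:(eapply Rle_trans; [exact (Hy I) | lra])).
fold (a1 q A m k x) in E.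
match goal with |- Cmod ?u <= _ =>
  replace u with (/ Cpow (iomega om) k
    * (A k x (m (x + z)%R) - taylor_x X (q - 2 * k) (A k) x (m (x + z)%R)
       - (RtoC (z ^ (q - 2 * k + 1)) * a1 q A m k x + RtoC (z ^ (q - 2 * k + 2)) * a2 q A m k x)))%C end.
- rewrite Cmod_mult.
  apply Rle_trans with (Cmod (/ Cpow (iomega om) k)%C * (K * Rabs z ^ (q - 2 * k + 3))).
  { apply Rmult_le_compat_l; [apply Cmod_ge_0 | exact E]. }
  unfold z; rewrite Rabs_mult, Rpow_mult_distr, (Rabs_pos_eq (eta _ _)) by lra.
  assert (B := Cmod_inverse_iomega_power k (q - 2 * k + 3) x om Ho).
  replace (q - 2 * k + 3 + 2 * k)%nat with (S (S (q + 1))) in B by lia.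
  assert (Q : 0 <= K * Rabs y ^ (q - 2 * k + 3))
    by (apply Rmult_le_pos; [exact HK | apply pow_le, Rabs_pos]).
  replace (Cmod (/ Cpow (iomega om) k)%C * (K * (eta om x ^ (q - 2 * k + 3) * Rabs y ^ (q - 2 * k + 3))))
    with (Cmod (/ Cpow (iomega om) k)%C * eta om x ^ (q - 2 * k + 3) * (K * Rabs y ^ (q - 2 * k + 3)))
    by ring.
  eapply Rle_trans; [apply Rmult_le_compat_r; [exact Q | exact B]|]; right; ring.
- assert (C1 := inverse_iomega_power k (q - 2 * k + 1) x om Ho).
  assert (C2 := inverse_iomega_power k (q - 2 * k + 2) x om Ho).
  replace (q - 2 * k + 1 + 2 * k)%nat with (q + 1)%nat in C1 by lia.
  replace (q - 2 * k + 2 + 2 * k)%nat with (S (q + 1))%nat in C2 by lia.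
  unfold z at 3 4; rewrite !Rpow_mult_distr, !RtoC_mult.
  match goal with |- (_ * (?u - (?e1 * ?y1 * ?w1 + ?e2 * ?y2 * ?w2)))%C = _ =>
    transitivity (u / Cpow (iomega om) k - (/ Cpow (iomega om) k * e1 * y1 * w1
      + / Cpow (iomega om) k * e2 * y2 * w2))%C; [unfold Cdiv; ring|] end.
  rewrite C1, C2; ring.
Qed.

(** * The phase in the rescaled variable *)

Lemma imxx_neq_0 (x : R) : imxx phi m x <> 0%C.
Proof.
intros E; apply RtoC_inj in E; destruct (im_phi_xx_bounds x); lra.
Qed.

Lemma omega_eta_power (n : nat) (x om t : R) : omega0 < om ->
  (RtoC om * RtoC (eta om x ^ (n + 2) * t) = RtoC (eta om x ^ n * t) / imxx phi m x)%C.
Proof.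
intros Ho; destruct (im_phi_xx_bounds x) as [L _].
unfold imxx; rewrite <- RtoC_mult, <- RtoC_div by lra; f_equal.
rewrite pow_add; transitivity (eta om x ^ n * t * (om * eta om x ^ 2)); [ring|].
now rewrite omega_eta2.
Qed.

Lemma div_imxx_bound (w : C) (x K : R) : Cmod w <= K -> Cmod (Ci * (w / imxx phi m x))%C <= K / cI.
Proof.
intros H; destruct (im_phi_xx_bounds x) as [L _].
assert (H0 : 0 <= K) by (eapply Rle_trans; [apply Cmod_ge_0 | exact H]).
rewrite Cmod_mult, Cmod_Ci, Rmult_1_l, Cmod_div by apply imxx_neq_0.
unfold imxx; rewrite Cmod_R, Rabs_pos_eq by lra.
apply Rmult_le_compat; [apply Cmod_ge_0 | left; apply Rinv_0_lt_compat; lra | exact H|].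
apply Rinv_le_contravar; lra.
Qed.

Lemma phase_coefficient_bound : exists K, 0 <= K /\ forall x,
  Cmod (b1 q phi m x) <= K /\ Cmod (b2 q phi m x) <= K /\ Cmod (c2 q phi m x) <= K.
Proof.
destruct (signed_taylor_coefficient_bound _ phi Mphi Hphi Hphib) as [K [HK HS]].
destruct r_tilde_3_bound as [K3 [HK3 HR]].
assert (Hs : Rabs (sigma_q q) <= 1).
{ unfold sigma_q; destruct (Nat.eqb q 0); rewrite ?Rabs_R0, ?Rabs_R1; lra. }
exists ((K + K + K3) / cI); split; [apply Rdiv_le_0_compat; lra|].
intros x; split; [|split]; apply div_imxx_bound.
- assert (E : Cmod (p_tilde phi m (q + 3) x) <= K) by (apply HS; lia); lra.
- eapply Rle_trans; [apply Cmod_triangle|].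
  assert (E : Cmod (p_tilde phi m (q + 4) x) <= K) by (apply HS; lia).
  assert (E' : Cmod (CDerive (p_tilde phi m (q + 3)) x) <= K) by (apply HS; lia).
  lra.
- unfold Cminus; eapply Rle_trans; [apply Cmod_triangle|].
  rewrite Cmod_opp, Cmod_mult, Cmod_R.
  assert (E : Cmod (p_tilde phi m 3 x) <= K) by (apply HS; lia).
  assert (P := Cmod_ge_0 (p_tilde phi m 3 x)); assert (E3 := HR x).
  assert (Q := Rabs_pos (sigma_q q)); nra.
Qed.

Definition phase_error (x om y : R) : C :=
  (iomega om * (phi x (m (x + eta om x * y)%R)
                   - phase_taylor q phi X x (m (x + eta om x * y)%R)))%C.

Lemma omega_offset_bound (n : nat) (x om y : R) : omega0 < om ->
  om * Rabs (eta om x * y) ^ (n + 2) <= / cI * eta om x ^ n * Rabs y ^ (n + 2).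
Proof.
intros Ho; assert (He := eta_pos x om Ho); destruct (omega_eta2_bounds x om Ho) as [_ U].
rewrite Rabs_mult, Rpow_mult_distr, (Rabs_pos_eq (eta _ _)), (pow_add (eta _ _)) by lra.
transitivity (om * eta om x ^ 2 * (eta om x ^ n * Rabs y ^ (n + 2))); [right; ring|].
rewrite (Rmult_assoc (/ cI)); apply Rmult_le_compat_r; [|exact U].
apply Rmult_le_pos; apply pow_le; [lra | apply Rabs_pos].
Qed.

(** The Taylor error of the phase starts with [z ^ (q + 3)], but the frequency in front of it is
    worth [eta ^ (-2)]. The result has order [q + 1], the same as the amplitude errors. *)
Lemma expansion_phase_error : expansion 0 (q + 1) phase_error
  (fun x om y => b1 q phi m x * RtoC (eta om x ^ (q + 1) * y ^ (q + 3)))%C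
  (fun x om y => b2 q phi m x * RtoC (eta om x ^ S (q + 1) * y ^ (q + 4)))%C.
Proof.
destruct phase_coefficient_bound as [K0 [HK0 HB]].
destruct (taylor_x_two_terms _ phi Mphi Hphi Hphib (q + 2) ltac:(lia)) as [K [HK HT]].
replace (q + 2 + 1)%nat with (q + 3)%nat in HT by lia.
replace (q + 2 + 2)%nat with (q + 4)%nat in HT by lia.
replace (q + 2 + 3)%nat with (q + 3 + 2)%nat in HT by lia.
apply (expansion_terms _ _ _ (fun x _ => b1 q phi m x) (fun x _ => b2 q phi m x) K0 K0);
  try (intros; apply HB).
replace (S (S (q + 1))) with (q + 3)%nat by lia.
apply (order_bounded _ _ _ (K * / cI) (q + 3 + 2)).
{ apply Rmult_le_pos; [exact HK | left; now apply Rinv_0_lt_compat]. }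
intros x om y Ho Hy; assert (He := eta_pos x om Ho).
set (z := eta om x * y) in *.
assert (E := HT x z ltac:(eapply Rle_trans; [exact (Hy I) | lra])).
fold (phase_taylor q phi X x (m (x + z)%R)) in E.
change (signed_taylor_coefficient phi) with (p_tilde phi m) in E.
match goal with |- Cmod ?u <= _ => match type of E with Cmod ?w <= _ =>
  replace u with (iomega om * w)%C end end.
- rewrite Cmod_mult, Cmod_iomega by exact Ho.
  apply Rle_trans with (om * (K * Rabs z ^ (q + 3 + 2))).
  { apply Rmult_le_compat_l; [lra | exact E]. }
  assert (B := omega_offset_bound (q + 3) x om y Ho); fold z in B.
  replace (om * (K * Rabs z ^ (q + 3 + 2))) with (K * (om * Rabs z ^ (q + 3 + 2))) by ring.
  eapply Rle_trans; [apply Rmult_le_compat_l; [exact HK | exact B]|]; right; ring.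
- assert (C1 := omega_eta_power (q + 1) x om (y ^ (q + 3)) Ho).
  assert (C2 := omega_eta_power (S (q + 1)) x om (y ^ (q + 4)) Ho).
  replace (q + 1 + 2)%nat with (q + 3)%nat in C1 by lia.
  replace (S (q + 1) + 2)%nat with (q + 4)%nat in C2 by lia.
  rewrite <- Rpow_mult_distr in C1, C2; fold z in C1, C2.
  unfold phase_error; fold z; unfold b1, b2.
  match goal with |- (_ * (?u - (?e1 * ?w1 + ?e2 * ?w2)))%C = _ =>
    transitivity (iomega om * u - Ci * (RtoC om * e1 * w1 + RtoC om * e2 * w2))%C;
    [unfold iomega; ring|] end.
  rewrite C1, C2; unfold Cdiv; ring.
Qed.

(* [sigma_q] is there because for [q = 0] the Taylor polynomial stops before the cubic term. *)
Lemma phase_taylor_cubic : exists K, 0 <= K /\ forall x z, Rabs z <= 1 ->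
  Cmod (phase_taylor q phi X x (m (x + z)%R) - (phi x (m x) + RtoC (z ^ 2) * r_tilde phi m 2 x
        + RtoC (z ^ 3) * (r_tilde phi m 3 x - RtoC (sigma_q q) * p_tilde phi m 3 x)))%C
  <= K * Rabs z ^ 4.
Proof.
destruct phase_cubic as [K1 [HK1 HC]].
assert (T : exists K, 0 <= K /\ forall x z, Rabs z <= 1 ->
  Cmod (phi x (m (x + z)%R) - phase_taylor q phi X x (m (x + z)%R)
        - RtoC (z ^ 3) * (RtoC (sigma_q q) * p_tilde phi m 3 x))%C <= K * Rabs z ^ 4).
{ unfold sigma_q; destruct (Nat.eqb_spec q 0) as [E|E].
  - destruct (signed_taylor_coefficient_bound _ phi Mphi Hphi Hphib) as [K2 [HK2 HS]].
    destruct (taylor_x_two_terms _ phi Mphi Hphi Hphib (q + 2) ltac:(lia)) as [K3 [HK3 HT]].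
    replace (q + 2 + 1)%nat with 3%nat in HT by lia.
    replace (q + 2 + 2)%nat with 4%nat in HT by lia.
    replace (q + 2 + 3)%nat with 5%nat in HT by lia.
    exists (K3 + (K2 + K2)); split; [lra|]; intros x z Hz.
    assert (P := Rabs_pos z).
    assert (P4 : 0 <= Rabs z ^ 4) by now apply pow_le.
    assert (HTx := HT x z Hz).
    fold (phase_taylor q phi X x (m (x + z)%R)) in HTx.
    change (signed_taylor_coefficient phi) with (p_tilde phi m) in HTx.
    set (c := (p_tilde phi m 4 x + CDerive (p_tilde phi m 3) x)%C) in HTx.
    assert (Hc : Cmod c <= K2 + K2).
    { unfold c; eapply Rle_trans; [apply Cmod_triangle|]; apply Rplus_le_compat; apply HS; lia. }
    match goal with |- Cmod ?u <= _ => match type of HTx with Cmod ?w <= _ =>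
      replace u with (w + RtoC (z ^ 4) * c)%C by ring end end.
    eapply Rle_trans; [apply Cmod_triangle|].
    rewrite Cmod_mult, Cmod_R, <- RPow_abs, Rmult_plus_distr_r.
    apply Rplus_le_compat.
    + eapply Rle_trans; [exact HTx|]; apply Rmult_le_compat_l; [exact HK3|].
      rewrite <- tech_pow_Rmult; nra.
    + rewrite Rmult_comm; now apply Rmult_le_compat_r.
  - assert (HM := Mphi_nonneg).
    exists (2 * Mphi); split; [lra|]; intros x z Hz.
    rewrite Cmult_0_l, Cmult_0_r.
    replace (_ - 0)%C with (phi x (m (x + z)%R) - phase_taylor q phi X x (m (x + z)%R))%C by ring.
    eapply Rle_trans; [now apply phase_taylor_error|].
    apply Rmult_le_compat_l; [lra|].
    replace (q + 3)%nat with ((q - 1) + 4)%nat by lia; rewrite pow_add.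
    assert (P := Rabs_pos z).
    rewrite <- (Rmult_1_l (Rabs z ^ 4)) at 2.
    apply Rmult_le_compat_r; [now apply pow_le|].
    rewrite <- (pow1 (q - 1)); apply pow_incr; lra. }
destruct T as [K2 [HK2 HT]]; exists (K1 + K2); split; [lra|]; intros x z Hz.
assert (E1 := HC x z Hz); assert (E2 := HT x z Hz).
match goal with |- Cmod ?u <= _ =>
  match type of E1 with Cmod ?v <= _ => match type of E2 with Cmod ?w <= _ =>
    replace u with (v - w)%C by ring end end end.
unfold Cminus at 1; eapply Rle_trans; [apply Cmod_triangle|].
rewrite Cmod_opp, Rmult_plus_distr_r; now apply Rplus_le_compat.
Qed.

(** The exponent of [d_coef], and the limit of the rescaled phase: its real part carries no
    parameter because of the choice of the beam width. *)
Definition quadratic_phase (x y : R) : C :=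
  (Ci * RtoC (y ^ 2 * c1 phi m x) - RtoC (y ^ 2 / 2))%C.

Definition taylor_phase_shift (x om y : R) : C :=
  (iomega om * (phase_taylor q phi X x (m (x + eta om x * y)%R) - phi x (m x)))%C.

Lemma quadratic_phase_eq (x y : R) :
  (Ci * RtoC (y ^ 2) * (r_tilde phi m 2 x / imxx phi m x) = quadratic_phase x y)%C.
Proof.
unfold quadratic_phase, c1.
assert (H : Im (r_tilde phi m 2 x / imxx phi m x)%C = 1 / 2).
{ destruct (im_phi_xx_bounds x) as [L _].
  assert (E := Im_r_tilde_2 x); unfold imxx.
  unfold Cdiv; rewrite <- RtoC_inv by lra.
  destruct (r_tilde phi m 2 x) as [u v]; unfold Im in *; simpl in *; rewrite E; field; lra. }
destruct (r_tilde phi m 2 x / imxx phi m x)%C as [u v]; unfold Re, Im in *; simpl in H; subst v.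
apply injective_projections; simpl; field.
Qed.

Lemma order_taylor_phase_shift : order True 0 2 (fun x om y => taylor_phase_shift x om y
  - (quadratic_phase x y + c2 q phi m x * RtoC (eta om x ^ 1 * y ^ 3)))%C.
Proof.
destruct phase_taylor_cubic as [K [HK HC]].
apply (order_bounded _ _ _ (K * / cI) (2 + 2)).
{ apply Rmult_le_pos; [exact HK | left; now apply Rinv_0_lt_compat]. }
intros x om y Ho Hy; assert (He := eta_pos x om Ho).
set (z := eta om x * y) in *.
assert (E := HC x z ltac:(eapply Rle_trans; [exact (Hy I) | lra])).
match goal with |- Cmod ?u <= _ => match type of E with Cmod ?w <= _ =>
  replace u with (iomega om * w)%C end end.
- rewrite Cmod_mult, Cmod_iomega by exact Ho.
  apply Rle_trans with (om * (K * Rabs z ^ (2 + 2))).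
  { apply Rmult_le_compat_l; [lra | exact E]. }
  assert (B := omega_offset_bound 2 x om y Ho); fold z in B.
  replace (om * (K * Rabs z ^ (2 + 2))) with (K * (om * Rabs z ^ (2 + 2))) by ring.
  eapply Rle_trans; [apply Rmult_le_compat_l; [exact HK | exact B]|]; right; ring.
- assert (C1 := omega_eta_power 0 x om (y ^ 2) Ho).
  assert (C2 := omega_eta_power 1 x om (y ^ 3) Ho).
  simpl plus in C1, C2; rewrite <- Rpow_mult_distr in C1, C2; fold z in C1, C2.
  rewrite pow_O, Rmult_1_l in C1.
  rewrite <- quadratic_phase_eq; unfold taylor_phase_shift, c2; fold z.
  match goal with |- (_ * (?u - (?f0 + ?e1 * ?w1 + ?e2 * ?w2)))%C = _ =>
    transitivity (iomega om * (u - f0) - Ci * (RtoC om * e1 * w1 + RtoC om * e2 * w2))%C;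
    [unfold iomega; ring|] end.
  rewrite C1, C2; unfold Cdiv; ring.
Qed.

Lemma Re_quadratic_phase (x y : R) : Re (quadratic_phase x y) = - (y ^ 2 / 2).
Proof. unfold quadratic_phase, Re; simpl; field. Qed.

Lemma quadratic_phase_bound (x y : R) :
  Cmod (Cexp (quadratic_phase x y)) <= exp (- (/ 4 * y ^ 2)).
Proof.
rewrite Cmod_Cexp, Re_quadratic_phase; apply exp_le_exp.
assert (P := pow2_ge_0 y); lra.
Qed.

(** The subtracted value on the ray is real and does not affect the modulus. The relation
    [omega * eta ^ 2 * im_phi_xx = 1] turns the convexity constant [im_phi_xx / 4] into [/ 4]. *)
Lemma convex_phase_bound (x om y : R) (w : C) : omega0 < om ->
  im_phi_xx phi x (m x) / 4 * (eta om x * y) ^ 2 <= Im w ->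
  Cmod (Cexp (iomega om * (w - phi x (m x)))%C) <= exp (- (/ 4 * y ^ 2)).
Proof.
intros Ho Hw; destruct (im_phi_xx_bounds x) as [L _].
rewrite Cmod_Cexp, Re_iomega_mult; apply exp_le_exp, Ropp_le_contravar.
replace (Im (w - phi x (m x))%C) with (Im w - Im (phi x (m x))) by reflexivity.
rewrite phase_ray_value_real, Rminus_0_r.
apply Rle_trans with (om * (im_phi_xx phi x (m x) / 4 * (eta om x * y) ^ 2)).
- right; rewrite Rpow_mult_distr.
  replace (om * (im_phi_xx phi x (m x) / 4 * (eta om x ^ 2 * y ^ 2)))
    with (om * eta om x ^ 2 * (im_phi_xx phi x (m x) / 4 * y ^ 2)) by ring.
  rewrite omega_eta2 by exact Ho; field; lra.
- apply Rmult_le_compat_l; lra.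
Qed.

Lemma taylor_phase_shift_bound (x om y : R) : omega0 < om ->
  Rabs (eta om x * y) <= alpha ->
  Cmod (Cexp (taylor_phase_shift x om y)) <= exp (- (/ 4 * y ^ 2)).
Proof.
intros Ho Hy; apply convex_phase_bound; [exact Ho|].
now destruct (Hconvex x (eta om x * y) Hy).
Qed.

Lemma exact_phase_shift_bound (x om y : R) : omega0 < om ->
  Rabs (eta om x * y) <= alpha ->
  Cmod (Cexp (taylor_phase_shift x om y) * Cexp (phase_error x om y))%C
  <= exp (- (/ 4 * y ^ 2)).
Proof.
intros Ho Hy; rewrite <- Cexp_plus.
replace (taylor_phase_shift x om y + phase_error x om y)%C
  with (iomega om * (phi x (m (x + eta om x * y)%R) - phi x (m x)))%C
  by (unfold taylor_phase_shift, phase_error; ring).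
apply convex_phase_bound; [exact Ho|].
now destruct (Hconvex x (eta om x * y) Hy).
Qed.

Lemma order_gaussian (near : Prop) :
  order near (/ 4) 0 (fun x _ y => Cexp (quadratic_phase x y)).
Proof.
exists 1, 0%nat; split; [lra|]; intros x om y _ _; rewrite !pow_O, !Rmult_1_l.
apply quadratic_phase_bound.
Qed.

(** The quadratic exponential is factored out and the rest of the exponent, of order one, is
    expanded to first order. The remainder is Gaussian because both the quadratic exponential and
    the full one are. *)
Lemma expansion_taylor_exponential : expansion (/ 4) 0
  (fun x om y => Cexp (taylor_phase_shift x om y))
  (fun x om y => Cexp (quadratic_phase x y))
  (fun x om y => Cexp (quadratic_phase x y)
     * (c2 q phi m x * RtoC (eta om x ^ 1 * y ^ 3)))%C.
Proof.
destruct phase_coefficient_bound as [K [HK HB]].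
assert (Hc : forall near, order near 0 1
  (fun x om y => c2 q phi m x * RtoC (eta om x ^ 1 * y ^ 3))%C).
{ intros near; apply (order_term near (fun x _ => c2 q phi m x) K); intros; apply HB. }
split; [apply order_gaussian|split].
- apply (order_mult False (/ 4) 0 1); [apply order_gaussian | apply Hc].
- assert (R2 := order_taylor_phase_shift).
  assert (R1 : order True 0 1 (fun x om y => taylor_phase_shift x om y - quadratic_phase x y)%C).
  { apply (order_lower _ _ _ 1) in R2; [|lia].
    eapply order_ext; [|exact (order_plus _ _ _ _ _ R2 (Hc True))]; intros; cbv beta; ring. }
  assert (Q := order_exp_remainder (/ 4) 1 1 (fun x _ y => Cexp (quadratic_phase x y)) _ R1).
  assert (P := order_mult _ _ _ _ _ _ (order_gaussian True) R2).
  eapply order_ext; [|refine (order_plus _ _ _ _ _ (Q _) P)].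
  + intros x om y Ho Hy; cbv beta; unfold Csum; rewrite sum_Sn, sum_O.
    change plus with Cplus; unfold taylor_weight; simpl.
    rewrite Rmult_1_r, Rdiv_1_r.
    replace (Cexp (taylor_phase_shift x om y))
      with (Cexp (quadratic_phase x y) * Cexp (taylor_phase_shift x om y - quadratic_phase x y))%C
      by (rewrite <- Cexp_plus; f_equal; ring).
    ring.
  + intros x om y Ho Hy; cbv beta; split; [apply quadratic_phase_bound|].
    rewrite <- Cexp_plus.
    replace (quadratic_phase x y + (taylor_phase_shift x om y - quadratic_phase x y))%C
      with (taylor_phase_shift x om y) by ring.
    now apply taylor_phase_shift_bound.
Qed.

(* The square of the phase error has order [2 * q + 2], which is relevant only for [q = 0]. *)
Definition quadratic_phase_error (x om y : R) : C :=
  (phase_error x om y + RtoC (sigma_q q / 2) * (phase_error x om y * phase_error x om y))%C.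

Lemma expansion_quadratic_phase_error : expansion 0 (q + 1) quadratic_phase_error
  (fun x om y => b1 q phi m x * RtoC (eta om x ^ (q + 1) * y ^ (q + 3)))%C
  (fun x om y => b2 q phi m x * RtoC (eta om x ^ S (q + 1) * y ^ (q + 4))
     + RtoC (sigma_q q / 2) * Cpow (b1 q phi m x) 2 * RtoC (eta om x ^ S (q + 1) * y ^ (2 * q + 6)))%C.
Proof.
assert (H := expansion_phase_error); unfold quadratic_phase_error, sigma_q.
destruct (Nat.eqb_spec q 0) as [E|E].
- assert (S0 := expansion_mult _ _ _ _ _ _ _ _ _ H H).
  destruct phase_coefficient_bound as [K [HK HB]].
  destruct S0 as [S0 [S1 S2]].
  assert (Hsum : expansion 0 (q + 1)
    (fun x om y => RtoC (1 / 2) * (phase_error x om y * phase_error x om y))%C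
    (fun _ _ _ => 0%C)
    (fun x om y => RtoC (1 / 2) * Cpow (b1 q phi m x) 2
        * RtoC (eta om x ^ S (q + 1) * y ^ (2 * q + 6)))%C).
  { split; [|split].
    - exists 0, 0%nat; split; [lra|]; intros; rewrite Cmod_0.
      right; ring.
    - apply (order_term _ (fun x _ => RtoC (1 / 2) * Cpow (b1 q phi m x) 2)%C (1 / 2 * K ^ 2)).
      intros x om _; rewrite Cmod_mult, Cmod_R, Cmod_pow, Rabs_pos_eq by lra.
      apply Rmult_le_compat_l; [lra|]; apply pow_incr; split; [apply Cmod_ge_0 | apply HB].
    - apply (order_local True) in S1.
      apply (order_lower _ _ _ (S (S (q + 1)))) in S1; [|lia].
      apply (order_lower _ _ _ (S (S (q + 1)))) in S2; [|lia].
      assert (Hh : order True 0 0 (fun _ _ _ => RtoC (1 / 2))).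
      { apply (order_coefficient True (fun _ _ => RtoC (1 / 2)) (1 / 2)).
        intros; rewrite Cmod_R, Rabs_pos_eq; lra. }
      assert (P := order_mult _ _ _ _ _ _ (order_plus _ _ _ _ _ S1 S2) Hh).
      rewrite Nat.add_0_r in P; revert P; apply order_ext.
      intros x om y Ho Hy; cbv beta.
      replace (eta om x ^ S (q + 1) * y ^ (2 * q + 6))
        with ((eta om x ^ (q + 1) * y ^ (q + 3)) * (eta om x ^ (q + 1) * y ^ (q + 3))).
      + rewrite (RtoC_mult (eta om x ^ (q + 1) * y ^ (q + 3))); simpl Cpow; ring.
      + rewrite E; simpl; ring. }
  generalize (expansion_plus _ _ _ _ _ _ _ _ H Hsum); apply expansion_ext; intros; cbv beta; ring.
- revert H; apply expansion_ext; intros; cbv beta;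
    replace (0 / 2) with 0 by field; ring.
Qed.

Lemma expansion_phase_factor : expansion (/ 4) (q + 1)
  (fun x om y => Cexp (taylor_phase_shift x om y) * (Cexp (phase_error x om y) - 1))%C
  (fun x om y => Cexp (quadratic_phase x y)
     * (b1 q phi m x * RtoC (eta om x ^ (q + 1) * y ^ (q + 3))))%C
  (fun x om y => Cexp (quadratic_phase x y)
     * (b2 q phi m x * RtoC (eta om x ^ S (q + 1) * y ^ (q + 4))
        + RtoC (sigma_q q / 2) * Cpow (b1 q phi m x) 2
          * RtoC (eta om x ^ S (q + 1) * y ^ (2 * q + 6)))
     + Cexp (quadratic_phase x y) * (c2 q phi m x * RtoC (eta om x ^ 1 * y ^ 3))
       * (b1 q phi m x * RtoC (eta om x ^ (q + 1) * y ^ (q + 3))))%C.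
Proof.
assert (H := expansion_mult _ _ _ _ _ _ _ _ _
  expansion_taylor_exponential expansion_quadratic_phase_error).
apply (expansion_remainder _ _ _ _ _ _ H).
assert (D := expansion_order _ _ _ _ _ expansion_phase_error).
assert (B : forall x om y, omega0 < om -> Rabs (eta om x * y) <= alpha ->
  Cmod (Cexp (taylor_phase_shift x om y)) <= exp (- (/ 4 * y ^ 2)) /\
  Cmod (Cexp (taylor_phase_shift x om y) * Cexp (phase_error x om y))%C
    <= exp (- (/ 4 * y ^ 2))).
{ intros; split; [now apply taylor_phase_shift_bound | now apply exact_phase_shift_bound]. }
unfold quadratic_phase_error, sigma_q; destruct (Nat.eqb_spec q 0) as [E|E].
(* The remainder must have order [q + 3]. Stopping after degree [r] leaves order
   [(q + 1) * (r + 1)], so degree 2 is needed for [q = 0] and degree 1 is enough for [q >= 1]. *)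
- assert (Q := order_exp_remainder (/ 4) (q + 1) 2
    (fun x om y => Cexp (taylor_phase_shift x om y)) _ D B).
  apply (order_lower _ _ _ (S (S (0 + (q + 1))))) in Q; [|lia].
  revert Q; apply order_ext; intros x om y _ _; cbv beta.
  unfold Csum; rewrite !sum_Sn, sum_O; change plus with Cplus; unfold taylor_weight; simpl.
  rewrite !Rmult_1_r, !Rdiv_1_r; replace (1 / (1 + 1)) with (1 / 2) by field; ring.
- assert (Q := order_exp_remainder (/ 4) (q + 1) 1
    (fun x om y => Cexp (taylor_phase_shift x om y)) _ D B).
  apply (order_lower _ _ _ (S (S (0 + (q + 1))))) in Q; [|lia].
  revert Q; apply order_ext; intros x om y _ _; cbv beta.
  unfold Csum; rewrite !sum_Sn, sum_O; change plus with Cplus; unfold taylor_weight; simpl.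
  rewrite !Rmult_1_r, !Rdiv_1_r.
  replace (0 / 2) with 0 by field; ring.
Qed.

(** * The amplitude and the whole difference of the beams *)

Lemma source_bounds : exists K, 0 <= K /\ forall x,
  Cmod (A0_ray A m x) <= K /\ Cmod (b1_tilde A m x) <= K /\
  forall z, Cmod (A 0%nat x (m (x + z)%R)
     - (A0_ray A m x + RtoC z * b1_tilde A m x))%C <= K * Rabs z ^ 2.
Proof.
destruct inverse_derivatives_bounded as [K [HK Hmu]].
assert (B : forall j x s, (j <= 2)%nat -> Cmod (Cpartial 0 j (A 0%nat) x s) <= MA).
{ intros j x s Hj; apply (HAb 0%nat); lia. }
assert (HM : 0 <= MA) by (eapply Rle_trans; [apply Cmod_ge_0 | apply (B 0%nat 0 0); lia]).
assert (Hb : forall x, b1_tilde A m x = line_derivative (A 0%nat) x 1 0).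
{ intros x; apply Cder_unique, (line_derivative_der _ _ x 0 0 (HA 0%nat ltac:(lia))); lia. }
assert (B2 : forall x z, Cmod (line_derivative (A 0%nat) x 2 z) <= K * K * MA + K * MA).
{ intros x z; simpl; destruct (Hmu (x + z)) as [H1 [H2 _]].
  eapply Rle_trans; [apply Cmod_triangle|]; rewrite !Cmod_mult, !Cmod_R.
  apply Rplus_le_compat; repeat apply Rmult_le_compat; repeat apply Rmult_le_pos;
    try apply Rabs_pos; try apply Cmod_ge_0; auto; apply B; lia. }
exists (MA + K * MA + 2 * (K * K * MA + K * MA)); split; [nra|].
intros x; split; [|split].
- unfold A0_ray; rewrite <- Cpartial_00; eapply Rle_trans; [apply B; lia|].
  assert (0 <= K * MA) by nra; nra.
- rewrite Hb; simpl; rewrite Cmod_mult, Cmod_R.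
  assert (E : Rabs (mu1 (x + 0)) * Cmod (Cpartial 0 1 (A 0%nat) x (m (x + 0))) <= K * MA).
  { apply Rmult_le_compat; [apply Rabs_pos | apply Cmod_ge_0 | apply Hmu | apply B; lia]. }
  assert (0 <= K * MA) by nra; nra.
- intros z.
  assert (E := expansion2 (line_derivative (A 0%nat) x 0) (line_derivative (A 0%nat) x 1)
    (line_derivative (A 0%nat) x 2) (K * K * MA + K * MA) 0 z
    (fun t => line_derivative_der _ _ x 0 t (HA 0%nat ltac:(lia)) ltac:(lia) ltac:(lia))
    (fun t => line_derivative_der _ _ x 1 t (HA 0%nat ltac:(lia)) ltac:(lia) ltac:(lia)) (B2 x)).
  rewrite <- Hb, Rplus_0_l in E; unfold A0_ray.
  replace (line_derivative (A 0%nat) x 0 0) with (A 0%nat x (m x)) in E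
    by (simpl; now rewrite Rplus_0_r).
  eapply Rle_trans; [exact E|]; apply Rmult_le_compat_r; [apply pow_le, Rabs_pos | nra].
Qed.

(** For [k >= 1] the factor [(i * omega) ^ (- k)] has order at least 2 in the beam width, beyond the
    two orders kept. Hence only the amplitude of index 0 appears in [e21] and [e22]. *)
Lemma expansion_amplitude : expansion 0 0
  (fun x om y => amplitude q A om x (m (x + eta om x * y)%R))
  (fun x om y => A0_ray A m x * RtoC (eta om x ^ 0 * y ^ 0))%C
  (fun x om y => b1_tilde A m x * RtoC (eta om x ^ 1 * y ^ 1))%C.
Proof.
destruct source_bounds as [K [HK HB]].
apply (expansion_remainder _ _ (fun x om y => A 0%nat x (m (x + eta om x * y)%R))).
- apply (expansion_terms 0 0 1 (fun x _ => A0_ray A m x) (fun x _ => b1_tilde A m x) K K);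
    try (intros; apply HB).
  apply (order_offset 2 _ K HK); intros x z om Ho Hz.
  assert (He := eta_pos x om Ho).
  replace (eta om x * (z / eta om x)) with z by (field; lra).
  replace (eta om x ^ 1 * (z / eta om x) ^ 1) with z by (simpl; field; lra).
  rewrite !pow_O, !Rmult_1_r, Cmult_1_r, (Cmult_comm _ (RtoC z)); apply HB.
- assert (D : forall n, (n <= q / 2)%nat -> order True 0 2 (fun x om y =>
    Csum (fun k => A k x (m (x + eta om x * y)%R) / Cpow (iomega om) k) n
    - A 0%nat x (m (x + eta om x * y)%R))%C).
  { induction n as [|n IH]; intros Hn.
    - exists 0, 0%nat; split; [lra|]; intros x om y Ho _.
      unfold Csum; rewrite sum_O; simpl Cpow.
      replace (_ - _)%C with (RtoC 0) by field; rewrite Cmod_0; right; ring.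
    - assert (T : order True 0 2 (fun x om y =>
        A (S n) x (m (x + eta om x * y)%R) / Cpow (iomega om) (S n))%C).
      { apply (order_lower _ _ (2 * S n)); [lia|].
        assert (HM : 0 <= MA).
        { eapply Rle_trans; [apply Cmod_ge_0 | apply (HAb 0%nat ltac:(lia) 0 0 ltac:(lia) 0 0)]. }
        assert (HCI := CI_pos).
        apply (order_bounded _ _ _ (MA * CI ^ S n) 0).
        { apply Rmult_le_pos; [exact HM | apply pow_le; lra]. }
        intros x om y Ho _; unfold Cdiv; rewrite Cmod_mult, pow_O, Rmult_1_r, Rmult_assoc.
        assert (B := Cmod_inverse_iomega_power (S n) 0 x om Ho).
        rewrite pow_O, Rmult_1_r in B.
        apply Rmult_le_compat; try apply Cmod_ge_0; [|exact B].
        rewrite <- Cpartial_00; apply (HAb (S n)); [exact Hn|].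
        assert (H2 := double_half_le (S n) Hn); lia. }
      eapply order_ext; [|exact (order_plus _ _ _ _ _ (IH ltac:(lia)) T)].
      intros; cbv beta; unfold Csum at 2; rewrite sum_Sn; change plus with Cplus.
      fold (Csum (fun k => A k x (m (x + eta om x * y)) / Cpow (iomega om) k)%C n); ring. }
  exact (D (q / 2)%nat (Nat.le_refl _)).
Qed.

Definition gaussian_monomial (x y : R) (j : nat) : C :=
  (RtoC (y ^ j) * Cexp (quadratic_phase x y))%C.

(* The coefficients of the first two orders of the error, as functionals of the monomials
   [g j]: the integrand has [g j = y ^ j * exp (quadratic_phase x y)], its integral
   [g j = d_coef j]. *)
Definition amplitude0 (k : nat) (x om : R) (g : nat -> C) : C :=
  (kappa k x om * (a1 q A m k x * RtoC (mu1 x) * g (q - 2 * k + 1)%nat))%C.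

Definition amplitude1 (k : nat) (x om : R) (g : nat -> C) : C :=
  (kappa k x om
   * ((a2 q A m k x * RtoC (mu1 x) + a1 q A m k x * RtoC (mu2 x)) * g (q - 2 * k + 2)%nat
      + a1 q A m k x * c2 q phi m x * RtoC (mu1 x) * g (q - 2 * k + 4)%nat))%C.

Definition phase0 (x : R) (g : nat -> C) : C :=
  (A0_ray A m x * b1 q phi m x * RtoC (mu1 x) * g (q + 3)%nat)%C.

Definition phase1 (x : R) (g : nat -> C) : C :=
  ((b1_tilde A m x * b1 q phi m x * RtoC (mu1 x) + A0_ray A m x * b2 q phi m x * RtoC (mu1 x)
    + A0_ray A m x * b1 q phi m x * RtoC (mu2 x)) * g (q + 4)%nat
   + A0_ray A m x * (RtoC (sigma_q q / 2) * Cpow (b1 q phi m x) 2) * RtoC (mu1 x)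
     * g (2 * q + 6)%nat
   + A0_ray A m x * b1 q phi m x * c2 q phi m x * RtoC (mu1 x) * g (q + 6)%nat)%C.

Definition lead0 (x om : R) (g : nat -> C) : C :=
  (Csum (fun k => amplitude0 k x om g) (q / 2) + phase0 x g)%C.

Definition lead1 (x om : R) (g : nat -> C) : C :=
  (Csum (fun k => amplitude1 k x om g) (q / 2) + phase1 x g)%C.

(** The difference of two products is split by inserting a mixed one: here the error of an amplitude
    multiplies the Taylorised exponential, and in [phase_error_term] the error of the exponential
    multiplies the exact amplitude. *)
Definition amplitude_error_term (k : nat) (x om y : R) : C :=
  (Cexp (taylor_phase_shift x om y)
   * ((A k x (m (x + eta om x * y)%R)
       - taylor_x X (q - 2 * k) (A k) x (m (x + eta om x * y)%R)) / Cpow (iomega om) k)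
   * RtoC (chi (eta om x * y)) * RtoC (mu1 (x + eta om x * y)))%C.

Lemma expansion_amplitude_error_term (k : nat) : (k <= q / 2)%nat ->
  expansion (/ 4) (q + 1) (amplitude_error_term k)
  (fun x om y => RtoC (eta om x ^ (q + 1)) * amplitude0 k x om (gaussian_monomial x y))%C
  (fun x om y => RtoC (eta om x ^ (q + 2)) * amplitude1 k x om (gaussian_monomial x y))%C.
Proof.
intros Hk.
assert (H := expansion_mult _ _ _ _ _ _ _ _ _ (expansion_mult _ _ _ _ _ _ _ _ _
  (expansion_mult _ _ _ _ _ _ _ _ _ expansion_taylor_exponential (expansion_amplitude_error k Hk))
  expansion_cutoff) expansion_mu1).
rewrite !Nat.add_0_r, Nat.add_0_l in H.
revert H; apply expansion_ext.
- reflexivity.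
- intros x om y _; cbv beta; unfold amplitude0, gaussian_monomial.
  rewrite !pow_O, !RtoC_mult; ring.
- intros x om y _; cbv beta; unfold amplitude1, gaussian_monomial.
  replace (q - 2 * k + 2)%nat with ((q - 2 * k + 1) + 1)%nat by lia.
  replace (q - 2 * k + 4)%nat with ((q - 2 * k + 1) + 3)%nat by lia.
  replace (q + 2)%nat with (q + 1 + 1)%nat by lia.
  replace (S (q + 1)) with (q + 1 + 1)%nat by lia.
  rewrite !(pow_add y (q - 2 * k + 1)), !(pow_add (eta om x) (q + 1) 1).
  rewrite !pow_O, !pow_1, !RtoC_mult; ring.
Qed.

Definition phase_error_term (x om y : R) : C :=
  (Cexp (taylor_phase_shift x om y) * (Cexp (phase_error x om y) - 1)
   * amplitude q A om x (m (x + eta om x * y)%R)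
   * RtoC (chi (eta om x * y)) * RtoC (mu1 (x + eta om x * y)))%C.

Lemma expansion_phase_error_term : expansion (/ 4) (q + 1) phase_error_term
  (fun x om y => RtoC (eta om x ^ (q + 1)) * phase0 x (gaussian_monomial x y))%C
  (fun x om y => RtoC (eta om x ^ (q + 2)) * phase1 x (gaussian_monomial x y))%C.
Proof.
assert (H := expansion_mult _ _ _ _ _ _ _ _ _ (expansion_mult _ _ _ _ _ _ _ _ _
  (expansion_mult _ _ _ _ _ _ _ _ _ expansion_phase_factor expansion_amplitude)
  expansion_cutoff) expansion_mu1).
rewrite !Nat.add_0_r in H.
revert H; apply expansion_ext.
- reflexivity.
- intros x om y _; cbv beta; unfold phase0, gaussian_monomial.
  rewrite !pow_O, !RtoC_mult; ring.
- intros x om y _; cbv beta; unfold phase1, gaussian_monomial.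
  replace (q + 4)%nat with ((q + 3) + 1)%nat by lia.
  replace (q + 6)%nat with ((q + 3) + 3)%nat by lia.
  replace (q + 2)%nat with (q + 1 + 1)%nat by lia.
  replace (S (q + 1)) with (q + 1 + 1)%nat by lia.
  rewrite !(pow_add y (q + 3)), !(pow_add (eta om x) (q + 1) 1).
  rewrite !pow_O, !pow_1, !RtoC_mult; simpl Cpow; ring.
Qed.

Lemma Csum_mult_r (f : nat -> C) (c : C) (n : nat) :
  Csum (fun k => f k * c)%C n = (Csum f n * c)%C.
Proof.
unfold Csum; induction n as [|n IH]; [now rewrite !sum_O|].
rewrite !sum_Sn, IH; change plus with Cplus; ring.
Qed.

Lemma Csum_mult_l (f : nat -> C) (c : C) (n : nat) :
  Csum (fun k => c * f k)%C n = (c * Csum f n)%C.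
Proof.
rewrite Cmult_comm, <- Csum_mult_r; unfold Csum; apply sum_n_ext; intros; apply Cmult_comm.
Qed.

Lemma Csum_minus (f g : nat -> C) (n : nat) :
  Csum (fun k => f k - g k)%C n = (Csum f n - Csum g n)%C.
Proof.
unfold Csum; induction n as [|n IH]; [now rewrite !sum_O|].
rewrite !sum_Sn, IH; change plus with Cplus; ring.
Qed.

(* The Jacobian [mu1] comes from the substitution [s = m (x + eta * y)]. *)
Definition beam_difference (x om y : R) : C :=
  (RtoC (mu1 (x + eta om x * y))
   * (RtoC (chi (X (m (x + eta om x * y)) - x)) * amplitude q A om x (m (x + eta om x * y)%R)
      * Cexp (iomega om * phi x (m (x + eta om x * y)%R))
      - beam_taylor q phi A X chi om x (m (x + eta om x * y)%R)))%C.

Lemma beam_difference_eq (x om y : R) :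
  (beam_difference x om y = Cexp (iomega om * phi x (m x))
   * (Csum (fun k => amplitude_error_term k x om y) (q / 2) + phase_error_term x om y))%C.
Proof.
unfold beam_difference, beam_taylor, amplitude_error_term, phase_error_term.
rewrite !HXm; replace (x + eta om x * y - x) with (eta om x * y) by ring.
set (s := m (x + eta om x * y)); set (J := RtoC (mu1 (x + eta om x * y))).
set (T := Cexp (taylor_phase_shift x om y)); set (ch := RtoC (chi (eta om x * y))).
replace (Cexp (iomega om * phi x s)%C)
  with (Cexp (iomega om * phi x (m x)) * T * Cexp (phase_error x om y))%C.
2:{ unfold T; rewrite <- !Cexp_plus; f_equal; unfold taylor_phase_shift, phase_error; fold s; ring. }
replace (Cexp (iomega om * phase_taylor q phi X x s)%C)
  with (Cexp (iomega om * phi x (m x)) * T)%C.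
2:{ unfold T; rewrite <- !Cexp_plus; f_equal; unfold taylor_phase_shift; fold s; ring. }
rewrite !Csum_mult_r, Csum_mult_l.
replace (Csum (fun k => (A k x s - taylor_x X (q - 2 * k) (A k) x s) / Cpow (iomega om) k)%C (q / 2))
  with (amplitude q A om x s - amplitude_taylor q A X om x s)%C.
- ring.
- unfold amplitude, amplitude_taylor; rewrite <- Csum_minus.
  unfold Csum; apply sum_n_ext; intros k.
  match goal with |- ?u = ?v => change (@eq C u v) end; unfold Cdiv; ring.
Qed.

Lemma expansion_beam_difference : expansion (/ 4) (q + 1)
  (fun x om y => Csum (fun k => amplitude_error_term k x om y) (q / 2)
                    + phase_error_term x om y)%C
  (fun x om y => RtoC (eta om x ^ (q + 1)) * lead0 x om (gaussian_monomial x y))%C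
  (fun x om y => RtoC (eta om x ^ (q + 2)) * lead1 x om (gaussian_monomial x y))%C.
Proof.
generalize (expansion_plus _ _ _ _ _ _ _ _
  (expansion_Csum _ _ _ _ _ _ expansion_amplitude_error_term) expansion_phase_error_term).
apply expansion_ext.
- reflexivity.
- intros x om y _; cbv beta; rewrite Csum_mult_l; unfold lead0; ring.
- intros x om y _; cbv beta; rewrite Csum_mult_l; unfold lead1; ring.
Qed.

(** * The Taylor expansion error *)

(** A purely qualitative notion, used to obtain integrability on compact intervals; no bound on the
    derivative is attached. *)
Definition Cdifferentiable (f : R -> C) : Prop := forall y, exists l, Cder f y l.

Lemma Cdifferentiable_const (c : C) : Cdifferentiable (fun _ => c).
Proof. intros y; exists 0%C; apply Cder_const. Qed.

Lemma Cdifferentiable_plus (f g : R -> C) :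
  Cdifferentiable f -> Cdifferentiable g -> Cdifferentiable (fun y => f y + g y)%C.
Proof.
intros Hf Hg y; destruct (Hf y) as [a Ha], (Hg y) as [b Hb].
eexists; apply Cder_plus; eassumption.
Qed.

Lemma Cdifferentiable_mult (f g : R -> C) :
  Cdifferentiable f -> Cdifferentiable g -> Cdifferentiable (fun y => f y * g y)%C.
Proof.
intros Hf Hg y; destruct (Hf y) as [a Ha], (Hg y) as [b Hb].
eexists; apply Cder_mult; eassumption.
Qed.

Lemma Cdifferentiable_Cexp (f : R -> C) : Cdifferentiable f -> Cdifferentiable (fun y => Cexp (f y)).
Proof. intros Hf y; destruct (Hf y) as [a Ha]; eexists; apply Cder_Cexp; eassumption. Qed.

Lemma Cdifferentiable_Csum (f : nat -> R -> C) (n : nat) :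
  (forall k, (k <= n)%nat -> Cdifferentiable (f k)) ->
  Cdifferentiable (fun y => Csum (fun k => f k y) n).
Proof.
induction n as [|n IH]; intros H.
- intros y; destruct (H 0%nat (Nat.le_refl 0) y) as [l Hl]; exists l; revert Hl.
  apply Cder_ext; intros t; unfold Csum; now rewrite sum_O.
- intros y.
  destruct (Cdifferentiable_plus _ _ (IH ltac:(intros; apply H; lia)) (H (S n) (Nat.le_refl _)) y) as [l Hl].
  exists l; revert Hl; apply Cder_ext; intros t; unfold Csum; now rewrite sum_Sn.
Qed.

Lemma Cdifferentiable_ext (f g : R -> C) :
  (forall y, f y = g y) -> Cdifferentiable f -> Cdifferentiable g.
Proof. intros E Hf y; destruct (Hf y) as [l Hl]; exists l; now apply (Cder_ext f). Qed.

Lemma Cdifferentiable_continuous (f : R -> C) (y : R) :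
  Cdifferentiable f -> continuous (U := CR) f y.
Proof. intros Hf; destruct (Hf y) as [l Hl]; exact (Cder_continuous_CR f y l Hl). Qed.

Lemma Cdifferentiable_ex_RInt (f : R -> C) (a b : R) :
  Cdifferentiable f -> ex_RInt (V := CR) f a b.
Proof.
intros Hf; apply (ex_RInt_continuous (V := CR)); intros y _.
now apply Cdifferentiable_continuous.
Qed.

Lemma gaussian_monomial_differentiable (j : nat) (x : R) :
  Cdifferentiable (fun y => gaussian_monomial x y j).
Proof.
assert (P : forall k, Cdifferentiable (fun y => RtoC (y ^ k))).
{ intros k y; eexists; apply Cder_RtoC, (is_derive_pow (fun y => y) k), is_derive_id. }
apply Cdifferentiable_mult; [apply P|]; apply Cdifferentiable_Cexp.
apply (Cdifferentiable_ext (fun y => Ci * RtoC (c1 phi m x) * RtoC (y ^ 2)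
   + RtoC (- / 2) * RtoC (y ^ 2))%C).
- intros y; unfold quadratic_phase; rewrite RtoC_mult.
  replace (y ^ 2 / 2) with (/ 2 * y ^ 2) by field.
  rewrite RtoC_mult, RtoC_opp; ring.
- apply Cdifferentiable_plus; (apply Cdifferentiable_mult; [apply Cdifferentiable_const | apply P]).
Qed.

Lemma line_integral_gaussian_monomial (j : nat) (x : R) :
  line_integral (fun y => gaussian_monomial x y j) (d_coef phi m j x).
Proof.
destruct (polynomial_gaussian (/ 4) j ltac:(lra)) as [K [HK HG]].
destruct (is_RInt_gen_line_dominated (fun y => gaussian_monomial x y j) K) as [l [Hl _]].
- intros a b; apply Cdifferentiable_ex_RInt, gaussian_monomial_differentiable.
- intros y; unfold gaussian_monomial; rewrite Cmod_mult, Cmod_R, <- RPow_abs.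
  assert (G := HG (Rabs y) (Rabs_pos y)); rewrite pow2_abs in G.
  eapply Rle_trans; [|exact G]; apply Rmult_le_compat.
  + apply pow_le, Rabs_pos.
  + apply Cmod_ge_0.
  + apply pow_incr; assert (P := Rabs_pos y); lra.
  + apply quadratic_phase_bound.
- unfold d_coef, CRInt_line.
  assert (E := CRInt_line_unique _ _ Hl); unfold CRInt_line in E.
  unfold line_integral; revert Hl; rewrite <- E; intros Hl; exact Hl.
Qed.

Lemma d_coef_odd (j : nat) (x : R) : Nat.odd j = true -> d_coef phi m j x = 0%C.
Proof.
intros Hj; apply (is_RInt_gen_line_odd (fun y => gaussian_monomial x y j)).
- intros a b; apply Cdifferentiable_ex_RInt, gaussian_monomial_differentiable.
- intros y; unfold gaussian_monomial, quadratic_phase.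
  apply Nat.odd_spec in Hj; destruct Hj as [i Hi].
  replace ((- y) ^ j) with (- y ^ j).
  + replace ((- y) ^ 2) with (y ^ 2) by ring; rewrite RtoC_opp; ring.
  + rewrite Hi, !pow_add, !pow_mult, !pow_1; replace ((- y) ^ 2) with (y ^ 2) by ring; ring.
- apply line_integral_gaussian_monomial.
Qed.

Lemma lead0_differentiable (x om : R) :
  Cdifferentiable (fun y => lead0 x om (gaussian_monomial x y)).
Proof.
assert (G : forall c j, Cdifferentiable (fun y => c * gaussian_monomial x y j)%C).
{ intros c j; apply Cdifferentiable_mult;
    [apply Cdifferentiable_const | apply gaussian_monomial_differentiable]. }
unfold lead0, phase0; apply Cdifferentiable_plus; [|apply G].
apply (Cdifferentiable_Csum (fun k y => amplitude0 k x om (gaussian_monomial x y))); intros k _.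
unfold amplitude0; apply Cdifferentiable_mult; [apply Cdifferentiable_const | apply G].
Qed.

Lemma lead1_differentiable (x om : R) :
  Cdifferentiable (fun y => lead1 x om (gaussian_monomial x y)).
Proof.
assert (G : forall c j, Cdifferentiable (fun y => c * gaussian_monomial x y j)%C).
{ intros c j; apply Cdifferentiable_mult;
    [apply Cdifferentiable_const | apply gaussian_monomial_differentiable]. }
unfold lead1, phase1; apply Cdifferentiable_plus; [|apply Cdifferentiable_plus; [apply Cdifferentiable_plus|]; apply G].
apply (Cdifferentiable_Csum (fun k y => amplitude1 k x om (gaussian_monomial x y))); intros k _.
unfold amplitude1; apply Cdifferentiable_mult; [apply Cdifferentiable_const | apply Cdifferentiable_plus; apply G].
Qed.

Notation dcoef x := (fun j => d_coef phi m j x).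

Lemma line_integral_lead0 (x om : R) :
  line_integral (fun y => lead0 x om (gaussian_monomial x y)) (lead0 x om (dcoef x)).
Proof.
assert (G : forall c j, line_integral (fun y => c * gaussian_monomial x y j)%C (c * d_coef phi m j x)%C).
{ intros c j; apply line_integral_Cscal, line_integral_gaussian_monomial. }
unfold lead0, phase0; apply line_integral_plus; [|apply G].
apply (line_integral_Csum (fun k y => amplitude0 k x om (gaussian_monomial x y))); intros k _.
unfold amplitude0; apply line_integral_Cscal, G.
Qed.

Lemma line_integral_lead1 (x om : R) :
  line_integral (fun y => lead1 x om (gaussian_monomial x y)) (lead1 x om (dcoef x)).
Proof.
assert (G : forall c j, line_integral (fun y => c * gaussian_monomial x y j)%C (c * d_coef phi m j x)%C).
{ intros c j; apply line_integral_Cscal, line_integral_gaussian_monomial. }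
unfold lead1, phase1; apply line_integral_plus; [|apply line_integral_plus; [apply line_integral_plus|]; apply G].
apply (line_integral_Csum (fun k y => amplitude1 k x om (gaussian_monomial x y))); intros k _.
unfold amplitude1; apply line_integral_Cscal, line_integral_plus; apply G.
Qed.

(** * Parity and the leading coefficient *)

Lemma Csum_zero (f : nat -> C) (n : nat) : (forall k, (k <= n)%nat -> f k = 0%C) -> Csum f n = 0%C.
Proof.
unfold Csum; induction n as [|n IH]; intros H.
- rewrite sum_O; now apply H.
- rewrite sum_Sn, IH, H by (auto; intros; apply H; lia); change plus with Cplus; ring.
Qed.

(** The parity does not depend on [k], so the moments of all amplitude terms at a given order vanish
    together. *)
Lemma odd_offset (n k j : nat) : (2 * k <= n)%nat ->
  Nat.odd (n - 2 * k + j) = xorb (Nat.odd n) (Nat.odd j).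
Proof.
intros H; rewrite Nat.odd_add, Nat.odd_sub by exact H.
rewrite Nat.odd_mul; simpl; now destruct (Nat.odd n).
Qed.

Lemma lead0_integral_even (x om : R) : Nat.odd q = false -> lead0 x om (dcoef x) = 0%C.
Proof.
intros Hq; unfold lead0, phase0.
rewrite Csum_zero, (d_coef_odd (q + 3)).
- ring.
- rewrite Nat.odd_add, Hq; reflexivity.
- intros k Hk; unfold amplitude0; rewrite d_coef_odd; [ring|].
  rewrite odd_offset, Hq by now apply double_half_le.
  reflexivity.
Qed.

Lemma lead1_integral_odd (x om : R) : Nat.odd q = true -> lead1 x om (dcoef x) = 0%C.
Proof.
intros Hq; unfold lead1, phase1.
(* The moment of order [2 * q + 6] is even and does not cancel by symmetry; it disappears because an
   odd [q] is not zero. *)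
assert (Hs : sigma_q q = 0) by (unfold sigma_q; now destruct q).
rewrite Hs, Csum_zero, (d_coef_odd (q + 4)), (d_coef_odd (q + 6)).
- replace (0 / 2) with 0 by field; ring.
- rewrite Nat.odd_add, Hq; reflexivity.
- rewrite Nat.odd_add, Hq; reflexivity.
- intros k Hk; unfold amplitude1; rewrite !d_coef_odd; [ring | |];
    rewrite odd_offset, Hq by (now apply double_half_le); reflexivity.
Qed.

(** Puts the phase contribution into the summand of index 0, as [Cbar] does. *)
Lemma Csum_extra_first (f : nat -> C) (c : C) (n : nat) :
  Csum (fun k => f k + match k with 0 => c | S _ => 0 end)%C n = (Csum f n + c)%C.
Proof.
unfold Csum; induction n as [|n IH]; [now rewrite !sum_O|].
rewrite !sum_Sn, IH; change plus with Cplus; ring.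
Qed.

Lemma Cstar_even (x om : R) : Nat.odd q = false ->
  Cstar q phi A m om x = (Cexp (iomega om * phi x (m x)) * lead1 x om (dcoef x))%C.
Proof.
intros Hq; unfold Cstar, lead1, phase1.
rewrite <- Csum_extra_first, <- Csum_mult_l; unfold Csum; apply sum_n_ext; intros k.
match goal with |- ?u = ?v => change (@eq C u v) end.
unfold Cbar, amplitude1, kappa, Cdiv; rewrite Hq; unfold e12, e22, m1, m2; rewrite Derive_inverse, Derive2_inverse.
destruct k as [|k]; [|ring].
replace (/ Cpow (iomega om * RtoC (eta om x ^ 2)) 0)%C with (RtoC 1) by (simpl Cpow; field).
ring.
Qed.

Lemma Cstar_odd (x om : R) : Nat.odd q = true ->
  Cstar q phi A m om x = (Cexp (iomega om * phi x (m x)) * lead0 x om (dcoef x))%C.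
Proof.
intros Hq; unfold Cstar, lead0, phase0.
rewrite <- Csum_extra_first, <- Csum_mult_l; unfold Csum; apply sum_n_ext; intros k.
match goal with |- ?u = ?v => change (@eq C u v) end.
unfold Cbar, amplitude0, kappa, Cdiv; rewrite Hq; unfold e11, e21, m1; rewrite Derive_inverse.
destruct k as [|k]; [|ring].
replace (/ Cpow (iomega om * RtoC (eta om x ^ 2)) 0)%C with (RtoC 1) by (simpl Cpow; field).
ring.
Qed.

Lemma exact_beam_differentiable (x om : R) : Cdifferentiable (fun s =>
  RtoC (chi (X s - x)) * amplitude q A om x s * Cexp (iomega om * phi x s))%C.
Proof.
apply Cdifferentiable_mult; [apply Cdifferentiable_mult|apply Cdifferentiable_Cexp, Cdifferentiable_mult].
- intros s; eexists; apply Cder_RtoC.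
  apply (is_derive_Rcomp chi (fun s => X s - x)); [apply (cutoff_is_derive_n 0)|].
  apply (is_derive_minus X (fun _ => x));
    [apply X_is_derive | apply is_derive_Rconst].
- apply (Cdifferentiable_Csum (fun k s => A k x s / Cpow (iomega om) k)%C).
  intros k Hk; apply Cdifferentiable_mult; [|apply Cdifferentiable_const].
  intros s; eexists; apply (Cder_ext (fun s => Cpartial 0 0 (A k) x s)); [intros; apply Cpartial_00|].
  apply (Cpartial_der_y _ (A k) 0 0 x s (HA k Hk)); assert (D := double_half_le k Hk); lia.
- apply Cdifferentiable_const.
- intros s; eexists; apply (Cder_ext (fun s => Cpartial 0 0 phi x s)); [intros; apply Cpartial_00|].
  apply (Cpartial_der_y _ phi 0 0 x s Hphi); lia.
Qed.

Lemma beam_taylor_differentiable (x om : R) : omega0 < om ->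
  Cdifferentiable (fun s => beam_taylor q phi A X chi om x s).
Proof.
intros Ho; apply Cdifferentiable_mult;
  [apply Cdifferentiable_mult|apply Cdifferentiable_Cexp, Cdifferentiable_mult].
- intros s; eexists; apply Cder_RtoC.
  apply (is_derive_Rcomp chi (fun s => X s - x)); [apply (cutoff_is_derive_n 0)|].
  apply (is_derive_minus X (fun _ => x));
    [apply X_is_derive | apply is_derive_Rconst].
- destruct (symbol_amplitude_taylor 1 ltac:(lia)) as [_ [f' [Hf' _]]].
  intros s; exists (f' x om s); now apply Hf'.
- apply Cdifferentiable_const.
- intros s; eexists; apply phase_taylor_der_s.
Qed.

Lemma is_derive_inverse_scaled (x e y : R) :
  is_derive (fun y => m (x + e * y)) y (e * mu1 (x + e * y)).
Proof.
apply (is_derive_Rcomp m (fun y => x + e * y)); [apply inverse_is_derive|].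
eapply is_derive_val.
- apply (is_derive_plus (fun _ => x) (fun y => e * y));
    [apply is_derive_Rconst|].
  apply (is_derive_scal (fun y => y)), is_derive_id.
- unfold plus, zero, scal, one; simpl; unfold mult; simpl; ring.
Qed.

Lemma mu1_scaled_differentiable (x e : R) : Cdifferentiable (fun y => RtoC (mu1 (x + e * y))).
Proof.
intros y; eexists; apply Cder_RtoC.
apply (is_derive_Rcomp mu1 (fun y => x + e * y)); [apply mu1_is_derive|].
apply (is_derive_plus (fun _ => x) (fun y => e * y)); [apply is_derive_Rconst|].
apply (is_derive_scal (fun y => y)), is_derive_id.
Qed.

(** Both beams have compact support in [s], so the improper integrals are integrals between
    [m (x - alpha)] and [m (x + alpha)]. The substitution is made on a finite interval, and the
    result is then read as an integral over the line again. *)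
Lemma taylor_error_integral (x om : R) : omega0 < om -> exists l,
  taylor_error q phi A X chi om x = (RtoC (sqrt om) * l)%C /\
  line_integral (fun y => RtoC (eta om x) * beam_difference x om y)%C l.
Proof.
intros Ho; assert (He := eta_pos x om Ho).
set (f := fun s => (RtoC (chi (X s - x)) * amplitude q A om x s * Cexp (iomega om * phi x s))%C).
set (g := fun s => beam_taylor q phi A X chi om x s).
set (d := fun s => (f s + RtoC (-1) * g s)%C).
set (a := m (x - alpha)); set (b := m (x + alpha)).
assert (Hab : a <= b) by (apply inverse_increasing; lra).
assert (Df : Cdifferentiable f) by apply exact_beam_differentiable.
assert (Dg : Cdifferentiable g) by now apply beam_taylor_differentiable.
assert (Dd : Cdifferentiable d).
{ apply Cdifferentiable_plus; [exact Df|].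
  apply Cdifferentiable_mult; [apply Cdifferentiable_const | exact Dg]. }
assert (Zf : forall s, s < a \/ b < s -> f s = 0%C).
{ intros s Hs; unfold f; rewrite (cutoff_zero _ _ Hchi) by now apply outside_cutoff. ring. }
assert (Zg : forall s, s < a \/ b < s -> g s = 0%C).
{ intros s Hs; unfold g, beam_taylor; rewrite (cutoff_zero _ _ Hchi) by now apply outside_cutoff. ring. }
assert (Zd : forall s, s < a \/ b < s -> d s = 0%C).
{ intros s Hs; unfold d; rewrite Zf, Zg by exact Hs; ring. }
assert (If : line_integral f (RInt (V := CR) f a b))
  by exact (is_RInt_gen_line_compact f a b Hab (Cdifferentiable_ex_RInt f a b Df) Zf).
assert (Ig : line_integral g (RInt (V := CR) g a b))
  by exact (is_RInt_gen_line_compact g a b Hab (Cdifferentiable_ex_RInt g a b Dg) Zg).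
assert (Id : line_integral d (RInt (V := CR) d a b))
  by exact (is_RInt_gen_line_compact d a b Hab (Cdifferentiable_ex_RInt d a b Dd) Zd).
exists (RInt (V := CR) d a b); split.
- assert (E := line_integral_unique _ _ _ Id
    (line_integral_plus _ _ _ _ If (line_integral_Cscal _ _ (RtoC (-1)) Ig))).
  rewrite E; change (taylor_error q phi A X chi om x)
    with (RtoC (sqrt om) * CRInt_line f - RtoC (sqrt om) * CRInt_line g)%C.
  rewrite (CRInt_line_unique f _ If), (CRInt_line_unique g _ Ig).
  assert (H : forall s u v : C, (s * u - s * v)%C = (s * (u + RtoC (-1) * v))%C) by (intros; ring).
  apply H.
(* The size of the cut-off measured in beam widths. *)
- set (c := alpha / eta om x).
  assert (Hc : 0 < c) by (apply Rdiv_lt_0_compat; lra).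
  assert (Hec : eta om x * c = alpha) by (unfold c; field; lra).
  assert (S : is_RInt (V := CR) (fun y => scal (eta om x * mu1 (x + eta om x * y))
      (d (m (x + eta om x * y)))) (- c) c (RInt (V := CR) d a b)).
  { replace a with (m (x + eta om x * (- c))) by (unfold a; f_equal; nra).
    replace b with (m (x + eta om x * c)) by (unfold b; f_equal; nra).
    apply (is_RInt_comp (V := CR) d (fun y => m (x + eta om x * y))).
    - intros y _; now apply Cdifferentiable_continuous.
    - intros y _; split; [apply is_derive_inverse_scaled|].
      apply (continuous_mult (K := R_AbsRing)); [apply continuous_const|].
      exact (proj1 (Ccontinuous_proj _ _ (Cdifferentiable_continuous _ y (mu1_scaled_differentiable x _)))). }
  assert (E : forall y, (scal (V := CR) (eta om x * mu1 (x + eta om x * y))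
      (d (m (x + eta om x * y))) : C) = (RtoC (eta om x) * beam_difference x om y)%C).
  { intros y; unfold beam_difference, d, f, g.
    rewrite scal_CR, RtoC_mult; ring. }
  assert (S' : is_RInt (V := CR) (fun y => RtoC (eta om x) * beam_difference x om y)%C
      (- c) c (RInt (V := CR) d a b)).
  { refine (is_RInt_ext (V := CR) _ _ _ _ _ _ S); intros y _; apply E. }
  assert (Z : forall y, y < - c \/ c < y -> (RtoC (eta om x) * beam_difference x om y)%C = 0%C).
  { intros y Hy; unfold beam_difference, beam_taylor; rewrite !HXm.
    replace (x + eta om x * y - x) with (eta om x * y) by ring.
    rewrite (cutoff_zero _ _ Hchi); [ring|].
    rewrite Rabs_mult, (Rabs_pos_eq (eta om x)) by lra.
    assert (c < Rabs y).
    { destruct Hy as [Hy|Hy]; [rewrite Rabs_left | rewrite Rabs_pos_eq]; lra. }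
    nra. }
  assert (G := is_RInt_gen_line_compact _ (- c) c ltac:(lra) (ex_intro _ _ S') Z).
  rewrite (is_RInt_unique (V := CR) _ _ _ _ S') in G; exact G.
Qed.

(** * Bounds for the integrated expansion *)

Lemma gaussian_dominated (n : nat) (f : R -> R -> R -> C) : order False (/ 4) n f ->
  exists K, 0 <= K /\ forall x om y, omega0 < om ->
    Cmod (f x om y) <= K * eta om x ^ n / (1 + y ^ 2).
Proof.
intros [K [M [HK H]]].
destruct (polynomial_gaussian (/ 4) M ltac:(lra)) as [K' [HK' HG]].
exists (K * K'); split; [now apply Rmult_le_pos|].
intros x om y Ho; eapply Rle_trans; [apply H; [exact Ho | easy]|].
assert (G := HG (Rabs y) (Rabs_pos y)); rewrite pow2_abs in G.
rewrite Rmult_assoc; unfold Rdiv.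
replace (K * K' * eta om x ^ n * / (1 + y ^ 2))
  with (K * eta om x ^ n * (K' / (1 + y ^ 2))) by (unfold Rdiv; ring).
apply Rmult_le_compat_l; [|exact G].
apply Rmult_le_pos; [exact HK | apply pow_le; left; now apply eta_pos].
Qed.

(* Outside the cut-off any power of [eta * |y| / alpha >= 1] may be inserted, so that a
   bound on the support of the cut-off propagates to the whole line. *)
Lemma order_extend (g : R) (n k : nat) (f h : R -> R -> R -> C) :
  order True g (n + k) f -> order False g n h ->
  (forall x om y, omega0 < om -> alpha < Rabs (eta om x * y) -> f x om y = h x om y) ->
  order False g (n + k) f.
Proof.
intros [K1 [M1 [HK1 H1]]] [K2 [M2 [HK2 H2]]] E.
assert (Ha : 0 < alpha ^ k) by (apply pow_lt; lra).
assert (HK3 : 0 <= K2 / alpha ^ k) by (apply Rdiv_le_0_compat; lra).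
exists (K1 + K2 / alpha ^ k), (M1 + (M2 + k))%nat; split; [lra|].
intros x om y Ho _; assert (He := eta_pos x om Ho).
assert (P := Rabs_pos y).
assert (Pe : forall j, 0 <= eta om x ^ j) by (intros; apply pow_le; lra).
assert (Py : forall j, 0 <= (1 + Rabs y) ^ j) by (intros; apply pow_le; lra).
assert (Mon : forall i j, (i <= j)%nat -> (1 + Rabs y) ^ i <= (1 + Rabs y) ^ j)
  by (intros; apply Rle_pow; [lra | assumption]).
destruct (Rle_dec (Rabs (eta om x * y)) alpha) as [Hy|Hy].
- eapply Rle_trans; [apply H1; [exact Ho | now intros]|].
  apply Rmult_le_compat_r; [left; apply exp_pos|].
  apply Rmult_le_compat; [now apply Rmult_le_pos | apply Py | | apply Mon; lia].
  apply Rmult_le_compat_r; [apply Pe | lra].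
- rewrite E by (exact Ho || lra).
  eapply Rle_trans; [apply H2; [exact Ho | easy]|].
  apply Rmult_le_compat_r; [left; apply exp_pos|].
  apply Rle_trans with (K2 / alpha ^ k * eta om x ^ (n + k) * (1 + Rabs y) ^ (M2 + k)).
  + rewrite !pow_add.
    assert (Q : alpha ^ k <= eta om x ^ k * (1 + Rabs y) ^ k).
    { rewrite <- Rpow_mult_distr; apply pow_incr; split; [lra|].
      rewrite Rabs_mult, (Rabs_pos_eq (eta om x)) in Hy by lra; nra. }
    replace (K2 / alpha ^ k * (eta om x ^ n * eta om x ^ k) * ((1 + Rabs y) ^ M2 * (1 + Rabs y) ^ k))
      with (K2 * eta om x ^ n * (1 + Rabs y) ^ M2 * (eta om x ^ k * (1 + Rabs y) ^ k / alpha ^ k))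
      by (field; lra).
    rewrite <- (Rmult_1_r (K2 * eta om x ^ n * (1 + Rabs y) ^ M2)) at 1.
    apply Rmult_le_compat_l.
    * apply Rmult_le_pos; [now apply Rmult_le_pos | apply Py].
    * apply (Rmult_le_reg_r (alpha ^ k)); [exact Ha|].
      unfold Rdiv; rewrite Rmult_assoc, Rinv_l, Rmult_1_l, Rmult_1_r by lra; exact Q.
  + apply Rmult_le_compat; [apply Rmult_le_pos; [exact HK3 | apply Pe] | apply Py | | apply Mon; lia].
    apply Rmult_le_compat_r; [apply Pe | lra].
Qed.

Lemma lead_integral_bound : exists K, 0 <= K /\ forall x om, omega0 < om ->
  Cmod (lead0 x om (dcoef x)) <= K /\ Cmod (lead1 x om (dcoef x)) <= K.
Proof.
destruct expansion_beam_difference as [L0 [L1 _]].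
replace (S (q + 1)) with (q + 2)%nat in L1 by lia.
destruct (gaussian_dominated _ _ L0) as [K0 [HK0 D0]].
destruct (gaussian_dominated _ _ L1) as [K1 [HK1 D1]].
assert (HPI := PI_RGT_0).
assert (B : forall K n x om (f : R -> C) l, 0 <= K -> omega0 < om -> Cdifferentiable f ->
  line_integral f l ->
  (forall y, Cmod (RtoC (eta om x ^ n) * f y)%C <= K * eta om x ^ n / (1 + y ^ 2)) ->
  Cmod l <= K * PI).
{ intros K n x om f l HK Ho Hf Hl H; assert (He := eta_pos x om Ho).
  destruct (is_RInt_gen_line_dominated f K) as [l' [Hl' Hb]].
  - intros a b; now apply Cdifferentiable_ex_RInt.
  - intros y; assert (Hy := H y); rewrite Cmod_mult, Cmod_R in Hy.
    assert (Hn : 0 < eta om x ^ n) by now apply pow_lt.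
    rewrite Rabs_pos_eq in Hy by lra.
    apply (Rmult_le_reg_l (eta om x ^ n)); [exact Hn|].
    eapply Rle_trans; [exact Hy|]; right; unfold Rdiv; ring.
  - now rewrite (line_integral_unique _ _ _ Hl Hl'). }
exists (K0 * PI + K1 * PI); split; [nra|].
intros x om Ho; split.
- assert (E : Cmod (lead0 x om (dcoef x)) <= K0 * PI); [|nra].
  apply (B K0 (q + 1)%nat x om (fun y => lead0 x om (gaussian_monomial x y))); auto.
  + apply lead0_differentiable.
  + apply line_integral_lead0.
- assert (E : Cmod (lead1 x om (dcoef x)) <= K1 * PI); [|nra].
  apply (B K1 (q + 2)%nat x om (fun y => lead1 x om (gaussian_monomial x y))); auto.
  + apply lead1_differentiable.
  + apply line_integral_lead1.
Qed.

Lemma Cmod_ray_phase (x om : R) : Cmod (Cexp (iomega om * phi x (m x))%C) = 1.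
Proof. rewrite Cmod_Cexp, Re_iomega_mult, phase_ray_value_real, Rmult_0_r, Ropp_0; apply exp_0. Qed.

Lemma Cstar_bound : exists K, 0 <= K /\ forall x om, omega0 < om ->
  Cmod (Cstar q phi A m om x) <= K.
Proof.
destruct lead_integral_bound as [K [HK HB]]; exists K; split; [exact HK|].
intros x om Ho; destruct (HB x om Ho) as [B0 B1].
destruct (Nat.odd q) eqn:E; [rewrite Cstar_odd | rewrite Cstar_even]; auto;
  rewrite Cmod_mult, Cmod_ray_phase, Rmult_1_l; assumption.
Qed.

(** The Jacobian of the rescaling raises the two orders to [q + 2] and [q + 3], and parity keeps
    exactly one of them. It is [qstar q + 1] in both cases. *)
Lemma Cstar_lead_integral (x om : R) :
  (Cexp (iomega om * phi x (m x)) * (RtoC (eta om x ^ (q + 2)) * lead0 x om (dcoef x)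
     + RtoC (eta om x ^ (q + 3)) * lead1 x om (dcoef x))
   = Cstar q phi A m om x * RtoC (eta om x ^ (qstar q + 1)))%C.
Proof.
unfold qstar; rewrite <- Nat.negb_odd; destruct (Nat.odd q) eqn:E; simpl negb; cbv iota.
- rewrite Cstar_odd, lead1_integral_odd by exact E.
  replace (q + 1 + 1)%nat with (q + 2)%nat by lia; ring.
- rewrite Cstar_even, lead0_integral_even by exact E.
  replace (q + 2 + 1)%nat with (q + 3)%nat by lia; ring.
Qed.

Lemma taylor_error_leading_term : exists K, 0 <= K /\ forall x om, omega0 < om ->
  Cmod (taylor_error q phi A X chi om x
        - Cstar q phi A m om x * RtoC (sqrt om * eta om x ^ (qstar q + 1)))%C
  <= K * (sqrt om * eta om x ^ (qstar q + 2)).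
Proof.
destruct expansion_beam_difference as [L0 [L1 R]].
set (F := fun x om y => (Csum (fun k => amplitude_error_term k x om y) (q / 2)
                    + phase_error_term x om y)%C) in *.
set (L := fun x om y => (RtoC (eta om x ^ (q + 1)) * lead0 x om (gaussian_monomial x y)
                   + RtoC (eta om x ^ (q + 2)) * lead1 x om (gaussian_monomial x y))%C).
assert (HL : order False (/ 4) (q + 1) L).
{ apply (order_plus _ _ _ _ _ L0); now apply (order_lower _ _ (S (q + 1))); [lia|]. }
(* Off the support the beams vanish and the difference is [- L], of order [q + 1] only. The two
   missing powers of the beam width are recovered there by [order_extend]. *)
assert (HR : order False (/ 4) (q + 3) (fun x om y => F x om y - L x om y)%C).
{ replace (q + 3)%nat with ((q + 1) + 2)%nat by lia.
  apply (order_extend _ _ _ _ (fun x om y => RtoC (-1) * L x om y)%C).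
  - replace (q + 1 + 2)%nat with (S (S (q + 1))) by lia; exact R.
  - assert (C1 : order False 0 0 (fun _ _ _ => RtoC (-1))).
    { apply (order_coefficient False (fun _ _ => RtoC (-1)) 1).
      intros; rewrite Cmod_R, Rabs_left; lra. }
    assert (P := order_mult _ _ _ _ _ _ HL C1); rewrite Nat.add_0_r in P.
    revert P; apply order_ext; intros; ring.
  - intros x om y Ho Hy; unfold F, phase_error_term.
    rewrite Csum_zero.
    + rewrite (cutoff_zero _ _ Hchi) by exact Hy; ring.
    + intros k _; unfold amplitude_error_term.
      rewrite (cutoff_zero _ _ Hchi) by exact Hy; ring. }
destruct (gaussian_dominated _ _ HR) as [K [HK HD]].
assert (HPI := PI_RGT_0); assert (Hmax := eta_max_pos).
(* The remainder is of order [q + 4] whatever the parity. For even [q] this is [qstar q + 2]; for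
   odd [q] it is one power better than claimed, and [eta_max] absorbs the surplus. *)
exists (K * PI * (1 + eta_max)); split; [apply Rmult_le_pos; [apply Rmult_le_pos|]; lra|].
intros x om Ho; assert (He := eta_pos x om Ho).
assert (Hs := sqrt_omega_pos omega0 Homega0 om Ho).
destruct (taylor_error_integral x om Ho) as [l [-> Hl]].
set (e := Cexp (iomega om * phi x (m x))).
assert (He1 : Cmod e = 1) by apply Cmod_ray_phase.
set (J := (Cstar q phi A m om x * RtoC (eta om x ^ (qstar q + 1)))%C).
assert (HJ : line_integral (fun y => RtoC (eta om x) * (e * L x om y))%C J).
{ unfold J; rewrite <- Cstar_lead_integral; fold e.
  assert (I := line_integral_Cscal _ _ (RtoC (eta om x)) (line_integral_Cscal _ _ e
    (line_integral_plus _ _ _ _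
      (line_integral_Cscal _ _ (RtoC (eta om x ^ (q + 1))) (line_integral_lead0 x om))
      (line_integral_Cscal _ _ (RtoC (eta om x ^ (q + 2))) (line_integral_lead1 x om))))).
  replace (e * _)%C with (RtoC (eta om x) * (e * (RtoC (eta om x ^ (q + 1)) * lead0 x om (dcoef x)
     + RtoC (eta om x ^ (q + 2)) * lead1 x om (dcoef x))))%C; [exact I|].
  replace (q + 3)%nat with (q + 1 + 1 + 1)%nat by lia; replace (q + 2)%nat with (q + 1 + 1)%nat by lia.
  rewrite !(pow_add (eta om x) _ 1), !pow_1, !RtoC_mult; ring. }
assert (HDiff : line_integral (fun y => RtoC (eta om x) * (e * (F x om y - L x om y)))%C (l - J)%C).
{ assert (I := line_integral_plus _ _ _ _ Hl (line_integral_Cscal _ _ (RtoC (-1)) HJ)).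
  replace (l - J)%C with (l + RtoC (-1) * J)%C by ring.
  revert I; apply line_integral_ext; intros y; rewrite beam_difference_eq; fold e; unfold F; ring. }
assert (Bd : Cmod (l - J)%C <= K * eta om x ^ (q + 4) * PI).
{ destruct (is_RInt_gen_line_dominated
    (fun y => RtoC (eta om x) * (e * (F x om y - L x om y)))%C (K * eta om x ^ (q + 4)))
    as [l' [Hl' Hb]].
  - intros a b; apply Cdifferentiable_ex_RInt.
    apply Cdifferentiable_mult; [apply Cdifferentiable_const|].
    apply (Cdifferentiable_ext (fun y => beam_difference x om y + RtoC (-1) * (e * L x om y))%C).
    + intros y; rewrite beam_difference_eq; fold e; unfold F; ring.
    + assert (Hg : Cdifferentiable (fun y => L x om y)).
      { apply Cdifferentiable_plus; (apply Cdifferentiable_mult; [apply Cdifferentiable_const|]);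
          [apply lead0_differentiable | apply lead1_differentiable]. }
      apply Cdifferentiable_plus; [|do 2 (apply Cdifferentiable_mult; [apply Cdifferentiable_const|]);
        exact Hg].
      assert (Hc : forall h, Cdifferentiable h -> Cdifferentiable (fun y => h (m (x + eta om x * y)))).
      { intros h Hh y; destruct (Hh (m (x + eta om x * y))) as [dh Hdh].
        eexists; apply (Cder_comp h (fun y => m (x + eta om x * y))); [exact Hdh|].
        apply is_derive_inverse_scaled. }
      apply Cdifferentiable_mult; [apply mu1_scaled_differentiable|].
      apply (Cdifferentiable_ext (fun y =>
          RtoC (chi (X (m (x + eta om x * y)) - x)) * amplitude q A om x (m (x + eta om x * y)%R)
            * Cexp (iomega om * phi x (m (x + eta om x * y)%R))
          + RtoC (-1) * beam_taylor q phi A X chi om x (m (x + eta om x * y)%R))%C);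
          [intros y; ring|].
        apply Cdifferentiable_plus; [apply (Hc _ (exact_beam_differentiable x om))|].
        apply Cdifferentiable_mult; [apply Cdifferentiable_const|].
        apply (Hc _ (beam_taylor_differentiable x om Ho)).
  - intros y; rewrite !Cmod_mult, He1, Rmult_1_l, Cmod_R, Rabs_pos_eq by lra.
    eapply Rle_trans; [apply Rmult_le_compat_l; [lra | apply (HD x om y Ho)]|].
    right; replace (q + 4)%nat with (1 + (q + 3))%nat by lia.
    rewrite (pow_add _ 1 (q + 3)), pow_1; unfold Rdiv; ring.
  - now rewrite (line_integral_unique _ _ _ HDiff Hl'). }
replace (RtoC (sqrt om) * l - Cstar q phi A m om x
    * RtoC (sqrt om * eta om x ^ (qstar q + 1)))%C
  with (RtoC (sqrt om) * (l - J))%C by (unfold J; rewrite RtoC_mult; ring).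
rewrite Cmod_mult, Cmod_R, Rabs_pos_eq by lra.
replace (K * PI * (1 + eta_max) * (sqrt om * eta om x ^ (qstar q + 2)))
  with (sqrt om * (K * PI * ((1 + eta_max) * eta om x ^ (qstar q + 2)))) by ring.
apply Rmult_le_compat_l; [lra|].
eapply Rle_trans; [exact Bd|].
replace (K * eta om x ^ (q + 4) * PI) with (K * PI * eta om x ^ (q + 4)) by ring.
apply Rmult_le_compat_l; [apply Rmult_le_pos; lra|].
assert (Hle := eta_le_max x om Ho).
unfold qstar; destruct (Nat.even q).
- replace (q + 2 + 2)%nat with (q + 4)%nat by lia.
  assert (0 <= eta om x ^ (q + 4)) by (apply pow_le; lra); nra.
- replace (q + 1 + 2)%nat with (q + 3)%nat by lia.
  replace (q + 4)%nat with (1 + (q + 3))%nat by lia; rewrite (pow_add _ 1), pow_1.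
  apply Rmult_le_compat_r; [apply pow_le|]; lra.
Qed.

(** * Assembly of the estimates *)

Lemma inverse_sqrt_power (om : R) (n : nat) : 0 < om ->
  (/ sqrt om) ^ n = Rpower om (- (INR n / 2)).
Proof.
intros Ho; rewrite Rpower_Ropp, pow_inv; f_equal.
rewrite <- Rpower_sqrt, <- Rpower_pow by (exact Ho || apply exp_pos).
rewrite Rpower_mult; f_equal; field.
Qed.

Lemma beam_width_scaling (n : nat) (x om : R) : omega0 < om ->
  sqrt om * eta om x ^ (n + 1)
  = Rpower om (- (INR n / 2)) * (/ sqrt (im_phi_xx phi x (m x))) ^ (n + 1).
Proof.
intros Ho; assert (Hs := sqrt_omega_pos omega0 Homega0 om Ho).
destruct (im_phi_xx_bounds x) as [L _].
assert (Hi : 0 < sqrt (im_phi_xx phi x (m x))) by (apply sqrt_lt_R0; lra).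
rewrite <- inverse_sqrt_power by lra.
unfold beam_width; rewrite sqrt_mult, Rinv_mult, Rpow_mult_distr by lra.
rewrite (pow_add (/ sqrt om) n 1), pow_1; field; lra.
Qed.

(** The bound on the Taylor error follows from its leading term and the remainder, the latter being
    smaller by a factor at most [eta_max]. The clauses with [K''] give a meaning to the order of
    magnitude of the leading term: a bounded coefficient, and a scale comparable from both sides
    with [omega ^ (- qstar q / 2)]. *)
Lemma superposition_estimates (p : nat) : N = (p + 1)%nat ->
  exists K K' K'' : R, 0 < K'' /\
  forall x om h : R, omega0 < om -> 0 < h ->
  let ET := taylor_error q phi A X chi om x in
  let ED := discretization_error q phi A X chi om h x in
  let eta := beam_width phi m om x in
  let Cst := Cstar q phi A m om x in
  Cmod (u_exact q phi A X chi om x - u_discrete q phi A X chi om h x)%C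
    <= Cmod ET + Cmod ED /\
  Cmod ET <= K * Rpower om (- (INR (qstar q) / 2)) /\
  Cmod ED <= K * (h / eta) ^ p /\
  Cmod (ET - Cst * RtoC (sqrt om * eta ^ (qstar q + 1)))%C
    <= K' * (sqrt om * eta ^ (qstar q + 2)) /\
  (Cmod Cst <= K'' /\
   / K'' * Rpower om (- (INR (qstar q) / 2))
     <= sqrt om * eta ^ (qstar q + 1)
     <= K'' * Rpower om (- (INR (qstar q) / 2))).
Proof.
intros HNp.
destruct discretization_bound as [KD [HKD BD]].
destruct taylor_error_leading_term as [K' [HK' BT]].
destruct Cstar_bound as [KC [HKC BC]].
assert (HCI := CI_pos); assert (Hmax := eta_max_pos).
set (n := qstar q).
(* After the powers of [omega] are separated, the scale of the leading term is a power of
   [/ sqrt im_phi_xx], which lies between [/ V] and [U]. *)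
set (U := (/ sqrt cI) ^ (n + 1)); set (V := sqrt CI ^ (n + 1)).
assert (HscI : 0 < sqrt cI) by now apply sqrt_lt_R0.
assert (HsCI : 0 < sqrt CI) by now apply sqrt_lt_R0.
assert (HU : 0 < U) by (apply pow_lt, Rinv_0_lt_compat, HscI).
assert (HV : 0 < V) by now apply pow_lt.
set (K'' := KC + U + V).
(* One constant serves both errors: [KD] is for the discretization; for the Taylor error, [KC]
   bounds the coefficient, [K' * eta_max] its correction, and [U] converts the beam width into a
   power of [omega]. *)
exists (KD + (KC + K' * eta_max) * U), K', K''; split; [unfold K''; lra|].
intros x om h Ho Hh; cbv zeta.
assert (He := eta_pos x om Ho); assert (Hle := eta_le_max x om Ho).
assert (Hs := sqrt_omega_pos omega0 Homega0 om Ho).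
destruct (im_phi_xx_bounds x) as [L1 L2].
set (P := Rpower om (- (INR n / 2))); assert (HP : 0 < P) by apply exp_pos.
assert (Hw : / V <= (/ sqrt (im_phi_xx phi x (m x))) ^ (n + 1) <= U).
{ assert (S1 : sqrt cI <= sqrt (im_phi_xx phi x (m x))) by (apply sqrt_le_1_alt; lra).
  assert (S2 : sqrt (im_phi_xx phi x (m x)) <= sqrt CI) by (apply sqrt_le_1_alt; lra).
  unfold V, U; rewrite <- pow_inv; split; apply pow_incr; split.
  - left; now apply Rinv_0_lt_compat.
  - apply Rinv_le_contravar; lra.
  - left; apply Rinv_0_lt_compat; lra.
  - apply Rinv_le_contravar; lra. }
assert (Hsc := beam_width_scaling n x om Ho); fold P in Hsc.
assert (Hup : sqrt om * eta om x ^ (n + 1) <= U * P) by (rewrite Hsc; nra).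
assert (HT := BT x om Ho); fold n in HT.
assert (HC := BC x om Ho).
assert (HKm : 0 <= K' * eta_max) by (apply Rmult_le_pos; lra).
split; [|split; [|split; [|split; [|split]]]].
- replace (u_exact q phi A X chi om x - u_discrete q phi A X chi om h x)%C
    with (taylor_error q phi A X chi om x + discretization_error q phi A X chi om h x)%C
    by (unfold taylor_error, discretization_error; ring).
  apply Cmod_triangle.
- set (E := taylor_error q phi A X chi om x) in *.
  set (Cst := Cstar q phi A m om x) in *.
  set (t := sqrt om * eta om x ^ (n + 1)) in *.
  assert (Ht : 0 <= t) by (apply Rmult_le_pos; [lra | apply pow_le; lra]).
  assert (HE : Cmod E <= Cmod (E - Cst * RtoC t)%C + Cmod (Cst * RtoC t)%C).
  { replace E with ((E - Cst * RtoC t) + Cst * RtoC t)%C at 1 by ring; apply Cmod_triangle. }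
  rewrite Cmod_mult, Cmod_R, (Rabs_pos_eq t Ht) in HE.
  assert (HT2 : sqrt om * eta om x ^ (n + 2) <= eta_max * t).
  { unfold t; replace (n + 2)%nat with (1 + (n + 1))%nat by lia.
    rewrite (pow_add _ 1 (n + 1)), pow_1.
    assert (0 <= sqrt om * eta om x ^ (n + 1)) by exact Ht; nra. }
  assert (B1 : K' * (sqrt om * eta om x ^ (n + 2)) <= K' * eta_max * t).
  { rewrite Rmult_assoc; now apply Rmult_le_compat_l. }
  assert (B2 : Cmod Cst * t <= KC * t) by now apply Rmult_le_compat_r.
  assert (B3 : (KC + K' * eta_max) * t <= (KC + K' * eta_max) * (U * P))
    by (apply Rmult_le_compat_l; [lra | exact Hup]).
  assert (B4 : 0 <= KD * P) by (apply Rmult_le_pos; lra).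
  lra.
- assert (HD := BD x om h Ho Hh).
  replace (N - 1)%nat with p in HD by lia.
  eapply Rle_trans; [exact HD|]; apply Rmult_le_compat_r.
  + apply pow_le, Rdiv_le_0_compat; lra.
  + assert (0 <= (KC + K' * eta_max) * U) by (apply Rmult_le_pos; lra); lra.
- exact HT.
- unfold K''; lra.
- rewrite Hsc; split.
  + rewrite (Rmult_comm P); apply Rmult_le_compat_r; [lra|].
    apply Rle_trans with (/ V); [|apply Hw].
    apply Rinv_le_contravar; [exact HV | unfold K''; lra].
  + rewrite (Rmult_comm P); apply Rmult_le_compat_r; [lra|].
    apply Rle_trans with U; [apply Hw | unfold K''; lra].
Qed.

End Discretization.

End Phase.

End InverseFunction.

(** Each amplitude comes with its own bound; as there are finitely many of them, monotonicity in the
    bound yields a common one. *)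
Lemma bound_uniform_in_index (B : nat -> R -> Prop) (n : nat) :
  (forall k M M', M <= M' -> B k M -> B k M') ->
  (forall k, (k <= n)%nat -> exists M, B k M) -> exists M, forall k, (k <= n)%nat -> B k M.
Proof.
intros Hmon; induction n as [|n IH]; intros H.
- destruct (H 0%nat (Nat.le_refl 0)) as [M HM]; exists M; intros k Hk.
  now replace k with 0%nat by lia.
- destruct IH as [M1 H1]; [intros; apply H; lia|].
  destruct (H (S n) (Nat.le_refl _)) as [M2 H2].
  exists (Rmax M1 M2); intros k Hk.
  destruct (Nat.eq_dec k (S n)) as [->|Hne].
  + apply (Hmon _ M2); [apply Rmax_r | exact H2].
  + apply (Hmon _ M1); [apply Rmax_l | apply H1; lia].
Qed.

Theorem theorem1 :
  forall (p q : nat) (ystar : R) (c : R -> R -> R) (x0 : R -> R * R)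
    (ray : R -> R -> R * R) (Phi : R -> R -> R -> C) (X tX m : R -> R),
  let phi := fun x s => Phi x ystar s in
  (2 <= p)%nat ->
  is_beam_phase c x0 ray Phi ->
  meets_line ystar ray phi X tX ->
  smooth_phase p q ray phi X ->
  polynomial_growth (p + q + 4) phi X ->
  no_caustics X ->
  beam_convexity phi X ->
  (forall x, X (m x) = x) ->
  (forall s, m (X s) = s) ->
  exists alpha0 : R, 0 < alpha0 /\
  forall (Amp : nat -> R -> R -> R -> C) (omega0 alpha : R) (chi : R -> R),
  let A := fun k x s => Amp k x ystar s in
  are_beam_amplitudes (q / 2) ray Phi Amp ->
  smooth_amplitudes p q A ->
  0 < omega0 ->
  0 < alpha <= alpha0 ->
  is_cutoff alpha chi ->
  exists K K' K'' : R, 0 < K'' /\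
  forall x omega h : R, omega0 < omega -> 0 < h ->
  let ET := taylor_error q phi A X chi omega x in
  let ED := discretization_error q phi A X chi omega h x in
  let eta := beam_width phi m omega x in
  let Cst := Cstar q phi A m omega x in
  Cmod (u_exact q phi A X chi omega x - u_discrete q phi A X chi omega h x)%C
    <= Cmod ET + Cmod ED /\
  Cmod ET <= K * Rpower omega (- (INR (qstar q) / 2)) /\
  Cmod ED <= K * (h / eta) ^ p /\
  Cmod (ET - Cst * RtoC (sqrt omega * eta ^ (qstar q + 1)))%C
    <= K' * (sqrt omega * eta ^ (qstar q + 2)) /\
  (Cmod Cst <= K'' /\
   / K'' * Rpower omega (- (INR (qstar q) / 2))
     <= sqrt omega * eta ^ (qstar q + 1)
     <= K'' * Rpower omega (- (INR (qstar q) / 2))).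
Proof.
intros p q ystar c x0 ray Phi X tX m phi Hp _ Hline Hsmooth Hgrow Hcaus Hconv HXm HmX.
destruct Hsmooth as [Hphi _ _ HX [MX HXb]].
destruct Hgrow as [M [pbar [HM Hgrow]]].
destruct Hcaus as [cX [CX [HcX HXbounds]]].
destruct Hconv as [cI [CI [HcI Hconv]]].
destruct Hline as [_ Hon Hx Hs].
assert (HN : (3 <= p + 1)%nat) by lia.
assert (Hdeg : (p + q + 4)%nat = (p + 1 + q + 3)%nat) by lia.
rewrite Hdeg in Hphi, Hgrow.
assert (HXlow : forall s, cX <= Derive X s) by (intros s; apply HXbounds).
assert (Hnear : forall j k, (j + k <= p + 1 + q + 3)%nat -> forall x s,
  Rabs (X s - x) <= 1 -> Cmod (Cpartial j k phi x s) <= 2 * M).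
(* Within distance 1 of the ray the polynomial factor [1 + Rabs (x - X s) ^ pbar] is at most 2,
   whatever the degree. The cut-off size never exceeds 1, so growth farther away does not matter. *)
{ intros j k Hjk x s Hxs; eapply Rle_trans; [now apply Hgrow|].
  rewrite Rabs_minus_sym in Hxs.
  assert (Rabs (x - X s) ^ pbar <= 1).
  { rewrite <- (pow1 pbar); apply pow_incr; split; [apply Rabs_pos | exact Hxs]. }
  nra. }
assert (Hreal : forall s, Im (phi (X s) s) = 0) by (intros s; now rewrite Hon).
(* Convexity concerns the phase and the rays only, so the threshold for the cut-off is fixed before
   the amplitudes and [omega0] are introduced. *)
destruct (phase_convex (p + 1) X m MX cX HN HX HXb HcX HXlow HXm q phi (2 * M) cI CI
  Hphi Hnear Hreal Hx Hs HcI Hconv) as [alpha0 [[Ha0 Ha1] Hconvex]].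
exists alpha0; split; [exact Ha0|].
intros Amp omega0 alpha chi A _ HA Homega0 Halpha Hchi.
destruct (bound_uniform_in_index (fun k M => forall i j, (i + j <= p + 1 + q + 1 - 2 * k)%nat ->
  forall x s, Cmod (Cpartial i j (A k) x s) <= M) (q / 2)) as [MA HMA].
{ intros k B B' HB H i j Hij x s; eapply Rle_trans; [now apply H | exact HB]. }
{ intros k Hk; destruct (HA k Hk) as [_ [B HB]]; exists B; intros i j Hij.
  apply HB; lia. }
apply (superposition_estimates (p + 1) X m MX cX HN HX HXb HcX HXlow HXm q phi (2 * M) cI CI
  Hphi Hnear HmX Hreal Hx Hs HcI Hconv A MA chi alpha omega0); auto.
- intros k Hk; replace (p + 1 + q + 1 - 2 * k)%nat with (p + q + 2 - 2 * k)%nat by lia.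
  apply (HA k Hk).
- lra.
- intros x z Hz; apply Hconvex; lra.
Qed.
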